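(* Let $H$ be an arbitrary entire harmonic function on $\mathbb{R}^2$. Set $H_1(\mathbf{x})=\nabla H(\mathbf{0})\cdot\mathbf{x}$ and $H_2(\mathbf{x})=H(\mathbf{x})-H_1(\mathbf{x})$. Let $0<k_i<\infty$, $0<k_e<\infty$, $k_e\neq1$, and $\sigma=k_i\chi(B_i)+k_e\chi(B_e\setminus B_i)+\chi(\mathbb{R}^2\setminus B_e)$. Then the solution $u$ of $$\nabla\cdot\sigma\nabla u=0\ \text{ in }\mathbb{R}^2,\qquad u(\mathbf{x})-H(\mathbf{x})=O(|\mathbf{x}|^{-1})\ \text{ as }|\mathbf{x}|\to\infty$$ has the decomposition $$u(\mathbf{x})=u_1(\mathbf{x})+u_2(\mathbf{x}),\qquad\mathbf{x}\in\mathbb{R}^2,$$ where $u_1$ and $u_2$ are the solutions of the same problem with $H_1$ and $H_2$, respectively, in place of $H$, and $$\|\nabla(u_2-H_2)\|_{L^\infty(\mathbb{R}^2)}<C$$ for some constant $C$ independent of $\epsilon$.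
   Context: Geometry. Fix $r_e>r_i>0$. For small $\epsilon>0$ let $B_i,B_e$ be the open disks with radii $r_i,r_e$ and centers $(c_i,0),(c_e,0)$, where $c_i=\frac{r_e^2-r_i^2-(r_e-r_i-\epsilon)^2}{2(r_e-r_i-\epsilon)}$ and $c_e=c_i+r_e-r_i-\epsilon$. Then $B_i\subset B_e$ and $\mathrm{dist}(\partial B_i,\partial B_e)=\epsilon$; the closest points of the two circles lie on the positive $x$-axis at distance $O(\epsilon)$ from the origin. Conventions. $\chi$ denotes a characteristic function. Solutions are weak solutions: $u$ is continuous across $\partial B_i,\partial B_e$, harmonic off these circles, with $\partial_\nu u|^+=k_e\,\partial_\nu u|^-$ on $\partial B_e$ and $k_e\,\partial_\nu u|^+=k_i\,\partial_\nu u|^-$ on $\partial B_i$ ($\nu$ outward unit normal; $+$/$-$ are limits from outside/inside). ''Independent of $\epsilon$'' means that there is $\epsilon_0>0$ such that the bound holds with the same constant for all $0<\epsilon<\epsilon_0$. *)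

(* Defs.v *)
From HB Require Import structures.
From mathcomp Require Import all_boot all_order all_algebra.
From mathcomp Require Import all_classical all_reals all_analysis.

Set Implicit Arguments.
Unset Strict Implicit.
Unset Printing Implicit Defensive.

Import Order.TTheory GRing.Theory Num.Theory.
Import numFieldNormedType.Exports.

Local Open Scope classical_set_scope.
Local Open Scope ring_scope.

Section Plane.
Context {R : realType}.
Implicit Types (f u H : R * R -> R) (x v : R * R) (U : set (R * R)).

(* The norm that the library puts on R * R is the max norm, hence these. *)
Definition dotp x v : R := x.1 * v.1 + x.2 * v.2.
Definition enorm x : R := Num.sqrt (dotp x x).

Definition partial1 f x : R := 'D_((1, 0) : R * R) f x.
Definition partial2 f x : R := 'D_((0, 1) : R * R) f x.
Definition grad f x : R * R := (partial1 f x, partial2 f x).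

Definition C1_on U f :=
  forall x, U x ->
    [/\ derivable f x ((1, 0) : R * R), derivable f x ((0, 1) : R * R),
        {for x, continuous (partial1 f)} & {for x, continuous (partial2 f)}].

Definition C2_on U f := [/\ C1_on U f, C1_on U (partial1 f) & C1_on U (partial2 f)].

(* Meant for open U only. *)
Definition harmonic_on U f :=
  C2_on U f /\
  forall x, U x -> partial1 (partial1 f) x + partial2 (partial2 f) x = 0.

Definition circle (c : R * R) (r : R) : set (R * R) := [set x | enorm (x - c) = r].

Definition outward_normal (c : R * R) (r : R) x : R * R := r^-1 *: (x - c).

(* d is the limit, as t decreases to 0, of the derivative of u in the
   direction nu(x) at the point x + s t nu(x), where x lies on [circle c r]:
   s = 1 is the limit from outside, s = -1 the limit from inside. *)
Definition normal_derivative_limit (s : R) (c : R * R) (r : R) u x (d : R) :=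
  let nu := outward_normal c r x in
  dotp (grad u (x + (s * t) *: nu)) nu @[t --> 0^'+] --> d.

Definition flux_condition (k_out k_in : R) (c : R * R) (r : R) u :=
  forall x, circle c r x ->
    exists d_out d_in : R,
      [/\ normal_derivative_limit 1 c r u x d_out,
          normal_derivative_limit (-1) c r u x d_in
        & k_out * d_out = k_in * d_in].

Definition center_i (r_i r_e eps : R) : R * R :=
  ((r_e ^+ 2 - r_i ^+ 2 - (r_e - r_i - eps) ^+ 2) / (2 * (r_e - r_i - eps)), 0).

Definition center_e (r_i r_e eps : R) : R * R :=
  ((center_i r_i r_e eps).1 + r_e - r_i - eps, 0).

Definition bigO_inv_at_infinity f :=
  exists M K : R, forall x, K < enorm x -> `|f x| <= M * (enorm x)^-1.

(* div (sigma grad u) = 0 in the plane, with sigma = k_i in B_i, k_e in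
   B_e \ B_i and 1 outside B_e, and u - H = O(1/|x|) at infinity. *)
Definition transmission_solution (r_i r_e eps k_i k_e : R) H u :=
  let ci := center_i r_i r_e eps in
  let ce := center_e r_i r_e eps in
  [/\ continuous u,
      harmonic_on (~` (circle ci r_i `|` circle ce r_e)) u,
      flux_condition 1 k_e ce r_e u,
      flux_condition k_e k_i ci r_i u
    & bigO_inv_at_infinity (u \- H)].

Definition linear_part H x : R := dotp (grad H 0) x.

Definition Linfty_norm_grad f : \bar R :=
  ('N[ (@lebesgue_measure R \x @lebesgue_measure R) ]_ (+oo)
     [ EFin \o (enorm \o grad f) ])%E.

End Plane.

(* Main.v *)
(* Both circles belong to the coaxal pencil with limit points (al, 0) and
   (- al, 0). The reflections Ri and Re in them are anticonformal, and Ri o Re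
   is a Moebius map that preserves the right half-plane; after inversion at
   (- al, 0) it becomes a dilation about 0 of ratio in [0, 1]. With the contrasts
   le = (k_e - 1) / (k_e + 1) and li = (k_e - k_i) / (k_e + k_i), the series
     A = sum_n (le li)^n H o (Ri o Re)^n
   converges, it is harmonic on the half-plane (a series of dilates, which can be
   differentiated termwise), and A = H + le li A o Ri o Re. So, up to a common
   additive constant, the solution is a combination of A inside, of A and A o Ri
   in the annulus, and of H, H o Re and A o Ri outside.

   All the maps (Ri o Re)^n are 1-Lipschitz on the half-plane, and a reflection
   is 1-Lipschitz outside its circle. Hence u - H is Lipschitz in each region,
   with a constant that depends only on k_i, k_e and on the Lipschitz constant
   of H on a ball that contains the circles for all small eps.

   Uniqueness: if w solves the homogeneous problem, adding to it a small multiple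
   of a piecewise quadratic function that is strictly subharmonic and strictly
   increases the flux on both circles excludes interior maxima on large disks. *)

Require Import Defs.
From HB Require Import structures.
From mathcomp Require Import all_boot all_order all_algebra.
From mathcomp Require Import all_classical all_reals all_analysis.
From mathcomp Require Import measurable_realfun ess_sup_inf.
From mathcomp Require Import ring lra.

Set Implicit Arguments.
Unset Strict Implicit.
Unset Printing Implicit Defensive.

Import Order.TTheory GRing.Theory Num.Theory.
Import numFieldNormedType.Exports.

Local Open Scope classical_set_scope.
Local Open Scope ring_scope.

(** * Differential calculus in the plane *)

Section Calculus.
Context {R : realType}.

(** As eps tends to 0 the two limit points merge at the origin and the ratio of the dilation tends
    to 1. The iterated maps thus do not contract uniformly in eps; convergence and uniformity both
    rest on |le li| < 1, which is where finite positive conductivities enter. For the same reason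
    the Lipschitz constant of the maps has to be 1 itself: a larger one would be amplified by
    iteration.

    Two coordinates are used because they serve different purposes. After inversion at the pole, the
    k-th term is G (kap^k w), with derivative kap^k times the derivative of G at kap^k w. A
    derivative of the series with weight mu is therefore a series of the same kind with weight mu
    kap, and second derivatives cost nothing more than first ones. That inversion, however, distorts
    lengths by factors depending on eps, so the bound is proved in the original coordinate, and by
    Lipschitz estimates: they compose well, and they control the gradient wherever it exists. *)

Lemma scaleRE (a b : R) : a *: b = a * b. Proof. by []. Qed.

Lemma is_derive_line (V W : normedModType R) (f : V -> W) x v t df :
  is_derive (x + t *: v) v f df ->
  is_derive t (1 : R) (fun s => f (x + s *: v)) df.
Proof.
have E : (fun h : R => h^-1 *: (((fun s => f (x + s *: v)) \o shift t) (h *: 1)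
            - f (x + t *: v))) =
         (fun h : R => h^-1 *: ((f \o shift (x + t *: v)) (h *: v) - f (x + t *: v))).
  apply/funext => h /=.
  by rewrite [h *: 1]mulr1 scalerDl addrCA.
move=> [df1 <-]; apply: DeriveDef.
  by rewrite /derivable E.
by rewrite /derive E.
Qed.

Lemma MVT_line_le (f : R * R -> R) (x v : R * R) (h M : R) :
  (forall t, Num.min 0 h <= t <= Num.max 0 h ->
     derivable f (x + t *: v) v /\ `|'D_v f (x + t *: v)| <= M) ->
  `|f (x + h *: v) - f x| <= M * `|h|.
Proof.
move=> hf; pose g s := f (x + s *: v).
have gd t : Num.min 0 h <= t <= Num.max 0 h -> is_derive t 1 g ('D_v f (x + t *: v)).
  by move=> /hf [/derivableP ? _]; exact: is_derive_line.
have gc a b : (forall t, a <= t <= b -> Num.min 0 h <= t <= Num.max 0 h) ->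
    {within `[a, b], continuous g}.
  move=> ab; apply: derivable_within_continuous => t; rewrite in_itv /= => /ab /gd.
  by case.
have -> : f x = g 0 by rewrite /g scale0r addr0.
have [h0|h0|h0] := ltgtP 0 h.
- have gd' t : t \in `]0, h[%R -> is_derive t 1 g ('D_v f (x + t *: v)).
    rewrite in_itv /= => /andP[t0 th]; apply: gd; rewrite (min_l (ltW h0)) (max_r (ltW h0)).
    by rewrite !ltW.
  have [|c ch ->] := MVT h0 gd'.
    by apply: gc => t; rewrite (min_l (ltW h0)) (max_r (ltW h0)).
  rewrite subr0 normrM ler_wpM2r// (hf _ _).2//.
  by move: ch; rewrite in_itv /= (min_l (ltW h0)) (max_r (ltW h0)) => /andP[? ?]; rewrite !ltW.
- have gd' t : t \in `]h, 0[%R -> is_derive t 1 g ('D_v f (x + t *: v)).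
    rewrite in_itv /= => /andP[t0 th]; apply: gd; rewrite (min_r (ltW h0)) (max_l (ltW h0)).
    by rewrite !ltW.
  have [|c ch E] := MVT h0 gd'.
    by apply: gc => t; rewrite (min_r (ltW h0)) (max_l (ltW h0)).
  rewrite distrC E sub0r normrM normrN ler_wpM2r// (hf _ _).2//.
  by move: ch; rewrite in_itv /= (min_r (ltW h0)) (max_l (ltW h0)) => /andP[? ?]; rewrite !ltW.
- by rewrite -h0 /g subrr normr0 mulr0.
Qed.

Lemma differentiable_is_derive (V W : normedModType R) (f : V -> W) x v :
  differentiable f x -> is_derive x v f ('d f x v).
Proof.
by move=> df; apply: DeriveDef; [exact/diff_derivable|rewrite deriveE].
Qed.

Definition between (a b t : R) := (Num.min a b <= t <= Num.max a b)%R.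

Lemma between_shift (a b t : R) :
  Num.min 0 (b - a) <= t <= Num.max 0 (b - a) -> between a b (a + t).
Proof.
rewrite /between; have [h|h] := leP 0 (b - a); have [h'|h'] := leP a b; lra.
Qed.

Lemma between_dist (a b t : R) : between a b t -> `|t - a| <= `|b - a|.
Proof.
rewrite /between; have [h'|h'] := leP a b => /andP[h1 h2].
  by rewrite !ger0_norm; lra.
by rewrite distrC (distrC b) !ger0_norm; lra.
Qed.

(** The path from [x] to [y] runs parallel to the axes through the corner [m], so that bounds on the
    two partial derivatives suffice; total differentiability is only derived from this estimate
    below. *)
Lemma MVT_box_le (f : R * R -> R) (x y : R * R) (M : R) :
  (forall z, between x.1 y.1 z.1 -> between x.2 y.2 z.2 ->
     [/\ derivable f z (1, 0), derivable f z (0, 1),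
         `|partial1 f z| <= M & `|partial2 f z| <= M]) ->
  `|f y - f x| <= M * (`|y.1 - x.1| + `|y.2 - x.2|).
Proof.
move=> hf.
have bl (a b : R) : between a b a by rewrite /between ge_min le_max lexx.
have br (a b : R) : between a b b by rewrite /between ge_min le_max lexx !orbT.
pose m := x + (y.1 - x.1) *: ((1, 0) : R * R).
have my : y = m + (y.2 - x.2) *: ((0, 1) : R * R).
  case: x y {hf} @m => x1 x2 [y1 y2] /=; congr pair => /=; rewrite !scaleRE; lra.
have -> : f y - f x = (f y - f m) + (f m - f x) by lra.
rewrite (le_trans (ler_normD _ _))// addrC mulrDr lerD//.
- apply: MVT_line_le => t /between_shift tb.
  have [//|//|d1 _ m1 _] := hf (x + t *: ((1, 0) : R * R)).
  + by rewrite /= scaleRE mulr1.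
  + by rewrite /= scaler0 addr0.
  + by split.
- rewrite {1}my; apply: MVT_line_le => t /between_shift tb.
  have [//|//|_ d1 _ m1] := hf (m + t *: ((0, 1) : R * R)).
  + by rewrite /= scaler0 addr0 scaleRE mulr1 addrC subrK.
  + by rewrite /= scaler0 addr0 scaleRE mulr1.
  + by split.
Qed.

(** The box estimate is applied to [f - d], where [d] is the candidate differential. Near [x] both
    partials of [f - d] are at most e / 2, and each of the two coordinates of the increment is
    bounded by its norm. *)
Lemma C1_differentiable (U : set (R * R)) (f : R * R -> R) x :
  open U -> C1_on U f -> U x -> differentiable f x.
Proof.
move=> oU fU Ux.
set a := partial1 f x; set b := partial2 f x.
pose d (h : R * R) : R := h.1 * a + h.2 * b.
have lin_d : linear d.
  by move=> k u v; rewrite /d /= !scaleRE; ring.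
have dE h : d h = h.1 * a + h.2 * b by [].
have cd0 : continuous d.
  move=> z; apply: cvgD; apply: cvgM.
  - exact: cvg_fst.
  - exact: cvg_cst.
  - exact: cvg_snd.
  - exact: cvg_cst.
have d10 : d (1, 0) = a by rewrite dE /= mul1r mul0r addr0.
have d01 : d (0, 1) = b by rewrite dE /= mul1r mul0r add0r.
clearbody d.
pose is_derive_mul := GRing.isLinear.Build _ _ _ _ _ lin_d.
pose dl : {linear _ -> _} := HB.pack d is_derive_mul.
have cd : continuous dl by exact: cd0.
suff E : f \o shift x = cst (f x) + dl +o_ (0 : R * R) id.
  by apply/diff_locallyP; rewrite (diff_unique cd E).
apply/eqaddoP => e e0.
have [_ _ c1 c2] := fU x Ux.
have e20 : 0 < e / 2 by lra.
have /nbhs_ballP[r /= r0 hr] : \forall y \near x,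
    [/\ U y, `|partial1 f y - a| <= e / 2 & `|partial2 f y - b| <= e / 2].
  have nU : \forall y \near x, U y by exact: open_nbhs_nbhs.
  move/cvgrPdistC_le: c1 => /(_ _ e20) c1; move/cvgrPdistC_le: c2 => /(_ _ e20) c2.
  by apply: filterS3 nU c1 c2 => y h1 h2 h3; exact: (And3 h1 h2 h3).
apply: filterS (nbhs0_lt r0) => h hr1.
have dd z v : is_derive z v d (d v).
  have dz : differentiable dl z by exact: linear_differentiable.
  by have := differentiable_is_derive v dz; rewrite (diff_lin _ cd).
have /= := @MVT_box_le (f - d) x (h + x) (e / 2).
rewrite !addrK.
have -> : (f - d) (h + x) - (f - d) x = (f \o shift x - (cst (f x) + dl)) h.
  rewrite /= !fctE /= !dE; lra.
move=> H; apply: le_trans (H _) _; last first.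
  have h1 : `|h.1| <= `|h| by rewrite prod_normE le_max lexx.
  have h2 : `|h.2| <= `|h| by rewrite prod_normE le_max lexx orbT.
  nra.
move=> z z1 z2.
have hz : ball x r z.
  have h1 : `|h.1| <= `|h| by rewrite prod_normE le_max lexx.
  have h2 : `|h.2| <= `|h| by rewrite prod_normE le_max lexx orbT.
  move: (between_dist z1) (between_dist z2); rewrite !addrK => k1 k2.
  split; rewrite /ball /= distrC.
    exact: le_lt_trans (le_trans k1 h1) hr1.
  exact: le_lt_trans (le_trans k2 h2) hr1.
have [Uz b1 b2] := hr z hz.
have [d1 d2 _ _] := fU z Uz.
have [D1 E1] : is_derive z (1, 0) (f - d) ('D_(1, 0) f z - d (1, 0)).
  exact: is_deriveB (derivableP d1) (dd z (1, 0)).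
have [D2 E2] : is_derive z (0, 1) (f - d) ('D_(0, 1) f z - d (0, 1)).
  exact: is_deriveB (derivableP d2) (dd z (0, 1)).
split=> {H}.
- exact: D1.
- exact: D2.
- rewrite /partial1 E1 d10; exact: b1.
- rewrite /partial2 E2 d01; exact: b2.
Qed.

Lemma derive_dotp (f : R * R -> R) x v :
  differentiable f x -> is_derive x v f (dotp (grad f x) v).
Proof.
move=> df; apply: is_derive_eq (differentiable_is_derive v df) _.
have {1}-> : v = v.1 *: ((1, 0) : R * R) + v.2 *: ((0, 1) : R * R).
  by case: v => a b; congr pair; rewrite /= !scaleRE; lra.
rewrite linearD !linearZ -!deriveE// /dotp /grad /partial1 /partial2 /= !scaleRE; ring.
Qed.

Lemma is_derive_comp2 (V : normedModType R) (f : R * R -> R) (g1 g2 : V -> R)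
    (x v : V) :
  differentiable f (g1 x, g2 x) -> differentiable g1 x -> differentiable g2 x ->
  is_derive x v (fun y => f (g1 y, g2 y))
    (partial1 f (g1 x, g2 x) * 'D_v g1 x + partial2 f (g1 x, g2 x) * 'D_v g2 x).
Proof.
move=> df d1 d2; have dp := differentiable_pair d1 d2.
have dc := differentiable_comp dp df.
apply: is_derive_eq (differentiable_is_derive v dc) _.
rewrite (diff_comp dp df) /= (diff_pair d1 d2) /=.
have [_] := derive_dotp ('d g1 x v, 'd g2 x v) df.
by rewrite (deriveE _ df) => ->; rewrite (deriveE _ d1) (deriveE _ d2).
Qed.

End Calculus.

(** * Closure properties of C1 functions *)

Section C1.
Context {R : realType}.
Implicit Types (f g p : R * R -> R) (x v : R * R) (U V : set (R * R)).
Local Notation e1 := ((1, 0) : R * R).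
Local Notation e2 := ((0, 1) : R * R).

Lemma is_derive_add f g x v a b : is_derive x v f a -> is_derive x v g b ->
  is_derive x v (fun y => f y + g y) (a + b).
Proof. exact: is_deriveD. Qed.

Lemma is_derive_opp f x v a : is_derive x v f a -> is_derive x v (fun y => - f y) (- a).
Proof. exact: is_deriveN. Qed.

Lemma is_derive_mul f g x v a b : is_derive x v f a -> is_derive x v g b ->
  is_derive x v (fun y => f y * g y) (f x * b + g x * a).
Proof. exact: is_deriveM. Qed.

Lemma is_derive_inv f x v a : f x != 0 -> is_derive x v f a ->
  is_derive x v (fun y => (f y)^-1) (- (f x) ^- 2 * a).
Proof.
move=> f0 [df <-]; apply: DeriveDef; first exact: derivableV.
by rewrite deriveV.
Qed.

Lemma is_derive_const (k : R) x v : is_derive x v (fun=> k) 0.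
Proof. exact: is_derive_cst. Qed.

Lemma is_derive_fst x v : is_derive x v (fun y : R * R => y.1) v.1.
Proof.
have cf : continuous (fst : R * R -> R) by move=> z; exact: cvg_fst.
have := differentiable_is_derive v (linear_differentiable x cf).
by rewrite (diff_lin _ cf).
Qed.

Lemma is_derive_snd x v : is_derive x v (fun y : R * R => y.2) v.2.
Proof.
have cf : continuous (snd : R * R -> R) by move=> z; exact: cvg_snd.
have := differentiable_is_derive v (linear_differentiable x cf).
by rewrite (diff_lin _ cf).
Qed.

(** [C1_on] speaks of the continuity of the total functions [partial1 f] and [partial2 f]. Since [U]
    is open, explicit formulas that hold only on [U] may replace them near each of its points. *)
Lemma C1_intro U f p1 p2 :
  (forall x, U x -> is_derive x e1 f (p1 x)) ->
  (forall x, U x -> is_derive x e2 f (p2 x)) ->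
  open U ->
  (forall x, U x -> {for x, continuous p1}) ->
  (forall x, U x -> {for x, continuous p2}) -> C1_on U f.
Proof.
move=> h1 h2 oU c1 c2 x Ux.
have E p p' : (forall y, U y -> p' y = p y) -> {for x, continuous p} ->
    {for x, continuous p'}.
  move=> pp' cp; suff : p' y @[y --> x] --> p' x by [].
  rewrite pp'//.
  apply: cvg_trans cp; apply: near_eq_cvg.
  have := open_nbhs_nbhs (conj oU Ux); apply: filterS => y Uy.
  exact/esym/pp'.
split.
- by case: (h1 x Ux).
- by case: (h2 x Ux).
- by apply: (E p1); [move=> y /h1[]|exact: c1].
- by apply: (E p2); [move=> y /h2[]|exact: c2].
Qed.

Lemma C1_is_derive1 U f x : C1_on U f -> U x -> is_derive x e1 f (partial1 f x).
Proof. by move=> h /h[d _ _ _]; exact: derivableP. Qed.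

Lemma C1_is_derive2 U f x : C1_on U f -> U x -> is_derive x e2 f (partial2 f x).
Proof. by move=> h /h[_ d _ _]; exact: derivableP. Qed.

Lemma C1_continuous_partial1 U f x : C1_on U f -> U x -> {for x, continuous (partial1 f)}.
Proof. by move=> h /h[]. Qed.

Lemma C1_continuous_partial2 U f x : C1_on U f -> U x -> {for x, continuous (partial2 f)}.
Proof. by move=> h /h[]. Qed.

Lemma C1_continuous U f x : open U -> C1_on U f -> U x -> {for x, continuous f}.
Proof. by move=> oU h Ux; exact: differentiable_continuous (C1_differentiable oU h Ux). Qed.

Lemma C1_ext U f g : open U -> (forall x, U x -> f x = g x) -> C1_on U f -> C1_on U g.
Proof.
move=> oU fg h.
have nfg x (Ux : U x) : \forall y \near x, f y = g y.
  by have := open_nbhs_nbhs (conj oU Ux); apply: filterS => y /fg.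
apply: (C1_intro (p1 := partial1 f) (p2 := partial2 f)) => [||//||] x Ux.
- exact: near_eq_is_derive (nfg x Ux) (C1_is_derive1 h Ux).
- exact: near_eq_is_derive (nfg x Ux) (C1_is_derive2 h Ux).
- exact: C1_continuous_partial1 h Ux.
- exact: C1_continuous_partial2 h Ux.
Qed.

Lemma partial_ext U f g x : open U -> (forall x, U x -> f x = g x) -> U x ->
  partial1 f x = partial1 g x /\ partial2 f x = partial2 g x.
Proof.
move=> oU fg Ux.
have nfg : \forall y \near x, f y = g y.
  by have := open_nbhs_nbhs (conj oU Ux); apply: filterS => y /fg.
by split; exact: near_eq_derive.
Qed.

Lemma C1_D U f g : open U -> C1_on U f -> C1_on U g -> C1_on U (fun y => f y + g y).
Proof.
move=> oU hf hg.
apply: (C1_intro (p1 := fun x => partial1 f x + partial1 g x)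
                 (p2 := fun x => partial2 f x + partial2 g x)) => [||//||] x Ux.
- exact: is_derive_add (C1_is_derive1 hf Ux) (C1_is_derive1 hg Ux).
- exact: is_derive_add (C1_is_derive2 hf Ux) (C1_is_derive2 hg Ux).
- exact: cvgD (C1_continuous_partial1 hf Ux) (C1_continuous_partial1 hg Ux).
- exact: cvgD (C1_continuous_partial2 hf Ux) (C1_continuous_partial2 hg Ux).
Qed.

Lemma C1_M U f g : open U -> C1_on U f -> C1_on U g -> C1_on U (fun y => f y * g y).
Proof.
move=> oU hf hg.
apply: (C1_intro (p1 := fun x => f x * partial1 g x + g x * partial1 f x)
                 (p2 := fun x => f x * partial2 g x + g x * partial2 f x)) => [||//||] x Ux.
- exact: is_derive_mul (C1_is_derive1 hf Ux) (C1_is_derive1 hg Ux).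
- exact: is_derive_mul (C1_is_derive2 hf Ux) (C1_is_derive2 hg Ux).
- exact: cvgD (cvgM (C1_continuous oU hf Ux) (C1_continuous_partial1 hg Ux)) (cvgM (C1_continuous oU hg Ux) (C1_continuous_partial1 hf Ux)).
- exact: cvgD (cvgM (C1_continuous oU hf Ux) (C1_continuous_partial2 hg Ux)) (cvgM (C1_continuous oU hg Ux) (C1_continuous_partial2 hf Ux)).
Qed.

Lemma C1_cst U (k : R) : open U -> C1_on U (fun=> k).
Proof.
move=> oU; apply: (C1_intro (p1 := fun=> 0) (p2 := fun=> 0)) => [//||] x _.
- exact: cvg_cst.
- exact: cvg_cst.
Qed.

Lemma C1_fst U : open U -> C1_on U (fun y => y.1).
Proof.
move=> oU; apply: (C1_intro (p1 := fun=> 1) (p2 := fun=> 0)) => [||//||] x _.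
- exact: is_derive_fst.
- exact: is_derive_fst.
- exact: cvg_cst.
- exact: cvg_cst.
Qed.

Lemma C1_snd U : open U -> C1_on U (fun y => y.2).
Proof.
move=> oU; apply: (C1_intro (p1 := fun=> 0) (p2 := fun=> 1)) => [||//||] x _.
- exact: is_derive_snd.
- exact: is_derive_snd.
- exact: cvg_cst.
- exact: cvg_cst.
Qed.

Lemma C1_N U f : open U -> C1_on U f -> C1_on U (fun y => - f y).
Proof.
move=> oU hf.
apply: (C1_intro (p1 := fun x => - partial1 f x) (p2 := fun x => - partial2 f x)) => [||//||] x Ux.
- exact: is_derive_opp (C1_is_derive1 hf Ux).
- exact: is_derive_opp (C1_is_derive2 hf Ux).
- exact: cvgN (C1_continuous_partial1 hf Ux).
- exact: cvgN (C1_continuous_partial2 hf Ux).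
Qed.

Lemma C1_V U f : open U -> (forall x, U x -> f x != 0) -> C1_on U f ->
  C1_on U (fun y => (f y)^-1).
Proof.
move=> oU f0 hf.
apply: (C1_intro (p1 := fun x => - (f x) ^- 2 * partial1 f x)
                 (p2 := fun x => - (f x) ^- 2 * partial2 f x)) => [||//||] x Ux.
- exact: is_derive_inv (f0 x Ux) (C1_is_derive1 hf Ux).
- exact: is_derive_inv (f0 x Ux) (C1_is_derive2 hf Ux).
- apply: cvgM (C1_continuous_partial1 hf Ux); apply: cvgN; apply: cvgV; first by rewrite expf_neq0// f0.
  exact: cvgM (C1_continuous oU hf Ux) (C1_continuous oU hf Ux).
- apply: cvgM (C1_continuous_partial2 hf Ux); apply: cvgN; apply: cvgV; first by rewrite expf_neq0// f0.
  exact: cvgM (C1_continuous oU hf Ux) (C1_continuous oU hf Ux).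
Qed.

Lemma C1_comp_derive U V f g1 g2 x v :
  open U -> open V -> C1_on U f -> C1_on V g1 -> C1_on V g2 ->
  (forall y, V y -> U (g1 y, g2 y)) -> V x ->
  is_derive x v (fun y => f (g1 y, g2 y))
    (partial1 f (g1 x, g2 x) * 'D_v g1 x + partial2 f (g1 x, g2 x) * 'D_v g2 x).
Proof.
move=> oU oV hf h1 h2 VU Vx; apply: is_derive_comp2.
- exact: C1_differentiable oU hf (VU x Vx).
- exact: C1_differentiable oV h1 Vx.
- exact: C1_differentiable oV h2 Vx.
Qed.

Lemma C1_comp U V f g1 g2 :
  open U -> open V -> C1_on U f -> C1_on V g1 -> C1_on V g2 ->
  (forall y, V y -> U (g1 y, g2 y)) -> C1_on V (fun y => f (g1 y, g2 y)).
Proof.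
move=> oU oV hf h1 h2 VU.
have cg x : V x -> (g1 y, g2 y) @[y --> x] --> (g1 x, g2 x).
  move=> Vx; exact: (cvg_pair (C1_continuous oV h1 Vx) (C1_continuous oV h2 Vx)).
have cc p x : V x -> {for (g1 x, g2 x), continuous p} ->
    p (g1 y, g2 y) @[y --> x] --> p (g1 x, g2 x).
  by move=> Vx cp; exact: (cvg_comp _ _ (cg x Vx) cp).
apply: (C1_intro
  (p1 := fun x => partial1 f (g1 x, g2 x) * partial1 g1 x + partial2 f (g1 x, g2 x) * partial1 g2 x)
  (p2 := fun x => partial1 f (g1 x, g2 x) * partial2 g1 x + partial2 f (g1 x, g2 x) * partial2 g2 x)) => [||//||] x Vx.
- exact: C1_comp_derive oU oV hf h1 h2 VU Vx.
- exact: C1_comp_derive oU oV hf h1 h2 VU Vx.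
- apply: cvgD; apply: cvgM.
  + by apply: cc => //; exact: C1_continuous_partial1 hf (VU _ Vx).
  + exact: C1_continuous_partial1 h1 Vx.
  + by apply: cc => //; exact: C1_continuous_partial2 hf (VU _ Vx).
  + exact: C1_continuous_partial1 h2 Vx.
- apply: cvgD; apply: cvgM.
  + by apply: cc => //; exact: C1_continuous_partial1 hf (VU _ Vx).
  + exact: C1_continuous_partial2 h1 Vx.
  + by apply: cc => //; exact: C1_continuous_partial2 hf (VU _ Vx).
  + exact: C1_continuous_partial2 h2 Vx.
Qed.

End C1.

(** * Inversions preserve harmonicity *)

Section Inversion.
Context {R : realType}.
Implicit Types (f g p : R * R -> R) (x v c : R * R) (U V : set (R * R)).
Local Notation e1 := ((1, 0) : R * R).
Local Notation e2 := ((0, 1) : R * R).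

Definition dist2 c x : R := (x.1 - c.1) * (x.1 - c.1) + (x.2 - c.2) * (x.2 - c.2).
Definition cinv1 c (s : R) x := c.1 + s * (x.1 - c.1) * (dist2 c x)^-1.
Definition cinv2 c (s : R) x := c.2 + s * (x.2 - c.2) * (dist2 c x)^-1.
(* Inversion in the circle of center c and squared radius s; since x / 0 = 0,
   it fixes the center. *)
Definition cinv c (s : R) x : R * R := (cinv1 c s x, cinv2 c s x).

(* The Jacobian of cinv is [[cinv_dx, cinv_dy], [cinv_dy, - cinv_dx]]. *)
Definition cinv_dx c (s : R) x :=
  s * ((x.2 - c.2) * (x.2 - c.2) - (x.1 - c.1) * (x.1 - c.1)) *
    ((dist2 c x)^-1 * (dist2 c x)^-1).
Definition cinv_dy c (s : R) x :=
  - (2 * s) * ((x.1 - c.1) * (x.2 - c.2)) * ((dist2 c x)^-1 * (dist2 c x)^-1).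

Lemma dist2_derive c x v :
  is_derive x v (dist2 c) (2 * ((x.1 - c.1) * v.1 + (x.2 - c.2) * v.2)).
Proof.
apply: is_derive_eq; first by do ![exact: is_derive_fst|exact: is_derive_snd|exact: is_derive_const|apply: is_derive_opp|apply: is_derive_mul|apply: is_derive_add].
by cbv beta; ring.
Qed.

Local Ltac deriv := do ![exact: dist2_derive|exact: is_derive_const|exact: is_derive_fst|exact: is_derive_snd|apply: is_derive_opp|apply: is_derive_inv => //|apply: is_derive_mul|apply: is_derive_add].

Lemma cinv1_derive c s x v : dist2 c x != 0 ->
  is_derive x v (cinv1 c s) (cinv_dx c s x * v.1 + cinv_dy c s x * v.2).
Proof.
move=> x0; apply: is_derive_eq; first by deriv.
cbv beta; rewrite /cinv_dx /cinv_dy; move: (x0); rewrite /dist2 => {}x0; field.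
exact: x0.
Qed.

Lemma cinv2_derive c s x v : dist2 c x != 0 ->
  is_derive x v (cinv2 c s) (cinv_dy c s x * v.1 - cinv_dx c s x * v.2).
Proof.
move=> x0; apply: is_derive_eq; first by deriv.
cbv beta; rewrite /cinv_dx /cinv_dy; move: (x0); rewrite /dist2 => {}x0; field.
exact: x0.
Qed.

(** With z = x.1 + i x.2, the conjugate of the inversion is holomorphic with derivative [cinv_dx] -
    i [cinv_dy] = - s / (z - c)^2. The witnesses come from its second derivative a - i b = 2 s / (z
    - c)^3. *)
Lemma cinv_cauchy_riemann c s x : dist2 c x != 0 ->
  exists a b : R,
  [/\ is_derive x e1 (cinv_dx c s) a, is_derive x e2 (cinv_dy c s) (- a),
      is_derive x e1 (cinv_dy c s) b & is_derive x e2 (cinv_dx c s) b].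
Proof.
move=> x0.
exists (2 * s * (x.1 - c.1) * ((x.1 - c.1)^+2 - 3 * (x.2 - c.2)^+2) / dist2 c x ^+ 3),
  (2 * s * (x.2 - c.2) * (3 * (x.1 - c.1)^+2 - (x.2 - c.2)^+2) / dist2 c x ^+ 3).
split; (apply: is_derive_eq; first by deriv);
  rewrite /=; move: (x0); rewrite /dist2 => {}x0; field; exact: x0.
Qed.

Lemma C1_coordB U (k : R) : open U ->
  C1_on U (fun y => y.1 - k) /\ C1_on U (fun y => y.2 - k).
Proof.
move=> oU; split.
  exact: (@C1_D _ _ fst (fun=> - k) oU (C1_fst oU) (C1_cst _ oU)).
exact: (@C1_D _ _ snd (fun=> - k) oU (C1_snd oU) (C1_cst _ oU)).
Qed.

Lemma C1_dist2 U c : open U -> C1_on U (dist2 c).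
Proof.
move=> oU; have [[A _] [_ B]] := (C1_coordB c.1 oU, C1_coordB c.2 oU).
exact: C1_D oU (C1_M oU A A) (C1_M oU B B).
Qed.

Section InvC1.
Variables (U : set (R * R)) (c : R * R) (s : R).
Hypotheses (oU : open U) (U0 : forall x, U x -> dist2 c x != 0).

Let A : C1_on U (fun y => y.1 - c.1). Proof. by have [] := C1_coordB c.1 oU. Qed.
Let B : C1_on U (fun y => y.2 - c.2). Proof. by have [] := C1_coordB c.2 oU. Qed.
Let I : C1_on U (fun y => (dist2 c y)^-1). Proof. exact: C1_V oU U0 (C1_dist2 c oU). Qed.
Let K k : C1_on U (fun=> k). Proof. exact: C1_cst. Qed.

Lemma C1_cinv1 : C1_on U (cinv1 c s).
Proof. exact: C1_D oU (K _) (C1_M oU (C1_M oU (K _) A) I). Qed.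

Lemma C1_cinv2 : C1_on U (cinv2 c s).
Proof. exact: C1_D oU (K _) (C1_M oU (C1_M oU (K _) B) I). Qed.

Lemma C1_cinv_dx : C1_on U (cinv_dx c s).
Proof.
exact: C1_M oU (C1_M oU (K _) (C1_D oU (C1_M oU B B) (C1_N oU (C1_M oU A A)))) (C1_M oU I I).
Qed.

Lemma C1_cinv_dy : C1_on U (cinv_dy c s).
Proof. exact: C1_M oU (C1_M oU (K _) (C1_M oU A B)) (C1_M oU I I). Qed.

End InvC1.

(** The chain rule for the Laplacian of f composed with an inversion: the terms in [F1] and [F2]
    cancel by the Cauchy-Riemann equations, the mixed derivatives [D12] and [D21] cancel each on its
    own, and p^2 + q^2 times the Laplacian of f remains. *)
Let laplacian_comp_identity (D11 D12 D21 D22 p q F1 F2 a b : R) : D11 + D22 = 0 ->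
  F1 * a + p * (D11 * p + D12 * q) + (F2 * b + q * (D21 * p + D22 * q)) +
  (F1 * - a + q * (D11 * q - D12 * p) - (F2 * b + p * (D21 * q - D22 * p))) = 0.
Proof. by move=> /eqP; rewrite addr_eq0 => /eqP ->; ring. Qed.

Section Compose.
Variables (U V : set (R * R)) (f : R * R -> R) (c : R * R) (s : R).
Hypotheses (oU : open U) (oV : open V) (V0 : forall x, V x -> dist2 c x != 0)
  (VU : forall x, V x -> U (cinv c s x)).

Lemma C1_comp_cinv f' : C1_on U f' -> C1_on V (fun x => f' (cinv c s x)).
Proof.
by move=> hf; exact: C1_comp oU oV hf (C1_cinv1 s oV V0) (C1_cinv2 s oV V0) VU.
Qed.

Lemma cinv_comp_partial f' x : C1_on U f' -> V x ->
  is_derive x e1 (fun x => f' (cinv c s x))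
    (partial1 f' (cinv c s x) * cinv_dx c s x + partial2 f' (cinv c s x) * cinv_dy c s x) /\
  is_derive x e2 (fun x => f' (cinv c s x))
    (partial1 f' (cinv c s x) * cinv_dy c s x - partial2 f' (cinv c s x) * cinv_dx c s x).
Proof.
move=> hf Vx.
have h1 := C1_cinv1 s oV V0; have h2 := C1_cinv2 s oV V0.
have D v := C1_comp_derive v oU oV hf h1 h2 VU Vx.
split; apply: is_derive_eq (D _) _.
- have [_ ->] := cinv1_derive s e1 (V0 Vx); have [_ ->] := cinv2_derive s e1 (V0 Vx).
  rewrite /=; ring.
- have [_ ->] := cinv1_derive s e2 (V0 Vx); have [_ ->] := cinv2_derive s e2 (V0 Vx).
  rewrite /=; ring.
Qed.

Lemma harmonic_comp_cinv : harmonic_on U f -> harmonic_on V (fun x => f (cinv c s x)).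
Proof.
move=> [[hf hf1 hf2] lap].
have hP := C1_cinv_dx s oV V0; have hQ := C1_cinv_dy s oV V0.
pose g1 x := partial1 f (cinv c s x) * cinv_dx c s x + partial2 f (cinv c s x) * cinv_dy c s x.
pose g2 x := partial1 f (cinv c s x) * cinv_dy c s x - partial2 f (cinv c s x) * cinv_dx c s x.
have E1 x : V x -> g1 x = partial1 (fun x => f (cinv c s x)) x.
  by move=> Vx; have [[_ E] _] := cinv_comp_partial hf Vx; exact: esym E.
have E2 x : V x -> g2 x = partial2 (fun x => f (cinv c s x)) x.
  by move=> Vx; have [_ [_ E]] := cinv_comp_partial hf Vx; exact: esym E.
have k1 := C1_comp_cinv hf1; have k2 := C1_comp_cinv hf2.
have C1g1 : C1_on V g1 by exact: C1_D oV (C1_M oV k1 hP) (C1_M oV k2 hQ).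
have C1g2 : C1_on V g2 by exact: C1_D oV (C1_M oV k1 hQ) (C1_N oV (C1_M oV k2 hP)).
split; first split.
- exact: C1_comp_cinv.
- exact: C1_ext oV E1 C1g1.
- exact: C1_ext oV E2 C1g2.
- move=> x Vx.
  have [<- _] := partial_ext oV E1 Vx; have [_ <-] := partial_ext oV E2 Vx.
  have [a [b [Pa Qa Qb Pb]]] := cinv_cauchy_riemann s (V0 Vx).
  have [d11 d12] := cinv_comp_partial hf1 Vx.
  have [d21 d22] := cinv_comp_partial hf2 Vx.
  have [_ G1] := is_derive_add (is_derive_mul d11 Pa) (is_derive_mul d21 Qb).
  have [_ G2] := is_derive_add (is_derive_mul d12 Qa) (is_derive_opp (is_derive_mul d22 Pb)).
  apply: etrans (congr2 +%R G1 G2) _.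
  by apply: laplacian_comp_identity; exact: lap (VU Vx).
Qed.

End Compose.
End Inversion.

(** * Series of dilates *)

Section Geo.
Context {R : realType}.
Implicit Types (mu M : R) (a b : nat -> R).

Definition geo_sum mu a : R := limn (series (fun k => mu ^+ k * a k)).

Lemma geo_is_cvg mu M a : `|mu| < 1 -> (forall k, `|a k| <= M) ->
  cvgn (series (fun k => mu ^+ k * a k)) /\
  cvgn [normed series (fun k => mu ^+ k * a k)].
Proof.
move=> mu1 aM; set S := [normed _].
suff h : cvgn S by split=> //; exact: normed_cvg.
have M0 : 0 <= M by apply: le_trans (aM 0%N).
apply: (@series_le_cvg R _ (geometric M `|mu|)).
- by move=> n; exact: normr_ge0.
- by move=> n; rewrite /= mulr_ge0.
- by move=> n; rewrite /= normrM normrX mulrC ler_wpM2r.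
- by apply: is_cvg_geometric_series; rewrite normr_id.
Qed.

Lemma geo_bound mu M a : `|mu| < 1 -> (forall k, `|a k| <= M) ->
  `|geo_sum mu a| <= M / (1 - `|mu|).
Proof.
move=> mu1 aM; have [c1 c2] := geo_is_cvg mu1 aM.
have g1 : `|(`|mu|)| < 1 by rewrite normr_id.
apply: le_trans (lim_series_norm c2) _.
rewrite -(cvg_lim _ (@cvg_geometric_series R M _ g1))//.
apply: lim_series_le => //; first exact: is_cvg_geometric_series.
by move=> n; rewrite /= normrM normrX mulrC ler_wpM2r.
Qed.

Lemma geoS mu M a : `|mu| < 1 -> (forall k, `|a k| <= M) ->
  geo_sum mu a = a 0%N + mu * geo_sum mu (fun k => a k.+1).
Proof.
move=> mu1 aM; have [c1 _] := geo_is_cvg mu1 aM.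
have [c2 _] := geo_is_cvg mu1 (fun k => aM k.+1).
apply: cvg_lim => //.
suff h : series (fun k => mu ^+ k * a k) n.+1 @[n --> \oo] -->
    a 0%N + mu * geo_sum mu (fun k => a k.+1) by rewrite -cvg_shiftS.
have -> : (fun n => series (fun k => mu ^+ k * a k) n.+1) =
    (fun n => a 0%N + mu * series (fun k => mu ^+ k * a k.+1) n).
  apply/funext => n /=; rewrite /series /= big_nat_recl//= expr0 mul1r mulr_sumr.
  by congr (_ + _); apply: eq_bigr => i _; rewrite exprS mulrA.
by apply: cvgD; [exact: cvg_cst|apply: cvgM; [exact: cvg_cst|exact: c2]].
Qed.

Lemma geoB mu M N a b : `|mu| < 1 -> (forall k, `|a k| <= M) -> (forall k, `|b k| <= N) ->
  geo_sum mu a - geo_sum mu b = geo_sum mu (fun k => a k - b k).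
Proof.
move=> mu1 aM bN; have [c1 _] := geo_is_cvg mu1 aM; have [c2 _] := geo_is_cvg mu1 bN.
rewrite /geo_sum -lim_seriesB//; congr (limn (series _)).
by apply/funext => k /=; rewrite mulrBr.
Qed.

Lemma geoZ mu M a (k : R) : `|mu| < 1 -> (forall k, `|a k| <= M) ->
  k * geo_sum mu a = geo_sum mu (fun n => k * a n).
Proof.
move=> mu1 aM; have [c1 _] := geo_is_cvg mu1 aM.
rewrite /geo_sum -[LHS]/(k *: _) -lim_seriesZ//; congr (limn (series _)).
by apply/funext => n; rewrite mulrCA.
Qed.

Lemma geo_scale mu k a : geo_sum mu (fun n => k ^+ n * a n) = geo_sum (mu * k) a.
Proof.
by rewrite /geo_sum; congr (limn (series _)); apply/funext => n; rewrite exprMn mulrA.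
Qed.

(** Dominated convergence for series. It yields both the continuity of a series of dilates and,
    applied to difference quotients, its termwise differentiation. *)
Lemma tannery (T : Type) (F : set_system T) {FF : Filter F} mu M (q : nat -> T -> R) a :
  `|mu| < 1 -> (forall k, `|a k| <= M) ->
  (\forall h \near F, forall k, `|q k h| <= M) ->
  (forall k, q k h @[h --> F] --> a k) ->
  geo_sum mu (fun k => q k h) @[h --> F] --> geo_sum mu a.
Proof.
move=> mu1 aM qM qa; apply/cvgrPdistC_le => e e0.
have M0 : 0 <= M by apply: le_trans (aM 0%N).
(* The bound of [geo_bound] for the difference of two families that are both bounded by [M]; it
   serves for the tails. *)
set K := 2 * M / (1 - `|mu|).
(* Induction on [n] peels off one term and passes to the shifted families, hence the quantification
   over [q] and [a]. The first term costs e / 2, and the tail, multiplied by mu, costs at most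
   another e / 2 while its bound gains a factor |mu|. *)
have claim n : forall (q : nat -> T -> R) a, (forall k, `|a k| <= M) ->
    (\forall h \near F, forall k, `|q k h| <= M) ->
    (forall k, q k h @[h --> F] --> a k) -> forall e, 0 < e ->
    \forall h \near F, `|geo_sum mu (fun k => q k h) - geo_sum mu a| <= e + K * `|mu| ^+ n.
  elim: n => [|n IH] {qM qa e e0 aM} p b bM pM pb e e0.
    move: pM; apply: filterS => h pM.
    rewrite expr0 mulr1 (geoB mu1 pM bM) (le_trans (geo_bound (M := 2 * M) mu1 _))//.
      by move=> k; rewrite (le_trans (ler_normB _ _))// mulr2n mulrDl !mul1r lerD.
    by rewrite /K lerDr ltW.
  have e20 : 0 < e / 2 by lra.
  have pM' : \forall h \near F, forall k, `|p k.+1 h| <= M.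
    by move: pM; apply: filterS => h H k.
  have := IH (fun k => p k.+1) (fun k => b k.+1) (fun k => bM k.+1) pM' (fun k => pb k.+1) _ e20.
  move/cvgrPdistC_le: (pb 0%N) => /(_ _ e20).
  move: pM; apply: filterS3 => h pM h1 h2.
  rewrite (geoS mu1 pM) (geoS mu1 bM).
  set A := geo_sum _ _ in h2 *; set B := geo_sum _ _ in h2 *.
  have -> : p 0%N h + mu * A - (b 0%N + mu * B) = (p 0%N h - b 0%N) + mu * (A - B) by ring.
  rewrite (le_trans (ler_normD _ _))// normrM exprS.
  have : `|mu| * `|A - B| <= `|mu| * (e / 2 + K * `|mu| ^+ n) by rewrite ler_wpM2l.
  have : `|mu| * (e / 2) <= e / 2 by rewrite ler_piMl// ltW.
  lra.
have e20 : 0 < e / 2 by lra.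
have [n hn] : exists n, K * `|mu| ^+ n <= e / 2.
  have g1 : `|(`|mu|)| < 1 by rewrite normr_id.
  have /cvgrPdist_le/(_ _ e20) [n _ hn] := @cvg_geometric R K _ g1.
  by exists n; have /= := hn n (leqnn n); rewrite sub0r normrN; exact/le_trans/ler_norm.
have := claim n q a aM qM qa _ e20; apply: filterS => h /le_trans; apply.
lra.
Qed.

End Geo.

Section Disk.
Context {R : realType}.
Implicit Types (f G : R * R -> R) (x v w c : R * R) (U : set (R * R)).
Local Notation e1 := ((1, 0) : R * R).
Local Notation e2 := ((0, 1) : R * R).

Lemma is_derive_cvgP (V W : normedModType R) (f : V -> W) (x v : V) (df : W) :
  is_derive x v f df <-> h^-1 *: (f (h *: v + x) - f x) @[h --> 0^'] --> df.
Proof.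
split=> [[c <-]|c]; first exact: c.
by apply: DeriveDef; [apply/cvg_ex; exists df|apply: cvg_lim].
Qed.

(** Here [r] is the squared radius. *)
Definition disk (r : R) : set (R * R) := [set w | dotp w w < r].

Lemma dotp_continuous x : {for x, continuous (fun w : R * R => dotp w w)}.
Proof.
have h1 : w.1 @[w --> x] --> x.1 by exact: cvg_fst.
have h2 : w.2 @[w --> x] --> x.2 by exact: cvg_snd.
exact: cvgD (cvgM h1 h1) (cvgM h2 h2).
Qed.

Lemma open_disk r : open (disk r).
Proof.
apply: (open_comp (f := fun w : R * R => dotp w w) (D := [set y : R | y < r])).
  by move=> x _; exact: dotp_continuous.
exact: open_lt.
Qed.

Lemma compact_closed_disk r : compact [set w : R * R | dotp w w <= r].
Proof.
apply: (@subclosed_compact _ _ (`[- (r + 1), r + 1] `*` `[- (r + 1), r + 1])).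
- rewrite (_ : [set w | _] = (fun w : R * R => dotp w w) @^-1` [set y | y <= r]) //.
  apply: (preimage_closed (D := [set y : R | y <= r])); last exact: closed_le.
  by move=> x _; exact: dotp_continuous.
- by apply: compact_setX; exact: segment_compact.
- move=> [a b]; rewrite /dotp /= => h.
  by split; rewrite /= in_itv /=; apply/andP; split; nra.
Qed.

Lemma disk_bounded f r :
  (forall w, dotp w w <= r -> {for w, continuous f}) ->
  exists M : R, forall w, dotp w w <= r -> `|f w| <= M.
Proof.
move=> cf; have : compact (f @` [set w : R * R | dotp w w <= r]).
  apply: continuous_compact; last exact: compact_closed_disk.
  by apply: continuous_in_subspaceT => w; rewrite inE; exact: cf.
move=> /compact_bounded/ex_strict_bound_gt0 [M _ hM].
exists M => w wr; apply/ltW/hM; exact: imageP.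
Qed.

(** The point is that [d] does not depend on [k]: one increment is then admissible at all the
    dilates of [w] at once. *)
Lemma disk_near r w v : disk r w ->
  exists2 d : R, 0 < d & forall k t : R, 0 <= k <= 1 -> `|t| < d -> disk r (k *: w + t *: v).
Proof.
rewrite /disk /= => wr.
(* For |t| <= 1 the squared norm grows by at most |t| times the first two terms; the 1 keeps [A]
   positive. *)
set A := 2 * `|dotp w v| + dotp v v + 1.
have v0 : 0 <= dotp v v by rewrite /dotp -!expr2 addr_ge0// sqr_ge0.
have w0 : 0 <= dotp w w by rewrite /dotp -!expr2 addr_ge0// sqr_ge0.
have A0 : 0 < A by rewrite /A; have := normr_ge0 (dotp w v); lra.
exists (Num.min 1 ((r - dotp w w) / A)).
  by rewrite lt_min ltr01 divr_gt0// subr_gt0.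
move=> k t /andP[k0 k1]; rewrite lt_min ltr_pdivlMr// => /andP[t1 tA].
have -> : dotp (k *: w + t *: v) (k *: w + t *: v) =
    k ^+ 2 * dotp w w + k * (2 * (t * dotp w v)) + t ^+ 2 * dotp v v.
  by rewrite /dotp /= !scaleRE; ring.
have h1 : k ^+ 2 * dotp w w <= dotp w w by rewrite ler_piMl// expr_le1.
have h2 : t * dotp w v <= `|t| * `|dotp w v| by rewrite -normrM ler_norm.
have h3 : t ^+ 2 <= `|t| by rewrite -real_normK ?num_real// ler_piMl// ltW.
have h4 : t ^+ 2 * dotp v v <= `|t| * dotp v v by rewrite ler_wpM2r.
have h5 : 0 <= `|t| * `|dotp w v| by rewrite mulr_ge0.
have h6 : k * (2 * (t * dotp w v)) <= 2 * (`|t| * `|dotp w v|).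
  have : k * (t * dotp w v) <= k * (`|t| * `|dotp w v|) by rewrite ler_wpM2l.
  have : k * (`|t| * `|dotp w v|) <= `|t| * `|dotp w v| by rewrite ler_piMl.
  lra.
have : `|t| * A = 2 * (`|t| * `|dotp w v|) + `|t| * dotp v v + `|t|.
  by rewrite /A; ring.
have := normr_ge0 t; lra.
Qed.

Section DilationSeries.
Variables (kap rho : R).
Hypothesis kap01 : 0 <= kap <= 1.

Definition dilation_series (mu : R) G w := geo_sum mu (fun k => G (kap ^+ k *: w)).

Let kapk k : 0 <= kap ^+ k <= 1.
Proof. by case/andP: kap01 => k0 k1; rewrite exprn_ge0// exprn_ile1. Qed.

Lemma disk_scale r k w : 0 <= k <= 1 -> dotp w w <= r -> dotp (k *: w) (k *: w) <= r.
Proof.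
move=> /andP[k0 k1] wr; apply: le_trans wr.
have -> : dotp (k *: w) (k *: w) = k ^+ 2 * dotp w w by rewrite /dotp /= !scaleRE; ring.
by rewrite ler_piMl ?expr_le1// /dotp -!expr2 addr_ge0// sqr_ge0.
Qed.

Lemma dil_series_cont mu G w : `|mu| < 1 ->
  (forall x, disk rho x -> {for x, continuous G}) -> disk rho w ->
  {for w, continuous (dilation_series mu G)}.
Proof.
move=> mu1 cG wrho.
(* The closed disk of squared radius [r] is compact inside the domain and is a neighbourhood of [w],
   so one bound holds for all the terms at all nearby points. *)
have [r /andP[wr rrho]] : exists r : R, dotp w w < r < rho.
  by exists ((dotp w w + rho) / 2); move: wrho; rewrite /disk /= => ?; lra.
have [M hM] : exists M : R, forall w, dotp w w <= r -> `|G w| <= M.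
  by apply: disk_bounded => x xr; apply: cG; exact: le_lt_trans xr rrho.
apply: (@tannery R _ (nbhs w) _ mu M (fun k w => G (kap ^+ k *: w))) => //.
- by move=> k; apply: hM; exact: disk_scale (kapk k) (ltW wr).
- have := open_nbhs_nbhs (conj (@open_disk r) wr).
  by apply: filterS => x xr k; apply: hM; exact: disk_scale (kapk k) (ltW xr).
- move=> k; apply: (@cvg_comp _ _ _ (fun w => kap ^+ k *: w) G).
    exact: (differentiable_continuous (@ex_diff _ _ _ _ _ _ _ (is_diff_scaler (kap ^+ k) w))).
  by apply: cG; exact: le_lt_trans (disk_scale (kapk k) (ltW wr)) rrho.
Qed.

(** The chain rule puts a factor kap^k on the k-th term, which turns the weight mu into mu kap. By
    the mean value inequality the difference quotients of all the terms have a common bound, as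
    [tannery] requires. *)
Lemma dil_series_derive mu G w v : `|mu| < 1 -> C1_on (disk rho) G ->
  (forall x, disk rho x -> {for x, continuous (fun x => 'D_v G x)}) -> disk rho w ->
  is_derive w v (dilation_series mu G) (dilation_series (mu * kap) (fun x => 'D_v G x) w).
Proof.
move=> mu1 C1G cD wrho; have oD := @open_disk rho.
have dG x : disk rho x -> differentiable G x by exact: C1_differentiable.
have [r /andP[wr rrho]] : exists r : R, dotp w w < r < rho.
  by exists ((dotp w w + rho) / 2); move: wrho; rewrite /disk /= => ?; lra.
have sub x : dotp x x <= r -> disk rho x by move=> xr; exact: le_lt_trans xr rrho.
have [M hM] : exists M : R, forall w, dotp w w <= r -> `|'D_v G w| <= M.
  by apply: disk_bounded => x /sub; exact: cD.
have [N hN] : exists N : R, forall w, dotp w w <= r -> `|G w| <= N.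
  by apply: disk_bounded => x /sub /dG; exact: differentiable_continuous.
have M0 : 0 <= M by apply: le_trans (hM w (ltW wr)).
have [d d0 hd] := disk_near v wr.
apply/is_derive_cvgP; rewrite /dilation_series -geo_scale.
pose q k (h : R) := h^-1 *: (G (kap ^+ k *: (h *: v + w)) - G (kap ^+ k *: w)).
have sc k : dotp (kap ^+ k *: w) (kap ^+ k *: w) <= r.
  exact: disk_scale (kapk k) (ltW wr).
apply: cvg_trans (@tannery R _ (0^') _ mu M q _ mu1 _ _ _).
- apply: near_eq_cvg; near=> h.
  have hr : dotp (h *: v + w) (h *: v + w) <= r.
    apply: ltW; rewrite addrC -[w in w + _]scale1r; apply: hd; first by rewrite ler01 lexx.
    by near: h; exact: dnbhs0_lt.
  have b1 k : `|G (kap ^+ k *: (h *: v + w))| <= N.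
    by apply: hN; exact: disk_scale (kapk k) hr.
  have b2 k : `|G (kap ^+ k *: w)| <= N by exact: hN.
  rewrite (geoB mu1 b1 b2) scaleRE (@geoZ _ _ (N + N))//.
  by move=> k; rewrite (le_trans (ler_normB _ _))// lerD.
- move=> k; rewrite normrM (le_trans _ (hM _ (sc k)))// ler_piMl//.
  by case/andP: (kapk k) => ? ?; rewrite ger0_norm.
- near=> h => k.
  have h0 : h != 0 by near: h; exact: nbhs_dnbhs_neq.
  have hd' : `|h| < d by near: h; exact: dnbhs0_lt.
  rewrite /q scaleRE normrM normfV mulrC ler_pdivrMr ?normr_gt0//.
  have -> : kap ^+ k *: (h *: v + w) = kap ^+ k *: w + (kap ^+ k * h) *: v.
    by rewrite scalerDr scalerA addrC.
  have [k0 k1] := andP (kapk k).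
  apply: (@le_trans _ _ (M * `|kap ^+ k * h|)); last first.
    by rewrite ler_wpM2l// normrM ler_piMl// ger0_norm.
  apply: MVT_line_le => t tb.
  have : `|t| <= `|kap ^+ k * h| by have := @between_dist R 0 _ _ tb; rewrite !subr0.
  rewrite normrM (ger0_norm k0) => th.
  have xr : dotp (kap ^+ k *: w + t *: v) (kap ^+ k *: w + t *: v) <= r.
    apply/ltW/hd; first exact: kapk.
    by apply: le_lt_trans th _; rewrite (le_lt_trans _ hd')// ler_piMl.
  split; last exact: hM.
  by apply: diff_derivable; apply: dG; exact: sub.
- move=> k.
  suff /is_derive_cvgP : is_derive w v (G \o *:%R (kap ^+ k))
    (kap ^+ k * 'D_v G (kap ^+ k *: w)) by [].
  have dGk := dG _ (sub _ (sc k)).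
  have ds : is_diff w ( *:%R (kap ^+ k)) ( *:%R (kap ^+ k)) := is_diff_scaler _ w.
  have dsd := @ex_diff _ _ _ _ _ _ _ ds.
  apply: is_derive_eq (differentiable_is_derive v (differentiable_comp dsd dGk)) _.
  by rewrite (diff_comp dsd dGk) /= diff_val linearZ /= scaleRE (deriveE _ dGk).
Unshelve. all: by end_near. Qed.

End DilationSeries.
End Disk.

Section DilationHarmonic.
Context {R : realType}.
Variables (kap rho : R).
Hypothesis kap01 : 0 <= kap <= 1.
Implicit Types (G : R * R -> R) (mu : R).

Let mukap mu : `|mu| < 1 -> `|mu * kap| < 1.
Proof.
case/andP: kap01 => k0 k1 mu1; rewrite normrM (ger0_norm k0).
by apply: le_lt_trans mu1; rewrite ler_piMr.
Qed.

Lemma dil_series_C1 mu G : `|mu| < 1 -> C1_on (disk rho) G ->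
  [/\ C1_on (disk rho) (dilation_series kap mu G),
      forall x, disk rho x ->
        partial1 (dilation_series kap mu G) x = dilation_series kap (mu * kap) (partial1 G) x
    & forall x, disk rho x ->
        partial2 (dilation_series kap mu G) x = dilation_series kap (mu * kap) (partial2 G) x].
Proof.
move=> mu1 C1G; have oD := @open_disk R rho.
have D1 x : disk rho x -> is_derive x (1, 0) (dilation_series kap mu G)
    (dilation_series kap (mu * kap) (partial1 G) x).
  by apply: dil_series_derive => // y yr; exact: C1_continuous_partial1 C1G yr.
have D2 x : disk rho x -> is_derive x (0, 1) (dilation_series kap mu G)
    (dilation_series kap (mu * kap) (partial2 G) x).
  by apply: dil_series_derive => // y yr; exact: C1_continuous_partial2 C1G yr.
split.
- apply: (C1_intro D1 D2 oD) => x; apply: dil_series_cont => //.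
  + exact: mukap.
  + by move=> y yr; exact: C1_continuous_partial1 C1G yr.
  + exact: mukap.
  + by move=> y yr; exact: C1_continuous_partial2 C1G yr.
- by move=> x /D1[].
- by move=> x /D2[].
Qed.

(** Both pure second derivatives are series with the same weight mu kap^2, and their terms are
    opposite because [G] is harmonic. *)
Lemma dil_series_harmonic mu G : `|mu| < 1 -> harmonic_on (disk rho) G ->
  harmonic_on (disk rho) (dilation_series kap mu G).
Proof.
move=> mu1 [[hG hG1 hG2] lap]; have oD := @open_disk R rho.
have mk := mukap mu1.
have [h p1 p2] := dil_series_C1 mu1 hG.
have [h1 p11 _] := dil_series_C1 mk hG1.
have [h2 _ p22] := dil_series_C1 mk hG2.
split.
  split.
  - exact: h.
  - by apply: C1_ext oD _ h1 => x xr; rewrite p1.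
  - by apply: C1_ext oD _ h2 => x xr; rewrite p2.
move=> x xr.
have [-> _] := partial_ext oD p1 xr; have [_ ->] := partial_ext oD p2 xr.
rewrite p11// p22// /dilation_series.
have kapk k : 0 <= kap ^+ k <= 1.
  by case/andP: kap01 => k0 k1; rewrite exprn_ge0// exprn_ile1.
have sub w : dotp w w <= dotp x x -> disk rho w by move=> wx; exact: le_lt_trans wx xr.
have [M hM] : exists M : R, forall w, dotp w w <= dotp x x -> `|partial1 (partial1 G) w| <= M.
  by apply: disk_bounded => w /sub; exact: C1_continuous_partial1 hG1.
set mu2 := _ * kap; have mu21 : `|mu2| < 1 by exact: mukap.
have bM k : `|partial1 (partial1 G) (kap ^+ k *: x)| <= M.
  by apply: hM; exact: disk_scale (kapk k) (lexx _).
pose a2 k := partial2 (partial2 G) (kap ^+ k *: x).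
pose a1 k := partial1 (partial1 G) (kap ^+ k *: x).
have E : a2 = (fun k => -1 * a1 k).
  apply/funext => k; rewrite mulN1r; apply/eqP; rewrite -addr_eq0 addrC; apply/eqP.
  by apply: lap; apply: sub; exact: disk_scale (kapk k) (lexx _).
suff : geo_sum mu2 a1 + geo_sum mu2 a2 = 0 by [].
by rewrite E -(geoZ (-1) mu21 (bM : forall k, `|a1 k| <= M)) mulN1r subrr.
Qed.

End DilationHarmonic.

(** * Image points *)

Section HalfPlane.
Context {R : realType}.
Implicit Types (f G H : R * R -> R) (x y v w c : R * R) (U : set (R * R)) (k : R).

Lemma dist2_ge0 x y : 0 <= dist2 x y.
Proof. by rewrite /dist2 addr_ge0// -expr2 sqr_ge0. Qed.

Lemma enormB x y : enorm (x - y) = Num.sqrt (dist2 y x).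
Proof. by []. Qed.

(** The distortion formula of inversions; the Lipschitz bounds for the flow and for the reflections
    are both read off from it. *)
Lemma dist2_inv c s x y : dist2 c x != 0 -> dist2 c y != 0 ->
  dist2 (cinv c s x) (cinv c s y) * (dist2 c x * dist2 c y) = s ^+ 2 * dist2 x y.
Proof.
rewrite /cinv /cinv1 /cinv2 {1 2}/dist2 {5 6}/dist2 /= => x0 y0.
rewrite /dist2 /=; field; rewrite -/(dist2 c x) -/(dist2 c y).
by rewrite /dist2 x0 y0.
Qed.

Lemma dist2_cinv c s x : dist2 c x != 0 -> dist2 c (cinv c s x) = s ^+ 2 / dist2 c x.
Proof.
move=> x0; rewrite {1}/dist2 /cinv /cinv1 /cinv2 /=.
have -> : dist2 c x = (x.1 - c.1) * (x.1 - c.1) + (x.2 - c.2) * (x.2 - c.2) by [].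
by move: x0; rewrite /dist2 => x0; field.
Qed.

Lemma cinvK c s x : s != 0 -> dist2 c x != 0 -> cinv c s (cinv c s x) = x.
Proof.
move=> s0 x0; rewrite {1}/cinv /cinv1 /cinv2 (dist2_cinv s x0).
rewrite /cinv /cinv1 /cinv2 /=; move: (dist2 c x) x0 => n n0.
by case: x => x1 x2 /=; congr pair; field; rewrite s0 n0.
Qed.

Variable al : R.
Hypothesis al0 : 0 < al.

(* The pole and the focus are the limit points of the pencil of circles that
   contains both interfaces. Inversion at the pole exchanges the right
   half-plane and the disk of radius al about 0, and makes the circles of the
   pencil concentric about 0. *)
Definition pole : R * R := (- al, 0).
Definition focus : R * R := (al, 0).
Definition cayley x := cinv pole (2 * al ^+ 2) x.
Definition halfplane : set (R * R) := [set x | 0 < x.1].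

Lemma open_halfplane : open halfplane.
Proof.
apply: (open_comp (f := fst : R * R -> R) (D := [set y : R | 0 < y])).
  by move=> x _; exact: cvg_fst.
exact: open_gt.
Qed.

Lemma halfplane_pole x : halfplane x -> 0 < dist2 pole x.
Proof.
rewrite /halfplane /pole /dist2 /= => x0; rewrite opprK subr0.
by rewrite ltr_pwDl ?mulr_gt0 ?addr_gt0// -expr2 sqr_ge0.
Qed.

Lemma disk_pole w : disk (al ^+ 2) w -> 0 < dist2 pole w.
Proof.
rewrite /disk /pole /dist2 /dotp /= => w0.
have w1 : 0 < w.1 + al.
  have h : 0 <= w.2 * w.2 by rewrite -expr2 sqr_ge0.
  have [//|w1] := ltP 0 (w.1 + al).
  have : 0 <= (- al - w.1) * (al - w.1) by have a0 := al0; apply: mulr_ge0; lra.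
  lra.
have h1 : 0 < (w.1 + al) * (w.1 + al) by rewrite mulr_gt0.
have h : 0 <= w.2 * w.2 by rewrite -expr2 sqr_ge0.
rewrite opprK subr0; lra.
Qed.

Lemma cayleyK x : dist2 pole x != 0 -> cayley (cayley x) = x.
Proof. by move=> x0; apply: cinvK => //; rewrite mulf_neq0// expf_neq0// gt_eqF. Qed.

Lemma cayley_disk x : halfplane x -> disk (al ^+ 2) (cayley x).
Proof.
move=> x0; have N0 := halfplane_pole x0; rewrite /disk /=.
have -> : dotp (cayley x) (cayley x) = al ^+ 2 - 4 * al ^+ 3 * x.1 / dist2 pole x.
  have := lt0r_neq0 N0.
  by rewrite /dotp /cayley /cinv /cinv1 /cinv2 /pole /dist2 /= !subr0 => h; field.
by rewrite gtrBl divr_gt0// mulr_gt0// mulr_gt0// exprn_gt0.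
Qed.

(* In the complex variable z, with phi z = (z - al) / (z + al), this is the
   Moebius map phi^-1 (k * phi z). *)
Definition focal_flow k x := cayley (k *: cayley x).

Lemma disk_scale_lt k w : 0 <= k <= 1 -> disk (al ^+ 2) w -> disk (al ^+ 2) (k *: w).
Proof. by move=> k01 w0; exact: le_lt_trans (disk_scale k01 (lexx _)) w0. Qed.

(** [cayley] exchanges the focus with 0, the centre of the dilations. Together with the 1-Lipschitz
    bound, the fixed point keeps all images of a point in the same ball about the focus. *)
Lemma hyp_focus k : focal_flow k focus = focus.
Proof.
have a0 : al != 0 by rewrite gt_eqF.
have D1 : dist2 pole focus = 4 * al ^+ 2 by rewrite /dist2 /pole /focus /=; ring.
have D2 : dist2 pole 0 = al ^+ 2 by rewrite /dist2 /pole /=; ring.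
have -> : focal_flow k focus = cayley 0.
  congr cayley; rewrite (_ : cayley focus = 0) ?scaler0//.
  rewrite /cayley /cinv /cinv1 /cinv2 D1 /=; congr pair; first by field.
  by rewrite subrr mulr0 mul0r addr0.
rewrite /cayley /cinv /cinv1 /cinv2 D2 /= /focus; congr pair; first by field.
by rewrite subrr mulr0 mul0r addr0.
Qed.

(** By the distortion formula the flow scales lengths at [x] by the left side divided by the right
    side. On the closed half-plane the right side is least at the origin, where it equals al^4 (1 +
    k)^2, and (1 + k)^2 >= 4 k. *)
Let hyp_bound k x : 0 <= k <= 1 -> halfplane x ->
  4 * al ^+ 4 * k <= dist2 pole (k *: cayley x) * dist2 pole x.
Proof.
case/andP => k0 k1 x0; have N0 := halfplane_pole x0.
have -> : dist2 pole (k *: cayley x) * dist2 pole x =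
    (1 - k) ^+ 2 * al ^+ 2 * dist2 pole x + 4 * k * (1 - k) * al ^+ 3 * (x.1 + al)
     + 4 * k ^+ 2 * al ^+ 4.
  have := lt0r_neq0 N0.
  by rewrite /cayley /cinv /cinv1 /cinv2 /pole /dist2 /= !scaleRE !subr0 => h; field.
have h1 : (1 - k) ^+ 2 * al ^+ 2 * al ^+ 2 <= (1 - k) ^+ 2 * al ^+ 2 * dist2 pole x.
  apply: ler_wpM2l; first by rewrite mulr_ge0// sqr_ge0.
  have -> : dist2 pole x = al ^+ 2 + (x.1 ^+ 2 + 2 * (al * x.1) + x.2 ^+ 2).
    by rewrite /dist2 /pole /=; ring.
  by rewrite lerDl !addr_ge0 ?sqr_ge0// mulr_ge0// mulr_ge0// ltW.
have h2 : 4 * k * (1 - k) * al ^+ 3 * al <= 4 * k * (1 - k) * al ^+ 3 * (x.1 + al).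
  apply: ler_wpM2l; last by rewrite lerDr ltW.
  apply: mulr_ge0; last exact/exprn_ge0/ltW.
  by apply: mulr_ge0; [exact: mulr_ge0|rewrite subr_ge0].
have h3 : 0 <= (1 - k) ^+ 2 * al ^+ 4 by rewrite mulr_ge0 ?sqr_ge0// exprn_ge0// ltW.
have -> : 4 * al ^+ 4 * k = (1 - k) ^+ 2 * al ^+ 2 * al ^+ 2 + 4 * k * (1 - k) * al ^+ 3 * al
     + 4 * k ^+ 2 * al ^+ 4 - (1 - k) ^+ 2 * al ^+ 4 by ring.
lra.
Qed.

(** A Moebius map multiplies the squared distance of two points by the product of its length factors
    at these points, and neither factor exceeds 1 by [hyp_bound]. *)
Lemma hyp_lipschitz k x y : 0 <= k <= 1 -> halfplane x -> halfplane y ->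
  dist2 (focal_flow k x) (focal_flow k y) <= dist2 x y.
Proof.
move=> k01 x0 y0; have [k0 k1] := andP k01.
have Nx := halfplane_pole x0; have Ny := halfplane_pole y0.
have Kx := disk_pole (disk_scale_lt k01 (cayley_disk x0)).
have Ky := disk_pole (disk_scale_lt k01 (cayley_disk y0)).
have := @dist2_inv pole (2 * al ^+ 2) _ _ (lt0r_neq0 Kx) (lt0r_neq0 Ky).
have := @dist2_inv pole (2 * al ^+ 2) _ _ (lt0r_neq0 Nx) (lt0r_neq0 Ny).
rewrite -/(focal_flow k x) -/(focal_flow k y) -/(cayley x) -/(cayley y).
have -> : dist2 (k *: cayley x) (k *: cayley y) = k ^+ 2 * dist2 (cayley x) (cayley y).
  by rewrite /dist2 /= !scaleRE; ring.
have := hyp_bound k01 x0; have := hyp_bound k01 y0.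
move: Nx Ny Kx Ky; move: (dist2 pole x) (dist2 pole y) (dist2 pole (k *: cayley x)) (dist2 pole (k *: cayley y)).
move=> nx ny kx ky Nx Ny Kx Ky hy hx E1 E2.
have d0 := dist2_ge0 x y; move: E1 E2 d0.
move: (dist2 (cayley x) _) (dist2 (focal_flow k x) _) (dist2 x y) => D1 D2 D E1 E2 d0.
set S := 4 * al ^+ 4 in hx hy.
have S0 : 0 < S by rewrite mulr_gt0// exprn_gt0.
have E : D2 * ((kx * nx) * (ky * ny)) = (S * k) * (S * k) * D.
  transitivity (D2 * (kx * ky) * (nx * ny)); first by ring.
  rewrite E2.
  transitivity ((2 * al ^+ 2) ^+ 2 * k ^+ 2 * (D1 * (nx * ny))); first by ring.
  by rewrite E1 /S; ring.
have Sk : 0 <= S * k by rewrite mulr_ge0// ltW.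
have h : (S * k) * (S * k) <= (kx * nx) * (ky * ny) by exact: ler_pM.
have Z : 0 < (kx * nx) * (ky * ny) by rewrite !mulr_gt0.
by rewrite -(ler_pM2r Z) E mulrC ler_wpM2l.
Qed.

End HalfPlane.

(** * The series of images and its Lipschitz constant *)

Section Lip.
Context {R : realType}.
Implicit Types (f H : R * R -> R) (x y : R * R).

Lemma enorm_ge0 x : 0 <= enorm x.
Proof. exact: sqrtr_ge0. Qed.

Lemma enorm_sqr x : enorm x ^+ 2 = dotp x x.
Proof. by rewrite /enorm sqr_sqrtr// /dotp -!expr2 addr_ge0// sqr_ge0. Qed.

Lemma coord_le_enorm x : `|x.1| <= enorm x /\ `|x.2| <= enorm x.
Proof.
have n0 := enorm_ge0 x; split; rewrite -(@ler_pXn2r _ 2) ?nnegrE// real_normK ?num_real//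
  enorm_sqr /dotp !expr2.
  by rewrite lerDl -expr2 sqr_ge0.
by rewrite lerDr -expr2 sqr_ge0.
Qed.

(** The axis-parallel path between two points may leave the disk, but the square of each coordinate
    stays below [r]; hence the partials are bounded on the disk of squared radius 2 r. *)
Lemma C1_lipschitz H r : C1_on setT H ->
  exists2 L : R, 0 <= L & forall x y, dotp x x <= r -> dotp y y <= r ->
    `|H x - H y| <= L * enorm (x - y).
Proof.
move=> hH.
have [M1 hM1] : exists M : R, forall w, dotp w w <= 2 * r -> `|partial1 H w| <= M.
  by apply: disk_bounded => w _; exact: C1_continuous_partial1 hH I.
have [M2 hM2] : exists M : R, forall w, dotp w w <= 2 * r -> `|partial2 H w| <= M.
  by apply: disk_bounded => w _; exact: C1_continuous_partial2 hH I.
exists (2 * Num.max 0 (Num.max M1 M2)); first by rewrite mulr_ge0// le_max lexx.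
set M := Num.max 0 _ => x y xr yr.
have M0 : 0 <= M by rewrite le_max lexx.
have bt (a b t : R) : between a b t -> t * t <= Num.max (a * a) (b * b).
  move=> h; rewrite le_max; move: h; rewrite /between; have [ab|ab] := leP a b => /andP[h1 h2].
    have [t0|t0] := leP 0 t; first by apply/orP; right; rewrite ler_pM.
    by apply/orP; left; rewrite -mulrNN -[leRHS]mulrNN; apply: ler_pM; lra.
  have [t0|t0] := leP 0 t; first by apply/orP; left; rewrite ler_pM.
  by apply/orP; right; rewrite -mulrNN -[leRHS]mulrNN; apply: ler_pM; lra.
have sq (a : R) : 0 <= a * a by rewrite -expr2 sqr_ge0.
apply: (@le_trans _ _ (M * (`|x.1 - y.1| + `|x.2 - y.2|))).
  apply: MVT_box_le => z /bt z1 /bt z2.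
  have zr : dotp z z <= 2 * r.
    have h1 : z.1 * z.1 <= r.
      apply: le_trans z1 _; rewrite ge_max; move: xr yr; rewrite /dotp.
      by move: (sq x.2) (sq y.2) => *; apply/andP; split; lra.
    have h2 : z.2 * z.2 <= r.
      apply: le_trans z2 _; rewrite ge_max; move: xr yr; rewrite /dotp.
      by move: (sq x.1) (sq y.1) => *; apply/andP; split; lra.
    by rewrite /dotp; lra.
  have [d1 d2 _ _] := hH z I; split => {z1 z2}.
  - exact: d1.
  - exact: d2.
  - by apply: le_trans (hM1 z zr) _; rewrite /M !le_max lexx !orbT.
  - by apply: le_trans (hM2 z zr) _; rewrite /M !le_max lexx !orbT.
have [h1 h2] := coord_le_enorm (x - y).
have -> : 2 * M * enorm (x - y) = M * (enorm (x - y) + enorm (x - y)) by ring.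
by rewrite ler_wpM2l// lerD.
Qed.

Variables (al kap mu : R) (H : R * R -> R).
Hypotheses (al0 : 0 < al) (kap01 : 0 <= kap <= 1) (mu1 : `|mu| < 1).
Hypothesis hH : harmonic_on setT H.

(** The series A of the overview. The iterates are written in closed form, as the flow of ratio
    kap^k, so that up to [cayley] the series is literally a [dilation_series]. *)
Definition image_series x : R := geo_sum mu (fun k => H (focal_flow al (kap ^+ k) x)).

Let kapk k : 0 <= kap ^+ k <= 1.
Proof. by case/andP: kap01 => k0 k1; rewrite exprn_ge0// exprn_ile1. Qed.

Let cayley_comp : harmonic_on (disk (al ^+ 2)) (fun w => H (cayley al w)).
Proof.
apply: (@harmonic_comp_cinv _ setT) => //; first exact: openT.
  exact: open_disk.
by move=> w /(disk_pole al0) /lt0r_neq0.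
Qed.

Lemma image_series_harmonic : harmonic_on (halfplane : set (R * R)) image_series.
Proof.
have := dil_series_harmonic kap01 mu1 cayley_comp.
apply: (@harmonic_comp_cinv _ (disk (al ^+ 2)) halfplane (dilation_series kap mu (fun w => H (cayley al w)))).
- exact: open_disk.
- exact: open_halfplane.
- by move=> w /(halfplane_pole al0) /lt0r_neq0.
- by move=> x /(cayley_disk al0).
Qed.

Let image_bounded x : halfplane x -> exists M : R, forall k, 0 <= k <= 1 -> `|H (focal_flow al k x)| <= M.
Proof.
move=> /(cayley_disk al0) wr; case: (cayley_comp) => -[hG _ _] _.
have [M hM] : exists M : R, forall w, dotp w w <= dotp (cayley al x) (cayley al x) ->
    `|H (cayley al w)| <= M.
  apply: disk_bounded => w h; apply: C1_continuous hG _; first exact: open_disk.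
  exact: le_lt_trans h wr.
by exists M => k k01; apply: hM; apply: disk_scale.
Qed.

(** The flow of ratio 1 is the identity, because [cayley] is an involution, and ratios multiply
    under composition. *)
Lemma image_series_rec x : halfplane x ->
  image_series x = H x + mu * image_series (focal_flow al kap x).
Proof.
move=> x0; have [M hM] := image_bounded x0.
rewrite /image_series (geoS mu1 (fun k => hM _ (kapk k))) expr0.
have Nx := lt0r_neq0 (halfplane_pole al0 x0).
congr (H _ + mu * geo_sum mu _).
  by rewrite /focal_flow scale1r cayleyK.
apply/funext => k; congr H; rewrite /focal_flow cayleyK ?scalerA -?exprSr//.
by apply: lt0r_neq0; apply: disk_pole => //; apply: disk_scale_lt => //; exact: cayley_disk.
Qed.

(** All image points stay in the ball about the focus and move no faster than the point itself, so
    the constants of the terms add up to a geometric series in |mu| alone. Neither [kap] nor [al]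
    enters the constant. *)
Lemma image_series_lipschitz (L r : R) x y :
  (forall x y, dist2 (focus al) x <= r -> dist2 (focus al) y <= r ->
     `|H x - H y| <= L * enorm (x - y)) -> 0 <= L ->
  halfplane x -> halfplane y -> dist2 (focus al) x <= r -> dist2 (focus al) y <= r ->
  `|image_series x - image_series y| <= L / (1 - `|mu|) * enorm (x - y).
Proof.
move=> lH L0 x0 y0 xr yr; rewrite /image_series.
have [M hM] := image_bounded x0; have [N hN] := image_bounded y0.
rewrite (geoB mu1 (fun k => hM _ (kapk k)) (fun k => hN _ (kapk k))).
rewrite mulrAC; apply: geo_bound => // k.
have f0 : halfplane (focus al) by exact: al0.
have hr z : halfplane z -> dist2 (focus al) z <= r -> dist2 (focus al) (focal_flow al (kap ^+ k) z) <= r.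
  move=> z0; apply: le_trans; rewrite -{1}(hyp_focus al0 (kap ^+ k)).
  exact: hyp_lipschitz.
apply: le_trans (lH _ _ (hr _ x0 xr) (hr _ y0 yr)) _.
rewrite ler_wpM2l// !enormB ler_sqrt ?dist2_ge0//.
exact: hyp_lipschitz.
Qed.

End Lip.

(** * Reflections in the circles of a coaxal pencil *)

Section Circle.
Context {R : realType}.
Variable al : R.
Hypothesis al0 : 0 < al.
Implicit Types (f : R * R -> R) (c : R) (x y z : R * R) (U V : set (R * R)).

(* pencil c vanishes exactly on the circle of center (c, 0) and squared radius
   rad2 c, and is negative inside. *)
Definition rad2 c : R := c ^+ 2 - al ^+ 2.
Definition pencil c x : R := dotp x x - 2 * c * x.1 + al ^+ 2.
Definition circle_refl c x : R * R := cinv (c, 0) (rad2 c) x.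
(* The squared radius of the image of the circle under inversion at the pole. *)
Definition modulus c : R := al ^+ 2 * (c - al) / (c + al).

Lemma pencilE c x : pencil c x = dist2 (c, 0) x - rad2 c.
Proof. by rewrite /pencil /dist2 /dotp /rad2 /=; ring. Qed.

Lemma rad2_gt0 c : al < c -> 0 < rad2 c.
Proof. by move=> h; have a0 := al0; rewrite /rad2 subr_gt0 ltr_pXn2r// nnegrE; lra. Qed.

Lemma pencil_le0_halfplane c x : al < c -> pencil c x <= 0 -> halfplane x.
Proof.
move=> h; have a0 := al0; rewrite /pencil => hx.
have d0 : 0 <= dotp x x by rewrite /dotp -!expr2 addr_ge0// sqr_ge0.
have a2 : 0 < al ^+ 2 by rewrite exprn_gt0.
have : 0 < c * x.1 by lra.
by rewrite pmulr_rgt0//; lra.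
Qed.

Lemma pencil_ge0_center c x : al < c -> 0 <= pencil c x -> rad2 c <= dist2 (c, 0) x.
Proof. by move=> h; rewrite pencilE subr_ge0. Qed.

(** The line x.1 = 0 is the common radical axis of the pencil; in the half-plane this orders the
    disks by their centres. *)
Lemma pencil_diff c1 c2 x : pencil c1 x - pencil c2 x = 2 * (c2 - c1) * x.1.
Proof. by rewrite /pencil; ring. Qed.

Lemma refl_fixed c x : al < c -> pencil c x = 0 -> circle_refl c x = x.
Proof.
move=> h; rewrite pencilE => /eqP; rewrite subr_eq0 => /eqP e.
have r0 := lt0r_neq0 (rad2_gt0 h).
rewrite /circle_refl /cinv /cinv1 /cinv2 e; case: x {e} => x1 x2 /=.
by congr pair; field.
Qed.

Lemma pencil_refl c x : dist2 (c, 0) x != 0 ->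
  pencil c (circle_refl c x) = - (rad2 c * pencil c x / dist2 (c, 0) x).
Proof.
move=> n0; rewrite !pencilE (dist2_cinv _ n0).
by move: (dist2 _ _) n0 (rad2 c) => n n0 r; field.
Qed.

Lemma refl_lipschitz c x y : al < c -> 0 <= pencil c x -> 0 <= pencil c y ->
  dist2 (circle_refl c x) (circle_refl c y) <= dist2 x y.
Proof.
move=> h /(pencil_ge0_center h) hx /(pencil_ge0_center h) hy; have r0 := rad2_gt0 h.
have nx := lt_le_trans r0 hx; have ny := lt_le_trans r0 hy.
have := dist2_inv (rad2 c) (lt0r_neq0 nx) (lt0r_neq0 ny).
rewrite -/(circle_refl c x) -/(circle_refl c y) => E.
rewrite -(ler_pM2r (mulr_gt0 nx ny)) E mulrC ler_wpM2l ?dist2_ge0//.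
by rewrite expr2 ler_pM// ltW.
Qed.

(** Since (c - al) (c + al) is the squared radius, the reflection exchanges focus and pole, and this
    is the distortion formula for the points [x] and [focus al]. *)
Lemma dist2_pole_refl c x : dist2 (c, 0) x != 0 ->
  dist2 (pole al) (circle_refl c x) = (c + al) ^+ 2 * dist2 (focus al) x / dist2 (c, 0) x.
Proof.
move=> n0; apply: (mulIf n0); rewrite divfK//.
have D a b : dist2 (- al, 0) (a, b) = (a + al) ^+ 2 + b ^+ 2 by rewrite /dist2 /=; ring.
rewrite /circle_refl /cinv /cinv1 /cinv2 /pole /focus D /=.
set n := dist2 (c, 0) x in n0 *.
have e : n = (x.1 - c) ^+ 2 + x.2 ^+ 2 by rewrite /n /dist2 /=; ring.
transitivity (((c + al) ^+ 2 * n + 2 * (c + al) * rad2 c * (x.1 - c)) +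
   rad2 c ^+ 2 * (((x.1 - c) ^+ 2 + x.2 ^+ 2) / n)).
  by field.
by rewrite -e divff// e /rad2 /dist2 /=; ring.
Qed.

(** By Apollonius, the ratio of the distances to the limit points is constant on each circle of the
    pencil; so these circles become concentric about 0. *)
Lemma dotp_cayley x : dist2 (pole al) x != 0 ->
  dotp (cayley al x) (cayley al x) = al ^+ 2 * dist2 (focus al) x / dist2 (pole al) x.
Proof.
move=> n0; apply: (mulIf n0); rewrite divfK//.
rewrite /cayley /cinv /cinv1 /cinv2 /dotp /=.
set n := dist2 (pole al) x in n0 *.
have e : n = (x.1 + al) ^+ 2 + x.2 ^+ 2 by rewrite /n /dist2 /=; ring.
transitivity (al ^+ 2 * n - 4 * al ^+ 3 * (x.1 + al) +
   4 * al ^+ 4 * (((x.1 + al) ^+ 2 + x.2 ^+ 2) / n)).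
  by field.
by rewrite -e divff// e /dist2 /=; ring.
Qed.

(** Inversions preserve symmetry with respect to circles: the reflection becomes the inversion in
    the image circle, which is centred at 0. *)
Lemma cayley_refl c x : al < c -> dist2 (c, 0) x != 0 -> dist2 (pole al) x != 0 ->
  dist2 (focus al) x != 0 ->
  cayley al (circle_refl c x) = (modulus c / dotp (cayley al x) (cayley al x)) *: cayley al x.
Proof.
move=> h n0 p0 f0; have a0 := al0.
have ca : c + al != 0 by rewrite gt_eqF; lra.
have al1 : al != 0 by rewrite gt_eqF.
rewrite (dotp_cayley p0) {1}/cayley /cinv1 /cinv2 {1}/cinv /cinv1 /cinv2 (dist2_pole_refl n0).
rewrite /cayley /circle_refl /cinv /cinv1 /cinv2 /modulus /rad2 /=.
set n := dist2 (c, 0) x in n0 *; set p := dist2 _ x in p0 *; set m := dist2 _ x in f0 *.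
have en : n = (x.1 - c) ^+ 2 + x.2 ^+ 2 by rewrite /n /dist2 /=; ring.
have ep : p = (x.1 + al) ^+ 2 + x.2 ^+ 2 by rewrite /p /dist2 /=; ring.
have em : m = (x.1 - al) ^+ 2 + x.2 ^+ 2 by rewrite /m /dist2 /=; ring.
have ep' : p = m + 4 * al * x.1 by rewrite ep em; ring.
have en' : n = m + 2 * (al - c) * x.1 + c ^+ 2 - al ^+ 2 by rewrite en em; ring.
congr pair; rewrite /= ?scaleRE.
- transitivity (- al + 2 * al ^+ 2 * ((c + al) * n + (c ^+ 2 - al ^+ 2) * (x.1 - c)) / ((c + al) ^+ 2 * m)).
    by field; rewrite ca n0 f0.
  transitivity ((c - al) / (c + al) * (- al * p + 2 * al ^+ 2 * (x.1 + al)) / m); last first.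
    by field; rewrite ca al1 f0 p0.
  by rewrite ep' en'; field; rewrite ca f0.
- transitivity (2 * al ^+ 2 * ((c ^+ 2 - al ^+ 2) * x.2) / ((c + al) ^+ 2 * m)).
    by field; rewrite ca n0 f0.
  transitivity ((c - al) / (c + al) * (2 * al ^+ 2 * x.2) / m); last first.
    by field; rewrite ca al1 f0 p0.
  by field; rewrite ca f0.
Qed.

Lemma modulus_gt0 c : al < c -> 0 < modulus c.
Proof.
by move=> h; have a0 := al0; rewrite /modulus divr_gt0 ?mulr_gt0 ?exprn_gt0 ?subr_gt0// addr_gt0//; lra.
Qed.

(** Two inversions in circles about 0 compose to the dilation by the quotient of the squared radii.
    The side conditions keep every intermediate point away from the zero denominators, where
    inversions take default values. *)
Lemma refl_refl c1 c2 x : al < c1 -> al < c2 ->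
  dist2 (c2, 0) x != 0 -> dist2 (pole al) x != 0 -> dist2 (focus al) x != 0 ->
  dist2 (c1, 0) (circle_refl c2 x) != 0 -> dist2 (pole al) (circle_refl c2 x) != 0 ->
  dist2 (focus al) (circle_refl c2 x) != 0 ->
  circle_refl c1 (circle_refl c2 x) = focal_flow al (modulus c1 / modulus c2) x.
Proof.
move=> h1 h2 a1 a2 a3 b1 b2 b3.
have a0 := al0.
have P0 : dist2 (pole al) (circle_refl c1 (circle_refl c2 x)) != 0.
  rewrite (dist2_pole_refl b1); apply: mulf_neq0; last by rewrite invr_eq0.
  apply: mulf_neq0; last exact: b3.
  by apply: expf_neq0; rewrite gt_eqF//; lra.
rewrite -[LHS](cayleyK al0 P0) /focal_flow; congr cayley.
rewrite (cayley_refl h1 b1 b2 b3) (cayley_refl h2 a1 a2 a3).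
have D : dotp (cayley al x) (cayley al x) != 0.
  rewrite (dotp_cayley a2); apply: mulf_neq0; last by rewrite invr_eq0.
  by apply: mulf_neq0; [apply: expf_neq0; rewrite gt_eqF|exact: a3].
set w := cayley al x in D *; set k := _ / dotp w w.
have -> : dotp (k *: w) (k *: w) = k ^+ 2 * dotp w w by rewrite /dotp /= !scaleRE; ring.
have m1 := lt0r_neq0 (modulus_gt0 h1); have m2 := lt0r_neq0 (modulus_gt0 h2).
rewrite scalerA; congr (_ *: _); rewrite /k.
by move: (dotp w w) D (modulus c1) m1 (modulus c2) m2 => n D k1 m1 k2 m2; field; rewrite m2 D.
Qed.

Lemma modulus_ratio c1 c2 : al < c1 -> c1 <= c2 -> 0 <= modulus c1 / modulus c2 <= 1.
Proof.
move=> h1 h12; have h2 := lt_le_trans h1 h12; have a0 := al0.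
have m1 := modulus_gt0 h1; have m2 := modulus_gt0 h2.
apply/andP; split; first by apply: divr_ge0; exact: ltW.
rewrite ler_pdivrMr// mul1r /modulus ler_pdivrMr; last by lra.
rewrite [leRHS]mulrAC ler_pdivlMr; last by lra.
have h : 0 <= al ^+ 2 * (2 * al * (c2 - c1)).
  by apply: mulr_ge0; [exact: sqr_ge0|apply: mulr_ge0; lra].
rewrite -subr_ge0; apply: le_trans h _; rewrite le_eqVlt; apply/orP; left; apply/eqP; ring.
Qed.

(** At a point of the circle, the differential of the reflection is the linear reflection in the
    tangent line, which reverses the normal. *)
Lemma refl_normal U V f c x : al < c -> open U -> open V ->
  (forall y, V y -> dist2 (c, 0) y != 0) -> (forall y, V y -> U (circle_refl c y)) ->
  C1_on U f -> V x -> pencil c x = 0 ->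
  dotp (grad (fun y => f (circle_refl c y)) x) (x - (c, 0)) = - dotp (grad f x) (x - (c, 0)).
Proof.
move=> h oU oV V0 VU hf Vx x0.
have [[_ E1] [_ E2]] := cinv_comp_partial oU oV V0 VU hf Vx.
have rx : cinv (c, 0) (rad2 c) x = x by exact: refl_fixed.
rewrite rx in E1 E2.
rewrite /grad /dotp [in LHS]/partial1 [in LHS]/partial2.
apply: etrans (congr2 +%R (congr1 ( *%R^~ _) E1) (congr1 ( *%R^~ _) E2)) _.
have e : dist2 (c, 0) x = rad2 c by apply/eqP; rewrite -subr_eq0 -pencilE x0.
have r0 := lt0r_neq0 (rad2_gt0 h).
move: (partial1 f x) (partial2 f x) => F1 F2.
rewrite /cinv_dx /cinv_dy e; move: e; rewrite /dist2 /= => e.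
move: (rad2 c) r0 e => r r0 e; rewrite subr0 in e *.
transitivity (- ((x.1 - c) * (x.1 - c) + x.2 * x.2) / r * (F1 * (x.1 - c) + F2 * x.2)).
  by field.
by rewrite e mulNr divff// mulN1r.
Qed.

End Circle.

(** * Functions defined piecewise *)

Section Glue.
Context {R : realType}.
Implicit Types (f g u F : R * R -> R) (c : R) (x y z : R * R) (U V W : set (R * R)).

Lemma harmonic_C1 U f : harmonic_on U f -> C1_on U f.
Proof. by case=> -[]. Qed.

Lemma harmonic_sub V U f : V `<=` U -> harmonic_on U f -> harmonic_on V f.
Proof.
move=> VU [[h0 h1 h2] lap]; split; first split.
- by move=> y /VU /h0.
- by move=> y /VU /h1.
- by move=> y /VU /h2.
- by move=> y /VU /lap.
Qed.

Lemma harmonic_ext U f g : open U -> (forall x, U x -> f x = g x) ->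
  harmonic_on U f -> harmonic_on U g.
Proof.
move=> oU fg [[h h1 h2] lap].
have e1 x : U x -> partial1 f x = partial1 g x by move=> Ux; case: (partial_ext oU fg Ux).
have e2 x : U x -> partial2 f x = partial2 g x by move=> Ux; case: (partial_ext oU fg Ux).
split; first split.
- exact: C1_ext oU fg h.
- exact: C1_ext oU e1 h1.
- exact: C1_ext oU e2 h2.
- move=> x Ux; have [<- _] := partial_ext oU e1 Ux; have [_ <-] := partial_ext oU e2 Ux.
  exact: lap.
Qed.

Lemma harmonic_local U g :
  (forall x, U x -> exists V F, [/\ open V, V x, (forall y, V y -> F y = g y) & harmonic_on V F]) ->
  harmonic_on U g.
Proof.
move=> h.
have k x : U x -> exists2 V, V x & harmonic_on V g.
  by move=> /h [V [F [oV Vx e hF]]]; exists V; [exact: Vx|exact: harmonic_ext oV e hF].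
split; first split.
- by move=> x /k [V Vx [[h0 _ _] _]]; exact: h0.
- by move=> x /k [V Vx [[_ h0 _] _]]; exact: h0.
- by move=> x /k [V Vx [[_ _ h0] _]]; exact: h0.
- by move=> x /k [V Vx [_ h0]]; exact: h0.
Qed.

Lemma harmonic_comb U f g (a b k : R) : open U -> harmonic_on U f -> harmonic_on U g ->
  harmonic_on U (fun x => a * f x + b * g x + k).
Proof.
move=> oU [[hf hf1 hf2] lf] [[hg hg1 hg2] lg].
have comb F G k' : C1_on U F -> C1_on U G ->
    [/\ C1_on U (fun x => a * F x + b * G x + k'),
        forall x, U x -> a * partial1 F x + b * partial1 G x + 0 =
          partial1 (fun x => a * F x + b * G x + k') x
      & forall x, U x -> a * partial2 F x + b * partial2 G x + 0 =
          partial2 (fun x => a * F x + b * G x + k') x].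
  move=> hF hG; split.
  - exact: C1_D oU (C1_D oU (C1_M oU (C1_cst _ oU) hF) (C1_M oU (C1_cst _ oU) hG)) (C1_cst _ oU).
  - move=> x Ux; have [_ E] := is_derive_add (is_derive_add (is_derive_mul (is_derive_const a x (1, 0)) (C1_is_derive1 hF Ux))
        (is_derive_mul (is_derive_const b x (1, 0)) (C1_is_derive1 hG Ux))) (is_derive_const k' x (1, 0)).
    apply: etrans (esym E); cbv beta; move: (F x) (G x) (partial1 F x) (partial1 G x) => ? ? ? ?; ring.
  - move=> x Ux; have [_ E] := is_derive_add (is_derive_add (is_derive_mul (is_derive_const a x (0, 1)) (C1_is_derive2 hF Ux))
        (is_derive_mul (is_derive_const b x (0, 1)) (C1_is_derive2 hG Ux))) (is_derive_const k' x (0, 1)).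
    apply: etrans (esym E); cbv beta; move: (F x) (G x) (partial2 F x) (partial2 G x) => ? ? ? ?; ring.
have [c e1 e2] := comb _ _ k hf hg.
have [c1 e11 _] := comb _ _ 0 hf1 hg1.
have [c2 _ e22] := comb _ _ 0 hf2 hg2.
split; first split.
- exact: c.
- exact: C1_ext oU e1 c1.
- exact: C1_ext oU e2 c2.
- move=> x Ux; have [<- _] := partial_ext oU e1 Ux; have [_ <-] := partial_ext oU e2 Ux.
  apply: etrans (congr2 +%R (esym (e11 x Ux)) (esym (e22 x Ux))) _.
  have := lf x Ux; have := lg x Ux.
  move: (partial1 (partial1 g) x) (partial2 (partial2 g) x) (partial1 (partial1 f) x) (partial2 (partial2 f) x) => g11 g22 f11 f22 hg0 hf0.
  transitivity (a * (f11 + f22) + b * (g11 + g22)); first by ring.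
  by rewrite hf0 hg0 !mulr0 addr0.
Qed.

Lemma continuous_glue g F1 F2 x : {for x, continuous F1} -> {for x, continuous F2} ->
  F1 x = g x -> F2 x = g x -> (\forall y \near x, g y = F1 y \/ g y = F2 y) ->
  {for x, continuous g}.
Proof.
move=> c1 c2 e1 e2 n; apply/cvgrPdistC_le => e e0.
move/cvgrPdistC_le: c1 => /(_ _ e0); move/cvgrPdistC_le: c2 => /(_ _ e0).
move: n; apply: filterS3 => y [->|->]; rewrite e1 e2 => h2 h1.
  exact: h1.
exact: h2.
Qed.

Lemma cvg_along (s : R) (x nu : R * R) : x + (s * t) *: nu @[t --> 0^'+] --> x.
Proof.
have h0 : (id t : R) @[t --> 0^'+] --> (0 : R).
  by apply: (@cvg_at_right_filter _ _ id 0 0); exact: cvg_id.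
have h1 : s * t @[t --> 0^'+] --> s * 0 by apply: cvgM h0; exact: cvg_cst.
have h2 : (s * t) *: nu @[t --> 0^'+] --> (s * 0) *: nu by exact: cvgZr_tmp.
have : x + (s * t) *: nu @[t --> 0^'+] --> x + (s * 0) *: nu.
  by apply: cvgD h2; exact: cvg_cst.
by rewrite mulr0 scale0r addr0.
Qed.

(** [u] agrees with [F] only on one side [W], but [F] is C1 on a full neighbourhood of the boundary
    point [x], so the one-sided limit is the value of the gradient of [F] at [x]. *)
Lemma normal_derivative_limit_side (s : R) (C : R * R) (r : R) u F V W x :
  open V -> C1_on V F -> V x -> open W -> (forall y, W y -> F y = u y) ->
  (\forall t \near 0^'+, W (x + (s * t) *: outward_normal C r x)) ->
  normal_derivative_limit s C r u x (dotp (grad F x) (outward_normal C r x)).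
Proof.
move=> oV hF Vx oW e nW; rewrite /normal_derivative_limit; set nu := outward_normal C r x.
have cx := @cvg_along s x nu.
have c1 : partial1 F (x + (s * t) *: nu) @[t --> 0^'+] --> partial1 F x.
  exact: (cvg_comp _ _ cx (C1_continuous_partial1 hF Vx)).
have c2 : partial2 F (x + (s * t) *: nu) @[t --> 0^'+] --> partial2 F x.
  exact: (cvg_comp _ _ cx (C1_continuous_partial2 hF Vx)).
have c3 : dotp (grad F (x + (s * t) *: nu)) nu @[t --> 0^'+] --> dotp (grad F x) nu.
  by apply: cvgD; [apply: cvgM c1 _|apply: cvgM c2 _]; exact: cvg_cst.
apply: cvg_trans c3; apply: near_eq_cvg.
move: nW; apply: filterS => t Wt.
by rewrite /dotp /grad /=; have [-> ->] := partial_ext oW e Wt.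
Qed.

Variables (al ci ce ri re ki ke : R).
Hypotheses (al0 : 0 < al) (alci : al < ci) (cice : ci < ce).
Hypotheses (ri0 : 0 < ri) (re0 : 0 < re).
Hypotheses (riE : ri ^+ 2 = rad2 al ci) (reE : re ^+ 2 = rad2 al ce).
Local Notation Pi := (pencil al ci).
Local Notation Pe := (pencil al ce).

Lemma circleP c r x : 0 < r -> r ^+ 2 = rad2 al c -> circle (c, 0) r x <-> pencil al c x = 0.
Proof.
move=> r0 rE; rewrite pencilE /circle /= enormB -rE; split=> [<-|/eqP].
  by rewrite sqr_sqrtr ?dist2_ge0// subrr.
by rewrite subr_eq0 => /eqP ->; rewrite sqrtr_sqr ger0_norm// ltW.
Qed.

Lemma pencil_continuous c x : {for x, continuous (pencil al c)}.
Proof.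
have h1 : w.1 @[w --> x] --> x.1 by exact: cvg_fst.
apply: cvgD; last exact: cvg_cst.
apply: cvgB; first exact: dotp_continuous.
by apply: cvgM; [exact: cvg_cst|exact: h1].
Qed.

Lemma open_pencil_lt0 c : open [set x | pencil al c x < 0].
Proof.
apply: (open_comp (f := pencil al c) (D := [set y : R | y < 0])); last exact: open_lt.
by move=> x _; exact: pencil_continuous.
Qed.

Lemma open_pencil_gt0 c : open [set x | 0 < pencil al c x].
Proof.
apply: (open_comp (f := pencil al c) (D := [set y : R | 0 < y])); last exact: open_gt.
by move=> x _; exact: pencil_continuous.
Qed.

(** At signed distance t from the circle along the normal the value is (r + t)^2 - r^2; its sign
    tells the side. *)
Lemma pencil_normal c r x t : 0 < r -> r ^+ 2 = rad2 al c -> pencil al c x = 0 ->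
  pencil al c (x + t *: outward_normal (c, 0) r x) = (2 * r + t) * t.
Proof.
move=> r0 rE; rewrite !pencilE -rE => /eqP; rewrite subr_eq0 => /eqP e.
have -> : dist2 (c, 0) (x + t *: outward_normal (c, 0) r x) = (1 + t / r) ^+ 2 * dist2 (c, 0) x.
  by rewrite /dist2 /outward_normal /= !scaleRE; ring.
by rewrite e; field; rewrite gt_eqF.
Qed.

Lemma pencil_nested x : Pi x <= 0 -> Pe x < Pi x.
Proof.
move=> h; have := pencil_le0_halfplane al0 alci h; rewrite /halfplane /= => x0.
have := pencil_diff al ci ce x; have : 0 < 2 * (ce - ci) * x.1.
  by rewrite mulr_gt0// mulr_gt0// subr_gt0.
lra.
Qed.

Lemma pencil_nested_gt0 x : 0 <= Pe x -> 0 < Pi x.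
Proof. by move=> h; rewrite ltNge; apply/negP => /[dup] /pencil_nested; lra. Qed.

Variables (Ui Ua Uo : set (R * R)) (Fi Fa Fo : R * R -> R).
Hypotheses (oUi : open Ui) (oUa : open Ua) (oUo : open Uo).
Hypotheses (hFi : harmonic_on Ui Fi) (hFa : harmonic_on Ua Fa) (hFo : harmonic_on Uo Fo).
Hypotheses (Uix : forall x, Pi x <= 0 -> Ui x)
  (Uax : forall x, 0 <= Pi x -> Pe x <= 0 -> Ua x)
  (Uox : forall x, 0 <= Pe x -> Uo x).
Hypotheses (ei : forall x, Pi x = 0 -> Fi x = Fa x) (ee : forall x, Pe x = 0 -> Fa x = Fo x).
Hypotheses (fi : forall x, Pi x = 0 ->
    ke * dotp (grad Fa x) (x - (ci, 0)) = ki * dotp (grad Fi x) (x - (ci, 0)))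
  (fe : forall x, Pe x = 0 ->
    1 * dotp (grad Fo x) (x - (ce, 0)) = ke * dotp (grad Fa x) (x - (ce, 0))).

(** Each piece is harmonic on an open set that contains its closed region. Gradients of the pieces
    therefore exist on the circles, where they express the flux conditions. *)
Definition glue x := if Pi x <= 0 then Fi x else if Pe x <= 0 then Fa x else Fo x.

Lemma glue_in x : Pi x <= 0 -> Fi x = glue x.
Proof. by rewrite /glue => ->. Qed.

Lemma glue_ann x : 0 <= Pi x -> Pe x <= 0 -> Fa x = glue x.
Proof.
rewrite /glue le_eqVlt => /orP[/eqP/esym h _|h ->]; first by rewrite h lexx ei.
by rewrite leNgt h.
Qed.

Lemma glue_out x : 0 <= Pe x -> Fo x = glue x.
Proof.
move=> h; rewrite /glue leNgt pencil_nested_gt0//=.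
by move: h; rewrite le_eqVlt => /orP[/eqP/esym h|h]; [rewrite h lexx ee|rewrite leNgt h].
Qed.

Definition ann : set (R * R) := [set x | 0 < Pi x] `&` [set x | Pe x < 0].

Lemma open_ann : open ann.
Proof. by apply: openI; [exact: open_pencil_gt0|exact: open_pencil_lt0]. Qed.

Lemma glue_continuous : continuous glue.
Proof.
move=> x; have ci' := C1_continuous oUi (harmonic_C1 hFi).
have ca := C1_continuous oUa (harmonic_C1 hFa); have co := C1_continuous oUo (harmonic_C1 hFo).
have nb W (h : open W) : W x -> \forall y \near x, W y by move=> Wx; exact: open_nbhs_nbhs.
have [i0|i0|i0] := ltgtP (Pi x) 0.
- apply: (@continuous_glue glue Fi Fi).
  + exact/ci'/Uix/ltW.
  + exact/ci'/Uix/ltW.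
  + exact/glue_in/ltW.
  + exact/glue_in/ltW.
  + have := nb _ (@open_pencil_lt0 ci) i0; apply: filterS => y /ltW h.
    by left; rewrite glue_in.
- have [e0|e0|e0] := ltgtP (Pe x) 0.
  + apply: (@continuous_glue glue Fa Fa).
    * by apply: ca; exact: Uax (ltW i0) (ltW e0).
    * by apply: ca; exact: Uax (ltW i0) (ltW e0).
    * exact: glue_ann (ltW i0) (ltW e0).
    * exact: glue_ann (ltW i0) (ltW e0).
    * have := nb _ open_ann (conj i0 e0); apply: filterS => y [/ltW h1 /ltW h2].
      by left; rewrite glue_ann.
  + apply: (@continuous_glue glue Fo Fo).
    * exact/co/Uox/ltW.
    * exact/co/Uox/ltW.
    * exact/glue_out/ltW.
    * exact/glue_out/ltW.
    * have := nb _ (@open_pencil_gt0 ce) e0; apply: filterS => y /ltW h.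
      by left; rewrite glue_out.
  + apply: (@continuous_glue glue Fa Fo).
    * by apply: ca; apply: Uax (ltW i0) _; rewrite e0.
    * by apply: co; apply: Uox; rewrite e0.
    * by apply: glue_ann (ltW i0) _; rewrite e0.
    * by apply: glue_out; rewrite e0.
    * have := nb _ (@open_pencil_gt0 ci) i0; apply: filterS => y /ltW h.
      have [h1|/ltW h1] := leP (Pe y) 0; first by left; rewrite glue_ann.
      by right; rewrite glue_out.
- have le0 : Pi x <= 0 by rewrite i0.
  have e0 : Pe x < 0 by rewrite -i0; exact: pencil_nested.
  apply: (@continuous_glue glue Fi Fa).
  + exact/ci'/Uix.
  + by apply: ca; apply: Uax (ltW e0); rewrite i0.
  + exact: glue_in.
  + by apply: glue_ann (ltW e0); rewrite i0.
  + have := nb _ (@open_pencil_lt0 ce) e0; apply: filterS => y /ltW h.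
    have [h1|/ltW h1] := leP (Pi y) 0; first by left; rewrite glue_in.
    by right; rewrite glue_ann.
Qed.

Lemma glue_harmonic : harmonic_on (~` (circle (ci, 0) ri `|` circle (ce, 0) re)) glue.
Proof.
apply: harmonic_local => x nx.
have ni : Pi x <> 0 by move=> h; apply: nx; left; apply/(circleP x ri0 riE).
have ne : Pe x <> 0 by move=> h; apply: nx; right; apply/(circleP x re0 reE).
have [i0|i0|//] := ltgtP (Pi x) 0.
- exists [set x | Pi x < 0], Fi; split => //.
  + exact: open_pencil_lt0.
  + by move=> y /ltW; exact: glue_in.
  + by apply: harmonic_sub hFi => y /ltW; exact: Uix.
have [e0|e0|//] := ltgtP (Pe x) 0.
- exists ann, Fa; split => //.
  + exact: open_ann.
  + by move=> y [/ltW h1 /ltW h2]; exact: glue_ann.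
  + by apply: harmonic_sub hFa => y [/ltW h1 /ltW h2]; exact: Uax.
- exists [set x | 0 < Pe x], Fo; split => //.
  + exact: open_pencil_gt0.
  + by move=> y /ltW; exact: glue_out.
  + by apply: harmonic_sub hFo => y /ltW; exact: Uox.
Qed.

Let flux_scale (k1 k2 r : R) (a b v : R * R) : k1 * dotp a v = k2 * dotp b v ->
  k1 * dotp a (r^-1 *: v) = k2 * dotp b (r^-1 *: v).
Proof.
move=> h; have E w : dotp w (r^-1 *: v) = r^-1 * dotp w v by rewrite /dotp /= !scaleRE; ring.
by rewrite !E mulrCA h mulrCA.
Qed.

Let near_side (s : R) (U : set (R * R)) x nu : open U -> U x ->
  \forall t \near 0^'+, U (x + (s * t) *: nu).
Proof.
move=> oU Ux.
have cx := @cvg_along s x nu.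
exact: (cx _ (open_nbhs_nbhs (conj oU Ux))).
Qed.

Lemma glue_flux_i : flux_condition ke ki (ci, 0) ri glue.
Proof.
move=> x /(circleP x ri0 riE) i0.
have e0 : Pe x < 0 by rewrite -i0; apply: pencil_nested; rewrite i0.
exists (dotp (grad Fa x) (outward_normal (ci, 0) ri x)),
  (dotp (grad Fi x) (outward_normal (ci, 0) ri x)); split.
- apply: (@normal_derivative_limit_side 1 (ci, 0) ri glue Fa Ua ann).
  + exact: oUa.
  + exact: harmonic_C1 hFa.
  + by apply: Uax (ltW e0); rewrite i0.
  + exact: open_ann.
  + by move=> y [/ltW h1 /ltW h2]; exact: glue_ann.
  + have := near_side 1 (outward_normal (ci, 0) ri x) (@open_pencil_lt0 ce) e0.
    have := nbhs_right_gt (0 : R).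
    apply: filterS2 => t t0 h; split => //=.
    by rewrite (pencil_normal _ ri0 riE i0) mul1r mulr_gt0// addr_gt0// mulr_gt0.
- apply: (@normal_derivative_limit_side (-1) (ci, 0) ri glue Fi Ui [set y | Pi y < 0]).
  + exact: oUi.
  + exact: harmonic_C1 hFi.
  + by apply: Uix; rewrite i0.
  + exact: open_pencil_lt0.
  + by move=> y /ltW; exact: glue_in.
  + have := nbhs_right_lt ri0; have := nbhs_right_gt (0 : R).
    apply: filterS2 => t t0 tr; rewrite /= (pencil_normal _ ri0 riE i0).
    have : 0 < (2 * ri - t) * t by rewrite mulr_gt0//; lra.
    lra.
- by apply: flux_scale; exact: fi.
Qed.

Lemma glue_flux_e : flux_condition 1 ke (ce, 0) re glue.
Proof.
move=> x /(circleP x re0 reE) e0.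
have i0 : 0 < Pi x by apply: pencil_nested_gt0; rewrite e0.
exists (dotp (grad Fo x) (outward_normal (ce, 0) re x)),
  (dotp (grad Fa x) (outward_normal (ce, 0) re x)); split.
- apply: (@normal_derivative_limit_side 1 (ce, 0) re glue Fo Uo [set y | 0 < Pe y]).
  + exact: oUo.
  + exact: harmonic_C1 hFo.
  + by apply: Uox; rewrite e0.
  + exact: open_pencil_gt0.
  + by move=> y /ltW; exact: glue_out.
  + have := nbhs_right_gt (0 : R); apply: filterS => t t0.
    by rewrite /= (pencil_normal _ re0 reE e0) mul1r mulr_gt0// addr_gt0// mulr_gt0.
- apply: (@normal_derivative_limit_side (-1) (ce, 0) re glue Fa Ua ann).
  + exact: oUa.
  + exact: harmonic_C1 hFa.
  + by apply: Uax (ltW i0) _; rewrite e0.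
  + exact: open_ann.
  + by move=> y [/ltW h1 /ltW h2]; exact: glue_ann.
  + have := near_side (-1) (outward_normal (ce, 0) re x) (@open_pencil_gt0 ci) i0.
    have := nbhs_right_lt re0; have := nbhs_right_gt (0 : R).
    apply: filterS3 => t t0 tr h; split => //=.
    rewrite (pencil_normal _ re0 reE e0).
    have : 0 < (2 * re - t) * t by rewrite mulr_gt0//; lra.
    lra.
- by apply: flux_scale; exact: fe.
Qed.

End Glue.

(** * The solution by the method of images *)

Section Existence.
Context {R : realType}.
Implicit Types (f g u F : R * R -> R) (c : R) (x y z v : R * R) (U V W : set (R * R)).

Lemma grad_comb U f g (a b k : R) x v : C1_on U f -> C1_on U g -> U x ->
  dotp (grad (fun x => a * f x + b * g x + k) x) v =
  a * dotp (grad f x) v + b * dotp (grad g x) v.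
Proof.
move=> hf hg Ux.
have D w p q : is_derive x w f p -> is_derive x w g q ->
    'D_w (fun x => a * f x + b * g x + k) x = a * p + b * q.
  move=> df dg; have [_ ->] := is_derive_add (is_derive_add (is_derive_mul (is_derive_const a x w) df) (is_derive_mul (is_derive_const b x w) dg)) (is_derive_const k x w).
  by cbv beta; move: (f x) (g x) => ? ?; ring.
rewrite /dotp /grad [in LHS]/partial1 [in LHS]/partial2 /=.
rewrite (D _ _ _ (C1_is_derive1 hf Ux) (C1_is_derive1 hg Ux)) (D _ _ _ (C1_is_derive2 hf Ux) (C1_is_derive2 hg Ux)).
by move: (partial1 f x) (partial2 f x) (partial1 g x) (partial2 g x) => *; ring.
Qed.

Variables (al ci ce ri re ki ke : R).
Hypotheses (al0 : 0 < al) (alci : al < ci) (cice : ci < ce).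
Hypotheses (ri0 : 0 < ri) (re0 : 0 < re).
Hypotheses (riE : ri ^+ 2 = rad2 al ci) (reE : re ^+ 2 = rad2 al ce).
Hypotheses (ki0 : 0 < ki) (ke0 : 0 < ke).
Local Notation Pi := (pencil al ci).
Local Notation Pe := (pencil al ce).
Local Notation Ri := (circle_refl al ci).
Local Notation Re := (circle_refl al ce).

Let alce : al < ce. Proof. exact: lt_trans cice. Qed.

(** The centre is removed because the reflection takes its default value there. *)
Definition refl_dom c U : set (R * R) := [set x | 0 < dist2 (c, 0) x] `&` [set x | U (circle_refl al c x)].

Lemma open_dist2 c : open [set x : R * R | 0 < dist2 (c, 0) x].
Proof.
apply: (open_comp (f := dist2 (c, 0)) (D := [set y : R | 0 < y])); last exact: open_gt.
by move=> x _; exact: C1_continuous openT (C1_dist2 (c, 0) openT) I.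
Qed.

Lemma refl_continuous c x : 0 < dist2 (c, 0) x -> circle_refl al c y @[y --> x] --> circle_refl al c x.
Proof.
move=> n0; have oV := @open_dist2 c.
have V0 y : [set x : R * R | 0 < dist2 (c, 0) x] y -> dist2 (c, 0) y != 0 by move=> /lt0r_neq0.
exact: (cvg_pair (C1_continuous oV (C1_cinv1 (rad2 al c) oV V0) n0)
                 (C1_continuous oV (C1_cinv2 (rad2 al c) oV V0) n0)).
Qed.

Lemma open_refl_dom c U : open U -> open (refl_dom c U).
Proof.
move=> oU; rewrite openE => x [n0 Ux]; apply: filterI.
  exact: open_nbhs_nbhs (conj (@open_dist2 c) n0).
by apply: (refl_continuous n0); exact: open_nbhs_nbhs.
Qed.

Lemma refl_dom_neq0 c U x : refl_dom c U x -> dist2 (c, 0) x != 0.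
Proof. by case=> /lt0r_neq0. Qed.

Lemma harmonic_refl c U f : open U -> harmonic_on U f ->
  harmonic_on (refl_dom c U) (fun x => f (circle_refl al c x)).
Proof.
move=> oU hf; apply: (harmonic_comp_cinv oU (open_refl_dom oU) _ _ hf).
- by move=> x /refl_dom_neq0.
- by move=> x [].
Qed.

Lemma pencil_ge0_dom c x : al < c -> 0 <= pencil al c x ->
  0 < dist2 (c, 0) x /\ pencil al c (circle_refl al c x) <= 0.
Proof.
move=> h x0; have n0 := lt_le_trans (rad2_gt0 al0 h) (pencil_ge0_center h x0).
split=> //; rewrite (pencil_refl _ (lt0r_neq0 n0)) oppr_le0.
by apply: divr_ge0 (ltW n0); apply: mulr_ge0 x0; exact: ltW (rad2_gt0 al0 h).
Qed.

Variables (H : R * R -> R) (L : R).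
Hypotheses (hH : harmonic_on setT H) (L0 : 0 <= L).
Hypothesis lH : forall x y, dist2 (focus al) x <= 4 * re ^+ 2 ->
  dist2 (focus al) y <= 4 * re ^+ 2 -> `|H x - H y| <= L * enorm (x - y).

(* With these coefficients, A x = H x + mu * A (Ri (Re x)) gives the
   transmission conditions on both circles, because a reflected function has
   the same values and the opposite normal derivative on the circle. *)
Definition contrast_e : R := (ke - 1) / (ke + 1).
Definition contrast_i : R := (ke - ki) / (ke + ki).
Definition transmit_in : R := 2 / (1 + ke).
Definition transmit_out : R := 2 * ke / (1 + ke).
Let mu := contrast_e * contrast_i.
Let kap := modulus al ci / modulus al ce.

Let mu1 : `|mu| < 1.
Proof.
have h (p q : R) : 0 < p -> 0 < q -> `|(p - q) / (p + q)| < 1.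
  move=> p0 q0; have pq : 0 < p + q by rewrite addr_gt0.
  rewrite normrM normfV (gtr0_norm pq) ltr_pdivrMr// mul1r ltr_norml; apply/andP; split; lra.
rewrite /mu normrM -[ltRHS]mulr1; apply: ltr_pM => //; exact: h.
Qed.

Let kap01 : 0 <= kap <= 1. Proof. exact: modulus_ratio (ltW cice). Qed.

Let A := image_series al kap mu H.
Let B x := A (Ri x).
Let E x := H (Re x).
(* Makes u - H tend to 0 at infinity, where Re and Ri tend to the
   centers. *)
Definition shift_const : R := contrast_e * H (ce, 0) - transmit_out * contrast_i * transmit_in * A (ci, 0).
Let K := shift_const.
Let VB := refl_dom ci halfplane.
Let VE := refl_dom ce setT.

(** The coefficients 0 and 1 keep every piece in the shape a f + b g + k of [harmonic_comb] and
    [grad_comb]. On the inner circle [B] equals [A], and the fluxes match because ke (1 -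
    [contrast_i]) = ki (1 + [contrast_i]). On the outer circle the recursion for [A] is used with
    [transmit_in] = 1 - [contrast_e] and [transmit_out] = 1 + [contrast_e]. *)
Let Fi x := (1 + contrast_i) * transmit_in * A x + 0 * A x + K.
Let Fa x := transmit_in * A x + contrast_i * transmit_in * B x + K.
Let Fo x := 1 * H x + 1 * (- contrast_e * E x + transmit_out * contrast_i * transmit_in * B x + K) + 0.

Definition image_solution := glue al ci ce Fi Fa Fo.

Let oVB : open VB. Proof. exact: open_refl_dom (@open_halfplane R). Qed.
Let oVE : open VE. Proof. exact: open_refl_dom openT. Qed.

Let hA : harmonic_on halfplane A. Proof. exact: image_series_harmonic. Qed.
Let hB : harmonic_on VB B. Proof. exact: harmonic_refl (@open_halfplane R) hA. Qed.
Let hE : harmonic_on VE E. Proof. exact: harmonic_refl openT hH. Qed.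

Let hFi : harmonic_on halfplane Fi.
Proof. exact: harmonic_comb (@open_halfplane R) hA hA. Qed.

Let hFa : harmonic_on (halfplane `&` VB) Fa.
Proof.
apply: harmonic_comb; first by apply: openI => //; exact: open_halfplane.
  by apply: harmonic_sub hA => x [].
by apply: harmonic_sub hB => x [].
Qed.

Let hFo : harmonic_on (VE `&` VB) Fo.
Proof.
have oV : open (VE `&` VB) by exact: openI.
apply: harmonic_comb => //; first by apply: harmonic_sub hH.
apply: harmonic_comb => //; first by apply: harmonic_sub hE => x [].
by apply: harmonic_sub hB => x [].
Qed.

Let VBx x : 0 <= Pi x -> VB x.
Proof.
move=> /(pencil_ge0_dom alci) [n0 r0]; split; first exact: n0.
exact: (pencil_le0_halfplane al0 alci r0).
Qed.

Let VEx x : 0 <= Pe x -> VE x.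
Proof. by move=> /(pencil_ge0_dom alce) [n0 r0]; split. Qed.

Let Uax x : 0 <= Pi x -> Pe x <= 0 -> (halfplane `&` VB) x.
Proof. by move=> h1 h2; split; [exact: (pencil_le0_halfplane al0 alce h2)|exact: VBx]. Qed.

Let Uox x : 0 <= Pe x -> (VE `&` VB) x.
Proof. by move=> h; split; [exact: VEx|apply/VBx/ltW/(pencil_nested_gt0 al0 alci cice)]. Qed.

Let kes : 1 + ke != 0. Proof. by rewrite gt_eqF// addr_gt0. Qed.
Let kes' : ke + 1 != 0. Proof. by rewrite gt_eqF// addr_gt0. Qed.
Let kis : ke + ki != 0. Proof. by rewrite gt_eqF// addr_gt0. Qed.

Let ei x : Pi x = 0 -> Fi x = Fa x.
Proof. by move=> x0; rewrite /Fi /Fa /B refl_fixed//; ring. Qed.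

(** The recursion is needed in a neighbourhood of the point, not only on the circle, because the
    flux condition differentiates it. *)
Let A_rec x : Pe x = 0 -> \forall y \near x,
  A y = H y + mu * B (Re y).
Proof.
move=> e0; have i0 : 0 < Pi x by apply: (pencil_nested_gt0 al0 alci cice); rewrite e0.
have x0 : halfplane x by apply: (pencil_le0_halfplane al0 alce); rewrite e0.
have hxe := pencil_ge0_dom alce (eq_ind_r (fun t => 0 <= t) (lexx 0) e0).
have rx := refl_fixed al0 alce e0.
(* On [W] the point avoids the centre of the inner circle, the pole and the focus, as [refl_refl]
   demands of both [y] and [Re y]. *)
pose W := [set y : R * R | 0 < dist2 (ci, 0) y] `&` (halfplane `&`
  [set y : R * R | 0 < dist2 (focus al) y]).
have oW : open W.
  by apply: openI; [exact: open_dist2|apply: openI; [exact: open_halfplane|exact: open_dist2]].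
have Wx : W x.
  split; first by have [] := VBx (ltW i0).
  split => //=; rewrite lt_neqAle dist2_ge0 andbT eq_sym; apply/eqP => f0.
  (* The focus lies strictly inside the outer circle, hence differs from [x]. *)
  have : Pe (focus al) < 0.
    have -> : Pe (focus al) = 2 * al * (al - ce) by rewrite /pencil /dotp /focus /=; ring.
    by rewrite nmulr_llt0 ?mulr_gt0// subr_lt0.
  have fx : x = focus al.
    move: f0; rewrite /dist2 /focus /= -!expr2 => /eqP; rewrite paddr_eq0 ?sqr_ge0// !sqrf_eq0.
    by case: x {x0 i0 e0 hxe rx} => x1 x2 /=; rewrite !subr_eq0 => /andP[/eqP -> /eqP ->].
  by rewrite -fx e0 ltxx.
have nW : \forall y \near x, W y by exact: open_nbhs_nbhs.
have nE : \forall y \near x, 0 < dist2 (ce, 0) y by exact: open_nbhs_nbhs (conj (@open_dist2 ce) hxe.1).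
have nR : \forall y \near x, W (Re y).
  by apply: (refl_continuous hxe.1); rewrite -/(circle_refl al ce x) rx; exact: open_nbhs_nbhs.
apply: filterS3 nW nE nR => y [_ [y0 yf]] ye [ri' [rh rf]].
rewrite {1}/A (image_series_rec al0 kap01 mu1 hH y0) /B; congr (_ + mu * A _).
apply/esym/refl_refl => //; apply: lt0r_neq0 => //; exact: halfplane_pole.
Qed.

Let ee x : Pe x = 0 -> Fa x = Fo x.
Proof.
move=> e0; have rx := refl_fixed al0 alce e0.
have := nbhs_singleton (A_rec e0); rewrite /Fa /Fo rx /E rx /mu => ->.
by move: (H x) (B x) => h b; rewrite /transmit_in /transmit_out /contrast_e; field; rewrite ?kes ?kes'.
Qed.

Let fi_identity (Di Da DA DB : R) :
  Di = (1 + contrast_i) * transmit_in * DA + 0 * DA -> Da = transmit_in * DA + contrast_i * transmit_in * DB ->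
  DB = - DA -> ke * Da = ki * Di.
Proof. by move=> -> -> ->; rewrite /contrast_i; field; exact: kis. Qed.

Let fe_identity (Do DEB Da DHB DH DB DE DBR : R) :
  Do = 1 * DH + 1 * DEB -> DEB = - contrast_e * DE + transmit_out * contrast_i * transmit_in * DB ->
  Da = 1 * DHB + (mu * transmit_in) * DBR -> DHB = transmit_in * DH + contrast_i * transmit_in * DB ->
  DE = - DH -> DBR = - DB -> 1 * Do = ke * Da.
Proof.
by move=> -> -> -> -> -> ->; rewrite /mu /transmit_in /transmit_out /contrast_e; field; rewrite ?kes ?kes'.
Qed.

Let fi x : Pi x = 0 ->
  ke * dotp (grad Fa x) (x - (ci, 0)) = ki * dotp (grad Fi x) (x - (ci, 0)).
Proof.
move=> i0; have x0 : halfplane x by apply: (pencil_le0_halfplane al0 alci); rewrite i0.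
have bx : VB x by apply: VBx; rewrite i0.
set v := x - _.
have DFi : dotp (grad Fi x) v =
    (1 + contrast_i) * transmit_in * dotp (grad A x) v + 0 * dotp (grad A x) v.
  exact: (@grad_comb halfplane A A _ _ K x v (harmonic_C1 hA) (harmonic_C1 hA) x0).
have U0 : (halfplane `&` VB) x by [].
have cA : C1_on (halfplane `&` VB) A by apply: harmonic_C1; apply: harmonic_sub hA => y [].
have cB : C1_on (halfplane `&` VB) B by apply: harmonic_C1; apply: harmonic_sub hB => y [].
have DFa : dotp (grad Fa x) v = transmit_in * dotp (grad A x) v + contrast_i * transmit_in * dotp (grad B x) v.
  exact: (@grad_comb _ A B _ _ K x v cA cB U0).
have DB : dotp (grad B x) v = - dotp (grad A x) v.
  apply: (refl_normal al0 alci (@open_halfplane R) oVB _ _ (harmonic_C1 hA) bx i0).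
    by move=> y /refl_dom_neq0.
  by move=> y [].
exact: fi_identity DFi DFa DB.
Qed.

Let fe x : Pe x = 0 ->
  1 * dotp (grad Fo x) (x - (ce, 0)) = ke * dotp (grad Fa x) (x - (ce, 0)).
Proof.
move=> e0; have rx := refl_fixed al0 alce e0.
have i0 : 0 < Pi x by apply: (pencil_nested_gt0 al0 alci cice); rewrite e0.
have x0 : halfplane x by apply: (pencil_le0_halfplane al0 alce); rewrite e0.
have bx := VBx (ltW i0).
have ex : VE x by apply: VEx; rewrite e0.
pose W := refl_dom ce VB.
have oW : open W by exact: open_refl_dom.
have Wx : W x by split; [have [] := ex|rewrite /= rx].
have hBR : harmonic_on W (fun y => B (Re y)) by exact: harmonic_refl.
pose U := halfplane `&` (VB `&` (VE `&` W)).
have Ux : U x by [].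
have sub V F : U `<=` V -> harmonic_on V F -> C1_on U F.
  by move=> UV hF; apply: harmonic_C1; exact: harmonic_sub hF.
have cH : C1_on U H by apply: sub hH.
have cB : C1_on U B by apply: sub hB => y [_ []].
have cE : C1_on U E by apply: sub hE => y [_ [_ []]].
have cBR : C1_on U (fun y => B (Re y)) by apply: sub hBR => y [_ [_ []]].
have oU : open U.
  by apply: openI; [exact: open_halfplane|apply: openI => //; exact: openI].
(* The annulus piece with [A] expanded by the recursion. Against the outer piece it now involves
   only [H], [B] and their reflections in the outer circle, whose normal derivatives are the
   opposite ones. *)
pose Fa' y := 1 * (transmit_in * H y + contrast_i * transmit_in * B y + K) + (mu * transmit_in) * B (Re y) + 0.
have EF : \forall y \near x, Fa y = Fa' y.
  by have := A_rec e0; apply: filterS => y Ay; rewrite /Fa Ay /Fa'; ring.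
have gF : grad Fa x = grad Fa' x.
  by rewrite /grad; congr pair; exact: near_eq_derive.
rewrite gF; set v := x - _.
have nE : dotp (grad E x) v = - dotp (grad H x) v.
  apply: (refl_normal al0 alce openT oVE _ _ (harmonic_C1 hH) ex e0) => //.
  by move=> y /refl_dom_neq0.
have nB : dotp (grad (fun y => B (Re y)) x) v = - dotp (grad B x) v.
  apply: (refl_normal al0 alce oVB oW _ _ (harmonic_C1 hB) Wx e0) => //.
    by move=> y /refl_dom_neq0.
  by move=> y [].
have cEB : C1_on U (fun y => - contrast_e * E y + transmit_out * contrast_i * transmit_in * B y + K).
  exact: C1_D oU (C1_D oU (C1_M oU (C1_cst _ oU) cE) (C1_M oU (C1_cst _ oU) cB)) (C1_cst _ oU).
have cHB : C1_on U (fun y => transmit_in * H y + contrast_i * transmit_in * B y + K).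
  exact: C1_D oU (C1_D oU (C1_M oU (C1_cst _ oU) cH) (C1_M oU (C1_cst _ oU) cB)) (C1_cst _ oU).
pose FEB y := - contrast_e * E y + transmit_out * contrast_i * transmit_in * B y + K.
pose FHB y := transmit_in * H y + contrast_i * transmit_in * B y + K.
have D1 : dotp (grad Fo x) v = 1 * dotp (grad H x) v + 1 * dotp (grad FEB x) v.
  exact: (@grad_comb _ H FEB 1 1 0 x v cH cEB Ux).
have D2 : dotp (grad FEB x) v = - contrast_e * dotp (grad E x) v + transmit_out * contrast_i * transmit_in * dotp (grad B x) v.
  exact: (@grad_comb _ E B _ _ K x v cE cB Ux).
have D3 : dotp (grad Fa' x) v = 1 * dotp (grad FHB x) v + (mu * transmit_in) * dotp (grad (fun y => B (Re y)) x) v.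
  exact: (@grad_comb _ FHB (fun y => B (Re y)) 1 _ 0 x v cHB cBR Ux).
have D4 : dotp (grad FHB x) v = transmit_in * dotp (grad H x) v + contrast_i * transmit_in * dotp (grad B x) v.
  exact: (@grad_comb _ H B _ _ K x v cH cB Ux).
exact: fe_identity D1 D2 D3 D4 nE nB.
Qed.

Lemma image_solution_continuous : continuous image_solution.
Proof.
exact: (glue_continuous al0 alci cice (@open_halfplane R)
  (openI (@open_halfplane R) oVB) (openI oVE oVB) hFi hFa hFo
  (fun x => @pencil_le0_halfplane _ _ al0 ci x alci) Uax Uox ei ee).
Qed.

Lemma image_solution_harmonic : harmonic_on (~` (circle (ci, 0) ri `|` circle (ce, 0) re)) image_solution.
Proof.
exact: (glue_harmonic al0 alci cice ri0 re0 riE reE hFi hFa hFo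
  (fun x => @pencil_le0_halfplane _ _ al0 ci x alci) Uax Uox ei ee).
Qed.

Lemma image_solution_flux_i : flux_condition ke ki (ci, 0) ri image_solution.
Proof.
exact: (glue_flux_i al0 alci cice ri0 riE Fo (@open_halfplane R)
  (openI (@open_halfplane R) oVB) hFi hFa
  (fun x => @pencil_le0_halfplane _ _ al0 ci x alci) Uax ei fi).
Qed.

Lemma image_solution_flux_e : flux_condition 1 ke (ce, 0) re image_solution.
Proof.
exact: (glue_flux_e al0 alci cice re0 reE
  (openI (@open_halfplane R) oVB) (openI oVE oVB) hFa hFo Uax Uox ei ee fe).
Qed.

(** Both [x] and the focus lie in the outer disk, whose squared diameter is 4 re^2. *)
Let in_ball x : Pe x <= 0 -> dist2 (focus al) x <= 4 * re ^+ 2.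
Proof.
move=> hx.
have hf : Pe (focus al) <= 0.
  have -> : Pe (focus al) = 2 * (al * (al - ce)) by rewrite /pencil /dotp /focus /=; ring.
  by rewrite pmulr_rle0// pmulr_rle0// subr_le0 ltW.
move: hx hf; rewrite !pencilE -reE /dist2 /focus /= => hx hf.
have h1 : 0 <= ((x.1 - ce) + (al - ce)) ^+ 2 by exact: sqr_ge0.
have h2 : 0 <= (x.2 - 0) ^+ 2 by exact: sqr_ge0.
nra.
Qed.

Let LA := L / (1 - `|mu|).
Let LA0 : 0 <= LA. Proof. by rewrite divr_ge0// subr_ge0 ltW. Qed.

Let lipA x y : Pe x <= 0 -> Pe y <= 0 -> `|A x - A y| <= LA * enorm (x - y).
Proof.
move=> hx hy; apply: (@image_series_lipschitz _ al kap mu H al0 kap01 mu1 hH L (4 * re ^+ 2)) => //.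
- exact: (pencil_le0_halfplane al0 alce hx).
- exact: (pencil_le0_halfplane al0 alce hy).
- exact: in_ball.
- exact: in_ball.
Qed.

Let Pi_Pe x : Pi x <= 0 -> Pe x <= 0.
Proof. by move=> h; have := pencil_nested al0 alci cice h; lra. Qed.

Let enorm_refl c x y : al < c -> 0 <= pencil al c x -> 0 <= pencil al c y ->
  enorm (circle_refl al c x - circle_refl al c y) <= enorm (x - y).
Proof. by move=> h hx hy; rewrite !enormB ler_sqrt ?dist2_ge0//; exact: refl_lipschitz. Qed.

Let lipB x y : 0 <= Pi x -> 0 <= Pi y -> `|B x - B y| <= LA * enorm (x - y).
Proof.
move=> hx hy; apply: (@le_trans _ _ (LA * enorm (Ri x - Ri y))); last first.
  by rewrite ler_wpM2l// enorm_refl.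
by apply: lipA; apply: Pi_Pe; [have [] := pencil_ge0_dom alci hx|have [] := pencil_ge0_dom alci hy].
Qed.

Let lipH x y : Pe x <= 0 -> Pe y <= 0 -> `|H x - H y| <= L * enorm (x - y).
Proof. by move=> hx hy; apply: lH; exact: in_ball. Qed.

Let lipE x y : 0 <= Pe x -> 0 <= Pe y -> `|E x - E y| <= L * enorm (x - y).
Proof.
move=> hx hy; apply: (@le_trans _ _ (L * enorm (Re x - Re y))); last first.
  by rewrite ler_wpM2l// enorm_refl.
by apply: lipH; [have [] := pencil_ge0_dom alce hx|have [] := pencil_ge0_dom alce hy].
Qed.

(** The sum of the Lipschitz constants of all terms that occur in some region, hence a bound in each
    of them. Neither [al] nor the centres occur in it. *)
Definition grad_bound : R :=
  (`|(1 + contrast_i) * transmit_in| + `|transmit_in| + `|contrast_i * transmit_in| + `|transmit_out * contrast_i * transmit_in|) *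
    (L / (1 - `|contrast_e * contrast_i|)) + (1 + `|contrast_e|) * L.

Lemma grad_bound_ge0 : 0 <= grad_bound.
Proof.
by apply: addr_ge0; apply: mulr_ge0; rewrite ?addr_ge0.
Qed.

Let comb_bound (p q a b : R) : `|a| <= p -> `|b| <= q -> `|a + b| <= p + q.
Proof. by move=> ha hb; rewrite (le_trans (ler_normD _ _))// lerD. Qed.

Let scal_bound (k p a : R) : `|a| <= p -> `|k * a| <= `|k| * p.
Proof. by move=> ha; rewrite normrM ler_wpM2l. Qed.

Let gi x : Pi x <= 0 -> Fi x = image_solution x. Proof. exact: glue_in. Qed.
Let ga x : 0 <= Pi x -> Pe x <= 0 -> Fa x = image_solution x. Proof. exact: glue_ann. Qed.
Let go x : 0 <= Pe x -> Fo x = image_solution x. Proof. exact: glue_out. Qed.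

Lemma image_solution_lipschitz x : (~` (circle (ci, 0) ri `|` circle (ce, 0) re)) x ->
  \forall y \near x, `|(image_solution y - H y) - (image_solution x - H x)| <= grad_bound * enorm (y - x).
Proof.
move=> nx.
have ni : Pi x <> 0 by move=> h; apply: nx; left; apply/(circleP x ri0 riE).
have ne : Pe x <> 0 by move=> h; apply: nx; right; apply/(circleP x re0 reE).
have pos (k : R) : 0 <= `|k| * LA by rewrite mulr_ge0.
have pos' (k : R) : 0 <= `|k| * L by rewrite mulr_ge0.
have fin y (t b : R) : `|t| <= b * enorm (y - x) -> b <= grad_bound ->
    `|t| <= grad_bound * enorm (y - x).
  by move=> ht hb; apply: le_trans ht _; rewrite ler_wpM2r// enorm_ge0.
have bE : grad_bound = `|(1 + contrast_i) * transmit_in| * LA + `|transmit_in| * LA + `|contrast_i * transmit_in| * LA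
   + `|transmit_out * contrast_i * transmit_in| * LA + L + `|contrast_e| * L by rewrite /grad_bound /LA /mu; ring.
have [i0|i0|//] := ltgtP (Pi x) 0.
- have : \forall y \near x, Pi y < 0.
    exact: open_nbhs_nbhs (conj (@open_pencil_lt0 _ al ci) i0).
  apply: filterS => y iy.
  rewrite -(gi (ltW i0)) -(gi (ltW iy)) /Fi.
  apply: (fin _ _ (`|(1 + contrast_i) * transmit_in| * LA + L)).
    have -> : (1 + contrast_i) * transmit_in * A y + 0 * A y + K - H y -
        ((1 + contrast_i) * transmit_in * A x + 0 * A x + K - H x) =
        (1 + contrast_i) * transmit_in * (A y - A x) + - (H y - H x) by ring.
    rewrite [leRHS]mulrDl; apply: comb_bound.
      rewrite -[leRHS]mulrA; apply: scal_bound; apply: lipA; apply: Pi_Pe; exact: ltW.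
    by rewrite normrN; apply: lipH; apply: Pi_Pe; exact: ltW.
  rewrite bE; have := (pos transmit_in, pos (contrast_i * transmit_in), pos (transmit_out * contrast_i * transmit_in), pos' contrast_e).
  by case=> [[[]]] *; lra.
have [e0|e0|//] := ltgtP (Pe x) 0.
- have : \forall y \near x, ann al ci ce y.
    exact: open_nbhs_nbhs (conj (@open_ann _ al ci ce) (conj i0 e0)).
  apply: filterS => y [/ltW iy /ltW ey].
  rewrite -(ga (ltW i0) (ltW e0)) -(ga iy ey) /Fa.
  apply: (fin _ _ (`|transmit_in| * LA + `|contrast_i * transmit_in| * LA + L)).
    have -> : transmit_in * A y + contrast_i * transmit_in * B y + K - H y -
        (transmit_in * A x + contrast_i * transmit_in * B x + K - H x) =
        transmit_in * (A y - A x) + contrast_i * transmit_in * (B y - B x) + - (H y - H x) by ring.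
    rewrite [leRHS]mulrDl [X in _ <= X + _]mulrDl; apply: comb_bound; first apply: comb_bound.
    - by rewrite -[leRHS]mulrA; apply: scal_bound; apply: lipA => //; exact: ltW.
    - by rewrite -[leRHS]mulrA; apply: scal_bound; apply: lipB => //; exact: ltW.
    - by rewrite normrN; apply: lipH => //; exact: ltW.
  rewrite bE; have := (pos ((1 + contrast_i) * transmit_in), pos (transmit_out * contrast_i * transmit_in), pos' contrast_e).
  by case=> [[]] *; lra.
- have : \forall y \near x, 0 < Pe y.
    exact: open_nbhs_nbhs (conj (@open_pencil_gt0 _ al ce) e0).
  apply: filterS => y /ltW ey.
  have i0' := pencil_nested_gt0 al0 alci cice (ltW e0).
  have iy := pencil_nested_gt0 al0 alci cice ey.
  rewrite -(go (ltW e0)) -(go ey) /Fo.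
  apply: (fin _ _ (`|contrast_e| * L + `|transmit_out * contrast_i * transmit_in| * LA)).
    have -> : 1 * H y + 1 * (- contrast_e * E y + transmit_out * contrast_i * transmit_in * B y + K) + 0 - H y -
        (1 * H x + 1 * (- contrast_e * E x + transmit_out * contrast_i * transmit_in * B x + K) + 0 - H x) =
        - (contrast_e * (E y - E x)) + transmit_out * contrast_i * transmit_in * (B y - B x) by ring.
    rewrite [leRHS]mulrDl; apply: comb_bound.
    - by rewrite normrN -[leRHS]mulrA; apply: scal_bound; apply: lipE => //; exact: ltW.
    - by rewrite -[leRHS]mulrA; apply: scal_bound; apply: lipB => //; exact: ltW.
  rewrite bE; have := (pos ((1 + contrast_i) * transmit_in), pos transmit_in, pos (contrast_i * transmit_in)).
  by case=> [[]] *; have l0 := L0; lra.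
Qed.

(** The reflected point is at distance [rad2 al c] / |x - c| from the centre, and |x - c| >= |x| / 2
    once |x| > 2 c. *)
Let far_refl c x : al < c -> 2 * c < enorm x ->
  0 < pencil al c x /\ enorm (circle_refl al c x - (c, 0)) <= 2 * rad2 al c * (enorm x)^-1.
Proof.
move=> h hx; have c0 : 0 < c by exact: lt_trans h.
have n0 : 0 < enorm x by apply: lt_trans hx; rewrite mulr_gt0.
have [x1 _] := coord_le_enorm x.
have hx1 : c * x.1 <= c * enorm x by rewrite ler_wpM2l ?(ltW c0)// (le_trans (ler_norm _)).
have es := enorm_sqr x.
have d4 : (enorm x / 2) ^+ 2 <= dist2 (c, 0) x.
  have -> : dist2 (c, 0) x = enorm x ^+ 2 - 2 * (c * x.1) + c ^+ 2.
    by rewrite es /dist2 /dotp /=; ring.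
  (* Four times the difference of the squares of |x| - c and |x| / 2. *)
  have : 0 <= (enorm x - 2 * c) * (3 * enorm x - 2 * c) by apply: mulr_ge0; lra.
  lra.
have r0 := rad2_gt0 al0 h.
have dpos : 0 < dist2 (c, 0) x by apply: lt_le_trans d4; rewrite exprn_gt0// divr_gt0.
split.
  rewrite pencilE subr_gt0; apply: lt_le_trans d4.
  have : c ^+ 2 < (enorm x / 2) ^+ 2 by rewrite ltr_pXn2r// ?nnegrE; lra.
  have : 0 < al ^+ 2 by rewrite exprn_gt0.
  rewrite /rad2; lra.
rewrite enormB (dist2_cinv _ (lt0r_neq0 dpos)).
rewrite -(@ler_pXn2r _ 2)// ?nnegrE ?sqrtr_ge0//; last first.
  by rewrite mulr_ge0 ?invr_ge0 ?(ltW n0)// mulr_ge0// ltW.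
rewrite sqr_sqrtr; last by rewrite divr_ge0 ?sqr_ge0// ltW.
rewrite ler_pdivrMr//.
apply: (@le_trans _ _ ((2 * rad2 al c / enorm x) ^+ 2 * (enorm x / 2) ^+ 2)); last first.
  by rewrite ler_wpM2l// sqr_ge0.
rewrite le_eqVlt; apply/orP; left; apply/eqP.
by move: (enorm x) n0 (rad2 al c) => n n0 r; field; rewrite gt_eqF.
Qed.

Lemma image_solution_decay : bigO_inv_at_infinity (image_solution \- H).
Proof.
exists (`|contrast_e| * (L * (2 * rad2 al ce)) +
  `|transmit_out * contrast_i * transmit_in| * (LA * (2 * rad2 al ci))), (2 * ce) => x hx.
have [pe fe'] := far_refl alce hx.
have hxi : 2 * ci < enorm x by apply: lt_trans hx; rewrite ltr_pM2l.
have [pi fi'] := far_refl alci hxi.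
have ctr c : al < c -> pencil al c (c, 0) <= 0.
  move=> /(rad2_gt0 al0) r0; rewrite pencilE /dist2 /= !subrr mulr0 addr0; lra.
have [_ re'] := pencil_ge0_dom alce (ltW pe).
have [_ ri'] := pencil_ge0_dom alci (ltW pi).
rewrite /= -(go (ltW pe)) /Fo.
have -> : 1 * H x + 1 * (- contrast_e * E x + transmit_out * contrast_i * transmit_in * B x + K) + 0 - H x =
  - (contrast_e * (E x - H (ce, 0))) + transmit_out * contrast_i * transmit_in * (B x - A (ci, 0)).
  by rewrite /K /shift_const; ring.
rewrite [leRHS]mulrDl; apply: comb_bound.
  rewrite normrN -[leRHS]mulrA; apply: scal_bound.
  apply: le_trans (lipH re' (ctr _ alce)) _.
  by rewrite -mulrA ler_wpM2l.
rewrite -[leRHS]mulrA; apply: scal_bound.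
apply: le_trans (lipA (Pi_Pe ri') (Pi_Pe (ctr _ alci))) _.
by rewrite -mulrA ler_wpM2l.
Qed.

End Existence.

(** * Uniqueness *)

Section MaximumTests.
Context {R : realType}.
Implicit Types (f g q w : R * R -> R) (x y v : R * R).

Lemma near_line (x v : R * R) (P : set (R * R)) : (\forall y \near x, P y) ->
  exists2 e : R, 0 < e & forall t, `|t| < e -> P (x + t *: v).
Proof.
move=> nP.
have c : x + t *: v @[t --> (0 : R)] --> x.
  rewrite -[X in _ --> X]addr0 -(scale0r v).
  by apply: cvgD; [exact: cvg_cst|apply: cvgZr_tmp; exact: cvg_id].
have /nbhs_ballP[e /= e0 he] := c _ nP.
exists e => // t te; apply: he; by rewrite /ball /= sub0r normrN.
Qed.

(** If d were positive, [f'], which vanishes at the maximum, would be positive just beyond it, and f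
    would increase there. *)
Lemma second_derivative_le0 f f' x v (d : R) :
  (\forall y \near x, f y <= f x) ->
  (\forall y \near x, is_derive y v f (f' y)) -> is_derive x v f' d -> d <= 0.
Proof.
move=> mx df dd; rewrite leNgt; apply/negP => d0.
have [e e0 he] : exists2 e : R, 0 < e & forall t, `|t| < e ->
    f (x + t *: v) <= f x /\ is_derive (x + t *: v) v f (f' (x + t *: v)).
  apply: (@near_line x v (fun y => f y <= f x /\ is_derive y v f (f' y))).
  by apply: filterS2 mx df => y; split.
pose g t := f (x + t *: v).
have dg (t : R) : `|t| < e -> is_derive t (1 : R) g (f' (x + t *: v)).
  by move=> /he [_ h]; exact: is_derive_line.
have f'0 : f' x = 0.
  have [_ g0] : is_derive (0 : R) (1 : R) g 0.
    apply: (@derive1_at_max R g (- e) e 0).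
    - lra.
    - move=> t; rewrite in_itv /= => te; have [] // := dg t.
      by rewrite ltr_norml.
    - by rewrite in_itv /= e0 oppr_lt0 e0.
    - move=> t; rewrite in_itv /= => te; rewrite /g scale0r addr0.
      by have [] // := he t; rewrite ltr_norml.
  have := dg 0; rewrite normr0 => /(_ e0) [_]; rewrite g0 scale0r addr0.
  by move/esym.
have /is_derive_cvgP/cvgr_gt/(_ _ d0) := dd.
rewrite f'0 => /nbhs_ballP[e' /= e'0 he'].
pose t := Num.min e e' / 2.
have m0 : 0 < Num.min e e' by rewrite lt_min e0.
have m1 : Num.min e e' <= e by rewrite ge_min lexx.
have m2 : Num.min e e' <= e' by rewrite ge_min lexx orbT.
have t0 : 0 < t by rewrite /t; lra.
have te : t < e by rewrite /t; lra.
have te' : t < e' by rewrite /t; lra.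
have [||c] := @MVT R g (fun t => f' (x + t *: v)) 0 t t0.
- move=> s; rewrite in_itv /= => /andP[s0 st]; apply: dg.
  by rewrite gtr0_norm// (lt_trans st).
- apply: derivable_within_continuous => s; rewrite in_itv /= => /andP[s0 st].
  have [] // := dg s; by rewrite ger0_norm// (le_lt_trans st).
rewrite in_itv /= subr0 => /andP[c0 ct] E.
have : 0 < f' (x + c *: v).
  have := he' c; rewrite /ball /= sub0r normrN gtr0_norm// => /(_ (lt_trans ct te')).
  rewrite gt_eqF// => /(_ isT); rewrite subr0 scaleRE addrC.
  by rewrite pmulr_rgt0// invr_gt0.
move=> fc; have : 0 < g t - g 0 by rewrite E mulr_gt0.
rewrite {2}/g scale0r addr0 subr_gt0; apply/negP; rewrite -leNgt.
by have [] // := he t; rewrite gtr0_norm.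
Qed.

(** Only the limit of the derivatives from the right is assumed, not a derivative at 0: this is the
    form in which [normal_derivative_limit] supplies information on a circle. *)
Lemma right_derivative_le0 (g g' : R -> R) (d : R) : continuous g ->
  (\forall t \near 0^'+, g t <= g 0) ->
  (\forall t \near 0^'+, is_derive t (1 : R) g (g' t)) ->
  g' t @[t --> 0^'+] --> d -> d <= 0.
Proof.
move=> cg mx dg cd; rewrite leNgt; apply/negP => d0.
have gd : \forall t \near 0^'+, 0 < g' t by exact: (cvgr_gt _ cd).
have /nbhs_ballP[e /= e0 he] : \forall t \near 0^'+, [/\ g t <= g 0, is_derive t (1 : R) g (g' t) & 0 < g' t].
  by apply: filterS3 mx dg gd => t; split.
have he' t : 0 < t -> t < e -> [/\ g t <= g 0, is_derive t (1 : R) g (g' t) & 0 < g' t].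
  by move=> t0 te; apply: he => //; rewrite /ball /= sub0r normrN gtr0_norm.
have t0 : 0 < e / 2 by rewrite divr_gt0.
have te : e / 2 < e by rewrite ltr_pdivrMr// ltr_pMr// ltr1n.
have [||c] := @MVT R g g' 0 (e / 2) t0.
- move=> s; rewrite in_itv /= => /andP[s0 st].
  by have [] := he' s s0 (lt_trans st te).
- by apply: continuous_subspaceT; exact: cg.
rewrite in_itv /= subr0 => /andP[c0 ct] E.
have [_ _ g'c] := he' c c0 (lt_trans ct te).
have : 0 < g (e / 2) - g 0 by rewrite E mulr_gt0.
by rewrite subr_gt0; apply/negP; rewrite -leNgt; have [] := he' _ t0 te.
Qed.

End MaximumTests.

Section Uniqueness.
Context {R : realType}.
Implicit Types (f g q u w H : R * R -> R) (c s a b : R) (x y z v : R * R).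

Lemma line_continuous (x v : R * R) (t : R) : x + k *: v @[k --> t] --> x + t *: v.
Proof. by apply: cvgD; [exact: cvg_cst|apply: cvgZr_tmp; exact: cvg_id]. Qed.

Lemma grad_pencil al c x v : dotp (grad (pencil al c) x) v = 2 * dotp (x - (c, 0)) v.
Proof.
have D (u' : R * R) : 'D_u' (pencil al c) x = 2 * dotp (x - (c, 0)) u'.
  have -> : pencil al c = (fun y => dist2 (c, 0) y + - rad2 al c).
    by apply/funext => y; exact: pencilE.
  have [_ ->] := is_derive_add (dist2_derive (c, 0) x u') (is_derive_const (- rad2 al c) x u').
  by rewrite addr0.
rewrite /grad /dotp /partial1 /partial2 !D /dotp /=; ring.
Qed.

Lemma C1_pencil al c : C1_on setT (pencil al c).
Proof.
have -> : pencil al c = (fun y => dist2 (c, 0) y + - rad2 al c).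
  by apply/funext => y; exact: pencilE.
exact: C1_D openT (C1_dist2 (c, 0) openT) (C1_cst _ openT).
Qed.

Variables (al ci ce ri re ki ke : R).
Hypotheses (al0 : 0 < al) (alci : al < ci) (cice : ci < ce).
Hypotheses (ri0 : 0 < ri) (re0 : 0 < re).
Hypotheses (riE : ri ^+ 2 = rad2 al ci) (reE : re ^+ 2 = rad2 al ce).
Hypotheses (ki0 : 0 < ki) (ke0 : 0 < ke).
Local Notation Pi := (pencil al ci).
Local Notation Pe := (pencil al ce).

Definition interfaces : set (R * R) := circle (ci, 0) ri `|` circle (ce, 0) re.
Definition off_interfaces : set (R * R) := ~` interfaces.

Lemma off_interfacesP x : off_interfaces x <-> Pi x != 0 /\ Pe x != 0.
Proof.
split=> [nx|[/eqP ni /eqP ne] [/(circleP x ri0 riE)|/(circleP x re0 reE)]] //.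
by split; apply/eqP => h; apply: nx; [left; apply/(circleP x ri0 riE)|right; apply/(circleP x re0 reE)].
Qed.

Lemma open_off_interfaces : open off_interfaces.
Proof.
have on c : open [set x | pencil al c x != 0].
  apply: (open_comp (f := pencil al c) (D := [set y : R | y != 0])); last exact: open_neq.
  by move=> x _; exact: pencil_continuous.
have -> : off_interfaces = [set x | Pi x != 0] `&` [set x | Pe x != 0].
  by apply/seteqP; split => x /off_interfacesP.
by apply: openI.
Qed.

Lemma pencil_normal_neq0 c r s x : 0 < r -> r ^+ 2 = rad2 al c -> s != 0 -> pencil al c x = 0 ->
  \forall t \near 0^'+, pencil al c (x + (s * t) *: outward_normal (c, 0) r x) != 0.
Proof.
move=> r0 rE s0 x0.
have e0 : 0 < r / `|s| by rewrite divr_gt0// normr_gt0.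
have := nbhs_right_lt e0; have := nbhs_right_gt (0 : R); apply: filterS2 => t t0 te.
rewrite (pencil_normal _ r0 rE x0) mulf_neq0//; last by rewrite mulf_neq0// gt_eqF.
have h : `|s * t| < r.
  by rewrite normrM (gtr0_norm t0) mulrC -ltr_pdivlMr// normr_gt0.
by move: h; rewrite ltr_norml => /andP[h1 h2]; rewrite gt_eqF//; lra.
Qed.

(** The triple consists of a centre, its radius and the other centre; ranging over two triples, one
    statement serves both circles. *)
Lemma near_off_interfaces c r c' s x : (c, r, c') \in [:: (ci, ri, ce); (ce, re, ci)] -> s != 0 ->
  circle (c, 0) r x ->
  \forall t \near 0^'+, off_interfaces (x + (s * t) *: outward_normal (c, 0) r x).
Proof.
move=> hc s0 hx.
have [r0 rE x0 x1] : [/\ 0 < r, r ^+ 2 = rad2 al c, pencil al c x = 0 & pencil al c' x != 0].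
  move: hc; rewrite !inE => /orP[/eqP[e1 e2 e3]|/eqP[e1 e2 e3]]; subst c r c'.
    move/(circleP x ri0 riE): hx => x0; split=> //; rewrite lt_eqF// -x0.
    by apply: pencil_nested; rewrite ?x0.
  move/(circleP x re0 reE): hx => x0; split=> //; rewrite gt_eqF//.
  by apply: (pencil_nested_gt0 al0 alci cice); rewrite x0.
have oc : open [set x | pencil al c' x != 0].
  apply: (open_comp (f := pencil al c') (D := [set y : R | y != 0])); last exact: open_neq.
  by move=> y _; exact: pencil_continuous.
have n1 := pencil_normal_neq0 r0 rE s0 x0.
have n2 : \forall t \near 0^'+, pencil al c' (x + (s * t) *: outward_normal (c, 0) r x) != 0.
  exact: (@cvg_along _ s x (outward_normal (c, 0) r x) _ (open_nbhs_nbhs (conj oc x1))).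
apply: filterS2 n1 n2 => t h1 h2; apply/off_interfacesP.
by move: hc; rewrite !inE => /orP[/eqP[e1 e2 e3]|/eqP[e1 e2 e3]]; subst c r c'.
Qed.

Lemma normal_comb s (C : R * R) (r : R) u w x a b d1 d2 : C1_on off_interfaces u -> C1_on off_interfaces w ->
  (\forall t \near 0^'+, off_interfaces (x + (s * t) *: outward_normal C r x)) ->
  normal_derivative_limit s C r u x d1 -> normal_derivative_limit s C r w x d2 ->
  normal_derivative_limit s C r (fun y => a * u y + b * w y + 0) x (a * d1 + b * d2).
Proof.
move=> hu hw no l1 l2; rewrite /normal_derivative_limit in l1 l2 *.
have c3 : a * dotp (grad u (x + (s * t) *: outward_normal C r x)) (outward_normal C r x) +
    b * dotp (grad w (x + (s * t) *: outward_normal C r x)) (outward_normal C r x)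
    @[t --> 0^'+] --> a * d1 + b * d2.
  by apply: cvgD; [apply: cvgM l1|apply: cvgM l2]; exact: cvg_cst.
apply: cvg_trans c3; apply: near_eq_cvg.
apply: filterS no => t ot.
by rewrite (grad_comb a b 0 _ hu hw ot).
Qed.

(** The conjuncts of [transmission_solution] with the centres as free parameters; for the centres of
    the theorem the two are convertible. *)
Definition interface_solution H u := [/\ continuous u, harmonic_on off_interfaces u,
  flux_condition 1 ke (ce, 0) re u, flux_condition ke ki (ci, 0) ri u
  & bigO_inv_at_infinity (u \- H)].

Lemma interface_solution_comb a b H H' u w : interface_solution H u -> interface_solution H' w ->
  interface_solution (fun x => a * H x + b * H' x + 0) (fun x => a * u x + b * w x + 0).
Proof.
move=> [cu hu feu fiu [M [K ou]]] [cw hw few fiw [M' [K' ow]]].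
have flux c r c' k1 k2 : (c, r, c') \in [:: (ci, ri, ce); (ce, re, ci)] ->
    flux_condition k1 k2 (c, 0) r u -> flux_condition k1 k2 (c, 0) r w ->
    flux_condition k1 k2 (c, 0) r (fun x => a * u x + b * w x + 0).
  move=> hc fu fw x hx.
  have [d1 [d2 [l1 l2 e]]] := fu x hx; have [d1' [d2' [l1' l2' e']]] := fw x hx.
  exists (a * d1 + b * d1'), (a * d2 + b * d2'); split.
  - apply: normal_comb l1 l1'; [exact: harmonic_C1|exact: harmonic_C1|].
    by apply: near_off_interfaces hc _ hx; rewrite oner_eq0.
  - apply: normal_comb l2 l2'; [exact: harmonic_C1|exact: harmonic_C1|].
    by apply: near_off_interfaces hc _ hx; rewrite oppr_eq0 oner_eq0.
  - transitivity (a * (k1 * d1) + b * (k1 * d1')); first by ring.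
    by rewrite e e'; ring.
split.
- move=> x; apply: cvgD; last exact: cvg_cst.
  by apply: cvgD; apply: cvgM; [exact: cvg_cst|exact: cu|exact: cvg_cst|exact: cw].
- exact: harmonic_comb open_off_interfaces hu hw.
- by apply: (@flux ce re ci) => //; rewrite !inE eqxx orbT.
- by apply: (@flux ci ri ce) => //; rewrite !inE eqxx.
- exists (`|a| * M + `|b| * M'), (Num.max K K') => x; rewrite gt_max => /andP[h1 h2].
  have -> : ((fun x => a * u x + b * w x + 0) \- (fun x => a * H x + b * H' x + 0)) x =
    a * (u x - H x) + b * (w x - H' x) by rewrite /=; ring.
  rewrite mulrDl (le_trans (ler_normD _ _))// !normrM -!mulrA.
  by rewrite lerD// ler_wpM2l//; [exact: ou|exact: ow].
Qed.

Section MaxPrinciple.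
Variables (w : R * R -> R).
Hypothesis hw : interface_solution (fun=> 0) w.

Let pos (t : R) := (t + `|t|) / 2.
(* Q is strictly subharmonic off the circles, and strictly increases the flux
   across each of them: be is large enough for this on the outer circle. *)
Let b0 : R := ke.
Let b1 : R := 2 * ki.
Let del : R := ce - ci.
Let be : R := b1 * `|ke - 1| * (re + del) / re + 1.
Let Q x := b0 * Pi x + (b1 - b0) * pos (Pi x) + be * pos (Pe x).

Let pos_ge (t : R) : 0 <= t -> pos t = t.
Proof. by move=> t0; rewrite /pos ger0_norm//; lra. Qed.

Let pos_le (t : R) : t <= 0 -> pos t = 0.
Proof. by move=> t0; rewrite /pos ler0_norm//; lra. Qed.

Let Q_in x : Pi x <= 0 -> Q x = b0 * Pi x + 0 * Pe x + 0.
Proof.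
move=> h; have h' := pencil_nested al0 alci cice h; rewrite /Q !pos_le//; last by lra.
by ring.
Qed.

Let Q_ann x : 0 <= Pi x -> Pe x <= 0 -> Q x = b1 * Pi x + 0 * Pe x + 0.
Proof. by move=> h h'; rewrite /Q pos_ge// pos_le//; ring. Qed.

Let Q_out x : 0 <= Pe x -> Q x = b1 * Pi x + be * Pe x + 0.
Proof.
move=> h; have h' := pencil_nested_gt0 al0 alci cice h.
by rewrite /Q !pos_ge//; [ring|exact: ltW].
Qed.

Let Q_continuous : continuous Q.
Proof.
have cp c x : pos (pencil al c y) @[y --> x] --> pos (pencil al c x).
  have cc := @pencil_continuous _ al c x.
  apply: cvgM; last exact: cvg_cst.
  by apply: cvgD; [exact: cc|exact: cvg_norm].
move=> x; apply: cvgD; first apply: cvgD.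
- by apply: cvgM; [exact: cvg_cst|exact: pencil_continuous].
- by apply: cvgM; [exact: cvg_cst|exact: cp].
- by apply: cvgM; [exact: cvg_cst|exact: cp].
Qed.

Let b0_gt0 : 0 < b0. Proof. exact: ke0. Qed.
Let b1_gt0 : 0 < b1. Proof. by rewrite mulr_gt0. Qed.
Let del_gt0 : 0 < del. Proof. by rewrite subr_gt0. Qed.
Let be_gt0 : 0 < be.
Proof.
apply: ltr_wpDl; last exact: ltr01.
apply: divr_ge0; last exact: ltW.
apply: mulr_ge0; last by apply: addr_ge0; exact: ltW.
by apply: mulr_ge0 => //; exact: ltW.
Qed.

Section LocalMax.
Variables (dl : R) (x0 : R * R).
Hypothesis dl0 : 0 < dl.
Let psi x := w x + dl * Q x.
Hypothesis mx : \forall y \near x0, psi y <= psi x0.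

Let psi_continuous : continuous psi.
Proof.
move=> x; have [cw _ _ _ _] := hw; apply: cvgD; first exact: cw.
by apply: cvgM; [exact: cvg_cst|exact: Q_continuous].
Qed.

(** On each of the three regions [psi] agrees with some [comp a b]. Its polynomial part is smooth
    across the circles, so one-sided limits are taken of [w] only. *)
Let poly a b y := (dl * a) * Pi y + (dl * b) * Pe y + 0.
Let comp a b y := 1 * w y + 1 * poly a b y + 0.

Let C1_poly a b : C1_on setT (poly a b).
Proof.
exact: C1_D openT (C1_D openT (C1_M openT (C1_cst _ openT) (C1_pencil al ci))
  (C1_M openT (C1_cst _ openT) (C1_pencil al ce))) (C1_cst _ openT).
Qed.

Let hoff : harmonic_on off_interfaces w. Proof. by case: hw. Qed.

Let poly_grad a b x v : dotp (grad (poly a b) x) v =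
    dl * (a * (2 * dotp (x - (ci, 0)) v) + b * (2 * dotp (x - (ce, 0)) v)).
Proof.
transitivity (dl * a * (2 * dotp (x - (ci, 0)) v) + dl * b * (2 * dotp (x - (ce, 0)) v)).
  rewrite -!(grad_pencil al).
  exact: (grad_comb _ _ _ _ (C1_pencil al ci) (C1_pencil al ce) I).
by move: (dotp (x - (ci, 0)) v) (dotp (x - (ce, 0)) v) => *; ring.
Qed.

Let poly_partial a b x :
  partial1 (poly a b) x = 2 * dl * (a * (x.1 - ci) + b * (x.1 - ce)) /\
  partial2 (poly a b) x = 2 * dl * (a + b) * x.2.
Proof.
have G v := poly_grad a b x v.
have := G (1, 0); have := G (0, 1); rewrite /dotp /grad /=.
move: (partial1 _ x) (partial2 _ x) => p1 p2 e2 e1; split; lra.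
Qed.

(** The polynomial part has Laplacian 4 dl (a + b) > 0 and [w] is harmonic, whereas both pure second
    derivatives are nonpositive at a maximum. *)
Let interior_absurd a b : off_interfaces x0 -> 0 < a + b ->
  (\forall y \near x0, psi y = comp a b y) -> False.
Proof.
move=> ox ab0 np; have oo := open_off_interfaces.
have [[h h1 h2] lap] := hoff.
have no : \forall y \near x0, off_interfaces y by exact: open_nbhs_nbhs.
have mx' : \forall y \near x0, comp a b y <= comp a b x0.
  have e0 := nbhs_singleton np.
  by apply: filterS2 mx np => y h3 <-; rewrite -e0.
have ineq1 : partial1 (partial1 w) x0 + 2 * dl * (a + b) <= 0.
  apply: (@second_derivative_le0 _ (comp a b)
    (fun y => partial1 w y + 2 * dl * (a * (y.1 - ci) + b * (y.1 - ce))) x0 (1, 0) _ mx').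
    apply: filterS no => y oy; have [E _] := poly_partial a b y.
    apply: is_derive_eq (is_derive_add (is_derive_add (is_derive_mul (is_derive_const 1 y (1, 0)) (C1_is_derive1 h oy))
      (is_derive_mul (is_derive_const 1 y (1, 0)) (C1_is_derive1 (C1_poly a b) I))) (is_derive_const 0 y (1, 0))) _.
    by rewrite E; cbv beta; move: (partial1 w y) (w y) (poly a b y) => *; ring.
  have Dy c : is_derive x0 ((1, 0) : R * R) (fun y => y.1 - c) 1.
    by apply: is_derive_eq (is_derive_add (is_derive_fst x0 (1, 0)) (is_derive_opp (is_derive_const c x0 (1, 0)))) _; rewrite /= oppr0 addr0.
  apply: is_derive_eq (is_derive_add (C1_is_derive1 h1 ox) (is_derive_mul (is_derive_const (2 * dl) x0 (1, 0))
    (is_derive_add (is_derive_mul (is_derive_const a x0 (1, 0)) (Dy ci)) (is_derive_mul (is_derive_const b x0 (1, 0)) (Dy ce))))) _.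
  by cbv beta; move: (partial1 (partial1 w) x0) => *; ring.
have ineq2 : partial2 (partial2 w) x0 + 2 * dl * (a + b) <= 0.
  apply: (@second_derivative_le0 _ (comp a b)
    (fun y => partial2 w y + 2 * dl * (a + b) * y.2) x0 (0, 1) _ mx').
    apply: filterS no => y oy; have [_ E] := poly_partial a b y.
    apply: is_derive_eq (is_derive_add (is_derive_add (is_derive_mul (is_derive_const 1 y (0, 1)) (C1_is_derive2 h oy))
      (is_derive_mul (is_derive_const 1 y (0, 1)) (C1_is_derive2 (C1_poly a b) I))) (is_derive_const 0 y (0, 1))) _.
    by rewrite E; cbv beta; move: (partial2 w y) (w y) (poly a b y) => *; ring.
  apply: is_derive_eq (is_derive_add (C1_is_derive2 h2 ox) (is_derive_mul (is_derive_const (2 * dl * (a + b)) x0 (0, 1)) (is_derive_snd x0 (0, 1)))) _.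
  by cbv beta; rewrite /= ; move: (partial2 (partial2 w) x0) => *; ring.
have := lap x0 ox; move: (partial1 (partial1 w) x0) (partial2 (partial2 w) x0) ineq1 ineq2.
move=> p q i1 i2 e; have : 0 < dl * (a + b) by rewrite mulr_gt0.
lra.
Qed.

(** At a maximum on a circle the function cannot increase when the circle is left in the direction s
    nu; the derivatives along that ray tend to the left side of the conclusion. *)
Let side_le0 s (C : R * R) (r : R) a b d :
  (\forall t \near 0^'+, off_interfaces (x0 + (s * t) *: outward_normal C r x0)) ->
  (\forall t \near 0^'+, psi (x0 + (s * t) *: outward_normal C r x0) =
     comp a b (x0 + (s * t) *: outward_normal C r x0)) ->
  normal_derivative_limit s C r w x0 d ->
  s * (d + dotp (grad (poly a b) x0) (outward_normal C r x0)) <= 0.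
Proof.
set nu := outward_normal C r x0 => no np l.
have oo := open_off_interfaces; have h := harmonic_C1 hoff.
have cx := @cvg_along _ s x0 nu.
have E t : x0 + (s * t) *: nu = x0 + t *: (s *: nu) by rewrite scalerA mulrC.
pose g t := psi (x0 + t *: (s *: nu)).
pose g' t := s * (dotp (grad w (x0 + (s * t) *: nu)) nu +
                 dotp (grad (poly a b) (x0 + (s * t) *: nu)) nu).
apply: (@right_derivative_le0 _ g g').
- move=> t.
  exact: (cvg_comp _ _ (@line_continuous x0 (s *: nu) t) (@psi_continuous _)).
- have n : \forall t \near 0^'+, psi (x0 + (s * t) *: nu) <= psi x0 := cx _ mx.
  apply: filterS n => t; rewrite /g -E scale0r addr0; exact.
(* A derivative at t sees a neighbourhood of t, so the agreement of [psi] with [comp a b] is needed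
   near t as well as at t. *)
- have nn : \forall t \near 0^'+, \forall y \near t, off_interfaces (x0 + (s * y) *: nu) /\
      psi (x0 + (s * y) *: nu) = comp a b (x0 + (s * y) *: nu).
    have /nbhs_ballP[e /= e0 he] : \forall t \near 0^'+, off_interfaces (x0 + (s * t) *: nu) /\
      psi (x0 + (s * t) *: nu) = comp a b (x0 + (s * t) *: nu) by apply: filterS2 no np => t.
    have := nbhs_right_lt e0; have := nbhs_right_gt (0 : R); apply: filterS2 => t t0 te.
    have : \forall y \near t, 0 < y /\ y < e.
      by apply: filterS2 (lt_nbhsr t0) (lt_nbhsl te) => y; split.
    apply: filterS => y [y0 ye]; apply: he => //.
    by rewrite /ball /= sub0r normrN gtr0_norm.
  apply: filterS nn => t nt; have [ot _] := nbhs_singleton nt.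
  have Cc : C1_on off_interfaces (comp a b).
    have hp : C1_on off_interfaces (poly a b) by move=> y _; exact: C1_poly.
    exact: C1_D oo (C1_D oo (C1_M oo (C1_cst _ oo) h) (C1_M oo (C1_cst _ oo) hp)) (C1_cst _ oo).
  have D : is_derive t (1 : R) (fun t => comp a b (x0 + t *: (s *: nu))) (g' t).
    apply: is_derive_line; rewrite -E.
    apply: is_derive_eq (derive_dotp (s *: nu) (C1_differentiable oo Cc ot)) _.
    have hp : C1_on off_interfaces (poly a b) by move=> y _; exact: C1_poly.
    rewrite (grad_comb 1 1 0 _ h hp ot) /g' /dotp /= !scaleRE.
    by move: (partial1 w _) (partial2 w _) (partial1 (poly a b) _) (partial2 (poly a b) _) => *; ring.
  apply: near_eq_is_derive D.
  by apply: filterS nt => y [_ e]; rewrite /g -E e.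
- apply: cvgM; first exact: cvg_cst.
  apply: cvgD; first exact: l.
  have cp1 := cvg_comp _ _ cx (C1_continuous_partial1 (C1_poly a b) (I : setT x0)).
  have cp2 := cvg_comp _ _ cx (C1_continuous_partial2 (C1_poly a b) (I : setT x0)).
  by apply: cvgD; [apply: cvgM cp1 _|apply: cvgM cp2 _]; exact: cvg_cst.
Qed.

Let psi_comp a b y : Q y = a * Pi y + b * Pe y + 0 -> psi y = comp a b y.
Proof.
by rewrite /psi /comp /poly => ->; move: (Pi y) (Pe y) (w y) => *; ring.
Qed.

Let outward_self c (r : R) : 0 < r -> r ^+ 2 = rad2 al c -> pencil al c x0 = 0 ->
  dotp (x0 - (c, 0)) (outward_normal (c, 0) r x0) = r.
Proof.
move=> r0 rE; rewrite pencilE -rE => /eqP; rewrite subr_eq0 => /eqP e.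
have -> : dotp (x0 - (c, 0)) (outward_normal (c, 0) r x0) = dist2 (c, 0) x0 / r.
  by rewrite /dotp /outward_normal /dist2 /= !scaleRE; ring.
by rewrite e; field; rewrite gt_eqF.
Qed.

Let near_open s nu (U : set (R * R)) : open U -> U x0 ->
  \forall t \near 0^'+, U (x0 + (s * t) *: nu).
Proof. by move=> oU Ux; exact: (@cvg_along _ s x0 nu _ (open_nbhs_nbhs (conj oU Ux))). Qed.

Let side_out c (r : R) : 0 < r -> r ^+ 2 = rad2 al c -> pencil al c x0 = 0 ->
  \forall t \near 0^'+, 0 < pencil al c (x0 + (1 * t) *: outward_normal (c, 0) r x0).
Proof.
move=> r0 rE e; have := nbhs_right_gt (0 : R); apply: filterS => t t0.
by rewrite (pencil_normal _ r0 rE e) mul1r mulr_gt0// addr_gt0// mulr_gt0.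
Qed.

Let side_in c (r : R) : 0 < r -> r ^+ 2 = rad2 al c -> pencil al c x0 = 0 ->
  \forall t \near 0^'+, pencil al c (x0 + (-1 * t) *: outward_normal (c, 0) r x0) < 0.
Proof.
move=> r0 rE e; have := nbhs_right_lt r0; have := nbhs_right_gt (0 : R).
apply: filterS2 => t t0 tr; rewrite (pencil_normal _ r0 rE e).
have : 0 < (2 * r - t) * t by rewrite mulr_gt0//; lra.
lra.
Qed.

(** The jump of the flux of [Q] is 2 r (ke b1 - ki b0) = 2 r ke ki, positive by the choice of [b0]
    and [b1]. *)
Let flux_i_absurd (d1 d2 r : R) : 0 < r -> ke * d1 = ki * d2 ->
  1 * (d1 + dl * (b1 * (2 * r) + 0)) <= 0 -> -1 * (d2 + dl * (b0 * (2 * r) + 0)) <= 0 -> False.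
Proof.
move=> r0 e h1 h2.
have k1 : 0 <= ke * - (d1 + dl * (b1 * (2 * r))) by apply: mulr_ge0; [exact: ltW|lra].
have k2 : 0 <= ki * (d2 + dl * (b0 * (2 * r))) by apply: mulr_ge0; [exact: ltW|lra].
have k3 : 0 < ke * (ki * (dl * r)) by rewrite !mulr_gt0.
rewrite /b0 /b1 in k1 k2; lra.
Qed.

(** Here [P] is the normal component of x0 - (ci, 0). Half the jump of the flux of [Q] is be re -
    (ke - 1) b1 P; the first summand of [be] outweighs the last term, and the summand 1 leaves a
    surplus of at least re. *)
Let flux_e_absurd (d1 d2 P : R) : `|P| <= re + del -> 1 * d1 = ke * d2 ->
  1 * (d1 + dl * (b1 * (2 * P) + be * (2 * re))) <= 0 ->
  -1 * (d2 + dl * (b1 * (2 * P) + 0)) <= 0 -> False.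
Proof.
move=> hP e h1 h2.
have k2 : 0 <= ke * (d2 + dl * (b1 * (2 * P))) by apply: mulr_ge0; [exact: ltW|lra].
have k3 : dl * ((be * re) - (ke - 1) * b1 * P) <= 0 by lra.
have k4 : be * re = b1 * `|ke - 1| * (re + del) + re.
  by rewrite /be; field; rewrite gt_eqF.
have k5 : (ke - 1) * b1 * P <= b1 * `|ke - 1| * (re + del).
  apply: le_trans (ler_norm _) _; rewrite normrM [X in X * _]normrM (gtr0_norm b1_gt0) (mulrC b1).
  by rewrite ler_wpM2l// mulr_ge0// ltW.
have : 0 < dl * ((be * re) - (ke - 1) * b1 * P).
  by rewrite mulr_gt0// k4; have := re0; lra.
by move=> /lt_le_trans /(_ k3); rewrite ltxx.
Qed.

Lemma no_local_max : False.
Proof.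
have [_ _ hfe hfi _] := hw.
have [i0|i0|i0] := ltgtP (Pi x0) 0.
- have e0 := pencil_nested al0 alci cice (ltW i0).
  apply: (@interior_absurd b0 0); rewrite ?addr0//.
    by apply/off_interfacesP; split; rewrite lt_eqF//; lra.
  have := open_nbhs_nbhs (conj (@open_pencil_lt0 _ al ci) i0).
  by apply: filterS => y /ltW h; apply/psi_comp/Q_in.
- have [e0|e0|e0] := ltgtP (Pe x0) 0.
  + apply: (@interior_absurd b1 0); rewrite ?addr0//.
      by apply/off_interfacesP; split; [rewrite gt_eqF|rewrite lt_eqF].
    have := open_nbhs_nbhs (conj (@open_ann _ al ci ce) (conj i0 e0)).
    by apply: filterS => y [/ltW h1 /ltW h2]; apply/psi_comp/Q_ann.
  + apply: (@interior_absurd b1 be); first by apply/off_interfacesP; rewrite !gt_eqF.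
      by rewrite addr_gt0.
    have := open_nbhs_nbhs (conj (@open_pencil_gt0 _ al ce) e0).
    by apply: filterS => y /ltW h; apply/psi_comp/Q_out.
  + have cx : circle (ce, 0) re x0 by apply/(circleP x0 re0 reE).
    have [d1 [d2 [l1 l2 e]]] := hfe x0 cx.
    have no s : s != 0 -> \forall t \near 0^'+, off_interfaces (x0 + (s * t) *: outward_normal (ce, 0) re x0).
      by move=> s0; apply: (@near_off_interfaces ce re ci s x0) => //; rewrite !inE eqxx orbT.
    have s1 := @side_le0 1 (ce, 0) re b1 be d1 (no 1 (oner_neq0 _)) _ l1.
    have s2 := @side_le0 (-1) (ce, 0) re b1 0 d2 (no (-1) _) _ l2.
    rewrite !poly_grad (outward_self re0 reE e0) !mul0r in s1 s2.
    apply: flux_e_absurd e (s1 _) (s2 _ _).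
    (* The vector from the inner centre is the one from the outer centre plus (del, 0), and a
       component of the unit normal is at most 1 in absolute value. *)
    * have -> : dotp (x0 - (ci, 0)) (outward_normal (ce, 0) re x0) =
          re + del * ((x0 - (ce, 0)).1 / re).
        rewrite -[X in _ = X + _](outward_self re0 reE e0) /outward_normal /dotp /del /= !scaleRE; ring.
      apply: le_trans (ler_normD _ _) _; rewrite (gtr0_norm re0) lerD2l normrM (gtr0_norm del_gt0).
      rewrite ler_piMr ?(ltW del_gt0)// normrM normfV (gtr0_norm re0) ler_pdivrMr// mul1r.
      by have [h _] := coord_le_enorm (x0 - (ce, 0)); rewrite -[leRHS]cx.
    * by apply: filterS (side_out re0 reE e0) => t /ltW h; apply/psi_comp/Q_out.
    * by rewrite oppr_eq0 oner_eq0.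
    * have n := near_open (-1) (outward_normal (ce, 0) re x0) (@open_pencil_gt0 _ al ci) i0.
      apply: filterS2 n (side_in re0 reE e0) => t /ltW h1 /ltW h2.
      exact/psi_comp/Q_ann.
- have e0 : Pe x0 < 0 by rewrite -i0; apply: pencil_nested; rewrite ?i0.
  have cx : circle (ci, 0) ri x0 by apply/(circleP x0 ri0 riE).
  have [d1 [d2 [l1 l2 e]]] := hfi x0 cx.
  have no s : s != 0 -> \forall t \near 0^'+, off_interfaces (x0 + (s * t) *: outward_normal (ci, 0) ri x0).
    by move=> s0; apply: (@near_off_interfaces ci ri ce s x0) => //; rewrite !inE eqxx.
  have s1 := @side_le0 1 (ci, 0) ri b1 0 d1 (no 1 (oner_neq0 _)) _ l1.
  have s2 := @side_le0 (-1) (ci, 0) ri b0 0 d2 (no (-1) _) _ l2.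
  rewrite !poly_grad (outward_self ri0 riE i0) !mul0r in s1 s2.
  apply: flux_i_absurd ri0 e (s1 _) (s2 _ _).
  + have n := near_open 1 (outward_normal (ci, 0) ri x0) (@open_pencil_lt0 _ al ce) e0.
    apply: filterS2 n (side_out ri0 riE i0) => t /ltW h1 /ltW h2.
    exact/psi_comp/Q_ann.
  + by rewrite oppr_eq0 oner_eq0.
  + by apply: filterS (side_in ri0 riE i0) => t /ltW h; apply/psi_comp/Q_in.
Qed.

End LocalMax.

Lemma max_principle y : w y <= 0.
Proof.
rewrite leNgt; apply/negP => m0; set m := w y in m0.
have [cw _ _ _ [M [K0 hM]]] := hw.
(* The radius exceeds [K0], so the decay bound applies and gives w <= |M| / rho <= m / 4 on the
   boundary circle; it also exceeds [enorm y], so y lies inside. *)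
pose rho := 1 + `|K0| + enorm y + 4 * `|M| / m.
have rho0 : 0 < rho.
  have : 0 <= 4 * `|M| / m by rewrite divr_ge0 ?mulr_ge0// ltW.
  have := enorm_ge0 y; have := normr_ge0 K0; rewrite /rho; lra.
have [Qm hQ] : exists B : R, forall x, dotp x x <= rho ^+ 2 -> `|Q x| <= B.
  by apply: disk_bounded => x _; exact: Q_continuous.
have Qm0 : 0 <= Qm.
  apply: le_trans (hQ 0 _); rewrite // /dotp /= mulr0 addr0; exact: sqr_ge0.
(* The perturbation is at most m / 4 on the disk. Thus [psi] is at least 3 m / 4 at y and at most m
   / 2 on the boundary, which forces an interior maximum. *)
pose dl := m / (4 * (Qm + 1)).
have dl0 : 0 < dl by rewrite divr_gt0// mulr_gt0// ltr_wpDl.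
have dlQ x : dotp x x <= rho ^+ 2 -> `|dl * Q x| <= m / 4.
  move=> /hQ h; rewrite normrM (gtr0_norm dl0).
  apply: (@le_trans _ _ (dl * (Qm + 1))); first by rewrite ler_wpM2l ?(ltW dl0)//; lra.
  rewrite le_eqVlt; apply/orP; left; apply/eqP; rewrite /dl; field.
  by rewrite gt_eqF// ltr_wpDl.
pose psi x := w x + dl * Q x.
have cpsi : continuous psi.
  move=> x; apply: cvgD; first exact: cw.
  by apply: cvgM; [exact: cvg_cst|exact: Q_continuous].
have [x0 x0D hx0] : exists2 c, c \in [set x : R * R | dotp x x <= rho ^+ 2] &
    forall t, t \in [set x : R * R | dotp x x <= rho ^+ 2] -> psi t <= psi c.
  apply: compact_EVT_max.
  - by exists 0; rewrite /= /dotp /= mulr0 addr0; exact: sqr_ge0.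
  - exact: compact_closed_disk.
  - exact: continuous_subspaceT.
rewrite inE /= in x0D.
have yrho : enorm y < rho.
  have : 0 <= 4 * `|M| / m by rewrite divr_ge0 ?mulr_ge0// ltW.
  have := normr_ge0 K0; rewrite /rho; lra.
have yD : dotp y y <= rho ^+ 2.
  by rewrite -enorm_sqr ler_pXn2r// ?nnegrE ?enorm_ge0 ?ltW.
have psiy : psi y <= psi x0 by apply: hx0; rewrite inE.
have psiy' : m - m / 4 <= psi y.
  by have := dlQ y yD; rewrite ler_norml /psi -/m => /andP[h _]; lra.
have x0rho : dotp x0 x0 < rho ^+ 2.
  rewrite lt_neqAle x0D andbT; apply/eqP => e.
  have nx0 : enorm x0 = rho by rewrite /enorm e sqrtr_sqr gtr0_norm.
  have K0x : K0 < enorm x0.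
    rewrite nx0 /rho; have := ler_norm K0; have := enorm_ge0 y.
    have : 0 <= 4 * `|M| / m by rewrite divr_ge0 ?mulr_ge0// ltW.
    lra.
  have := hM x0 K0x; rewrite /= subr0 nx0 => h.
  have : w x0 <= m / 4.
    apply: le_trans (ler_norm _) _; apply: le_trans h _.
    rewrite ler_pdivrMr//; apply: le_trans (ler_norm _) _.
    have -> : `|M| = m / 4 * (4 * `|M| / m) by field; rewrite gt_eqF.
    rewrite ler_wpM2l ?divr_ge0 ?(ltW m0)// /rho; have := enorm_ge0 y; have := normr_ge0 K0; lra.
  have := dlQ x0 x0D; rewrite ler_norml => /andP[_]; move: psiy; rewrite {2}/psi; lra.
apply: (@no_local_max dl x0 dl0).
have : \forall z \near x0, disk (rho ^+ 2) z by exact: open_nbhs_nbhs (conj (@open_disk _ _) x0rho).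
by apply: filterS => z /ltW hz; apply: hx0; rewrite inE.
Qed.

End MaxPrinciple.

Lemma interface_solution_unique H u w : interface_solution H u -> interface_solution H w -> u = w.
Proof.
have h u1 u2 : interface_solution H u1 -> interface_solution H u2 -> forall x, u1 x <= u2 x.
  move=> h1 h2 x; have := interface_solution_comb 1 (-1) h1 h2.
  have -> : (fun x => 1 * H x + -1 * H x + 0) = (fun=> 0).
    by apply/funext => z; rewrite mul1r mulN1r subrr addr0.
  by move=> /max_principle /(_ x); lra.
by move=> h1 h2; apply/funext => x; apply/eqP; rewrite eq_le !h.
Qed.
End Uniqueness.

(** * The gradient bound *)

Section NullCircles.
Context {R : realType}.
Let leb2 := (@lebesgue_measure R \x @lebesgue_measure R)%E.

(** By Fubini: each vertical section has at most two points. *)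
Lemma pencil_zero_negligible (al c : R) :
  leb2.-negligible [set x : R * R | pencil al c x = 0].
Proof.
set Z := [set x | _].
have mZ : measurable (Z : set (measurableTypeR R * measurableTypeR R)).
  have mf : measurable_fun [set: measurableTypeR R * measurableTypeR R]
      (fun x : R * R => x.1 * x.1 + x.2 * x.2 - 2 * c * x.1 + al ^+ 2).
    apply: measurable_funD; last exact: measurable_cst.
    apply: measurable_funB.
      by apply: measurable_funD; apply: measurable_funM; [exact: measurable_fst|exact: measurable_fst|exact: measurable_snd|exact: measurable_snd].
    by apply: measurable_funM; [exact: measurable_cst|exact: measurable_fst].
  rewrite -[Z]setTI; exact: (mf measurableT [set 0] (measurable_set1 0)).
apply/negligibleP => //.
rewrite /leb2 /= /product_measure1 integral0_eq// => a _ /=.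
apply: countable_lebesgue_measure0; apply: finite_set_countable.
set k := Num.sqrt (2 * c * a - a * a - al ^+ 2).
apply: (@sub_finite_set _ _ [set k; - k]); last exact: finite_set2.
move=> y /xsectionP; rewrite /Z /= /pencil /dotp /= => h.
have h2 : y ^+ 2 = 2 * c * a - a * a - al ^+ 2 by rewrite expr2; lra.
have : `|y| = k by rewrite /k -h2 sqrtr_sqr.
by have [y0|y0] := leP 0 y; [rewrite ger0_norm// => ->; left|rewrite ltr0_norm// => <-; right; rewrite opprK].
Qed.

End NullCircles.

Section GradientBound.
Context {R : realType}.
Implicit Types (f g : R * R -> R) (x v : R * R).

Lemma derive_lipschitz_le g x v (L : R) : derivable g x v ->
  (\forall y \near x, `|g y - g x| <= L * enorm (y - x)) ->
  `|'D_v g x| <= L * enorm v.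
Proof.
move=> dg lg.
have /is_derive_cvgP/cvg_norm c := derivableP dg.
apply: (cvgr_to_le c).
have [e e0 he] := @near_line _ x v _ lg.
have := @dnbhs0_lt R R e e0; have := @nbhs_dnbhs_neq R 0.
apply: filterS2 => h h0 hlt.
have := he h hlt; rewrite (addrC x) addrK => k.
have hs : enorm (h *: v) = `|h| * enorm v.
  rewrite /enorm -sqrtr_sqr -sqrtrM ?sqr_ge0//; congr Num.sqrt.
  by rewrite /dotp /= /GRing.scale /=; ring.
rewrite hs in k; rewrite [_ *: _]/(_ * _) normrM normfV ler_pdivrMl ?normr_gt0//.
by rewrite mulrCA.
Qed.

Lemma enorm_le_abs x : enorm x <= `|x.1| + `|x.2|.
Proof.
rewrite -(@ler_pXn2r _ 2)// ?nnegrE ?enorm_ge0 ?addr_ge0// enorm_sqr /dotp.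
rewrite sqrrD !real_normK ?num_real// -!expr2 addrAC lerDl mulrn_wge0// mulr_ge0//.
Qed.

Lemma enorm_grad_le g x (L : R) : derivable g x (1, 0) -> derivable g x (0, 1) ->
  (\forall y \near x, `|g y - g x| <= L * enorm (y - x)) -> enorm (grad g x) <= 2 * L.
Proof.
move=> d1 d2 lg.
have e1 : enorm ((1, 0) : R * R) = 1 by rewrite /enorm /dotp /= mulr1 mulr0 addr0 sqrtr1.
have e2 : enorm ((0, 1) : R * R) = 1 by rewrite /enorm /dotp /= mulr1 mulr0 add0r sqrtr1.
have h1 := derive_lipschitz_le d1 lg; have h2 := derive_lipschitz_le d2 lg.
rewrite e1 mulr1 in h1; rewrite e2 mulr1 in h2.
apply: le_trans (enorm_le_abs _) _.
have -> : 2 * L = L + L by ring.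
exact: lerD h1 h2.
Qed.

Lemma Linfty_norm_grad_le g (N : set (R * R)) (L : R) :
  (@lebesgue_measure R \x @lebesgue_measure R)%E.-negligible N -> 0 <= L ->
  (forall x, ~ N x -> enorm (grad g x) <= L) -> (Linfty_norm_grad g <= L%:E)%E.
Proof.
move=> nN L0 hg; rewrite /Linfty_norm_grad unlock.
(* The norm of exponent +oo is an essential supremum if the whole space has positive measure, and 0
   otherwise. *)
case: ifPn => _; last by rewrite lee_fin.
apply/ess_supP; apply: negligibleS nN => x /=.
apply: contra_notP => nx; rewrite lee_fin ger0_norm ?enorm_ge0//; exact: hg.
Qed.

End GradientBound.

Section LinearPart.
Context {R : realType}.

Lemma harmonic_coord (p : R * R -> R) (a b : R) : C1_on setT p ->
  (forall x : R * R, is_derive x ((1, 0) : R * R) p a) ->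
  (forall x : R * R, is_derive x ((0, 1) : R * R) p b) ->
  harmonic_on setT p.
Proof.
move=> hp d1 d2.
have e1 x : setT x -> a = partial1 p x by move=> _; have [_ E] := d1 x; exact: esym E.
have e2 x : setT x -> b = partial2 p x by move=> _; have [_ E] := d2 x; exact: esym E.
split; first split.
- exact: hp.
- exact: C1_ext openT e1 (C1_cst a openT).
- exact: C1_ext openT e2 (C1_cst b openT).
- move=> x _; have [<- _] := partial_ext openT e1 (I : setT x).
  have [_ <-] := partial_ext openT e2 (I : setT x).
  have [_ Ea] := is_derive_const a x (1, 0); have [_ Eb] := is_derive_const b x (0, 1).
  by apply: etrans (congr2 +%R Ea Eb) _; rewrite addr0.
Qed.

Lemma linear_part_harmonic (H : R * R -> R) : harmonic_on setT (linear_part H).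
Proof.
have h1 : harmonic_on setT (fst : R * R -> R).
  by apply: (@harmonic_coord _ 1 0); [exact: C1_fst openT|move=> x; exact: is_derive_fst|move=> x; exact: is_derive_fst].
have h2 : harmonic_on setT (snd : R * R -> R).
  by apply: (@harmonic_coord _ 0 1); [exact: C1_snd openT|move=> x; exact: is_derive_snd|move=> x; exact: is_derive_snd].
have := harmonic_comb (grad H 0).1 (grad H 0).2 0 openT h1 h2.
by apply: harmonic_ext openT _ => x _; rewrite addr0.
Qed.

Lemma derivable_sub (f g : R * R -> R) x v :
  derivable f x v -> derivable g x v -> derivable (f \- g) x v.
Proof. exact: derivableB. Qed.

End LinearPart.

(** * Existence and the gradient bound for given circles *)

Section Assembly.
Context {R : realType}.
Variables (al ci ce ri re ki ke : R).
Hypotheses (al0 : 0 < al) (alci : al < ci) (cice : ci < ce).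
Hypotheses (ri0 : 0 < ri) (re0 : 0 < re).
Hypotheses (riE : ri ^+ 2 = rad2 al ci) (reE : re ^+ 2 = rad2 al ce).
Hypotheses (ki0 : 0 < ki) (ke0 : 0 < ke).
Implicit Types (H : R * R -> R).

(** From |x|^2 <= 2 |x - focus|^2 + 2 al^2. The ball about the focus, which moves with eps, is
    replaced with a ball about the origin that depends only on a bound [r] for al^2. *)
Let focus_ball r (x : R * R) : al ^+ 2 <= r -> dist2 (focus al) x <= 4 * re ^+ 2 ->
  dotp x x <= 8 * re ^+ 2 + 2 * r.
Proof.
rewrite /dist2 /focus /dotp /= => hr hx.
have : 0 <= (x.1 - 2 * al) ^+ 2 + x.2 ^+ 2 by rewrite addr_ge0// sqr_ge0.
lra.
Qed.

Let lip_focus H (r L : R) : al ^+ 2 <= r ->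
  (forall x y, dotp x x <= 8 * re ^+ 2 + 2 * r -> dotp y y <= 8 * re ^+ 2 + 2 * r ->
     `|H x - H y| <= L * enorm (x - y)) ->
  forall x y, dist2 (focus al) x <= 4 * re ^+ 2 ->
  dist2 (focus al) y <= 4 * re ^+ 2 -> `|H x - H y| <= L * enorm (x - y).
Proof. by move=> hr lH x y hx hy; apply: lH; exact: focus_ball. Qed.

Lemma image_solutionP H : harmonic_on setT H -> interface_solution ci ce ri re ki ke H (image_solution al ci ce ki ke H).
Proof.
move=> hH; have [L L0 lH] := C1_lipschitz (8 * re ^+ 2 + 2 * al ^+ 2) (harmonic_C1 hH).
have lf := lip_focus (lexx _) lH.
split.
- exact: image_solution_continuous.
- exact: image_solution_harmonic.
- exact: image_solution_flux_e.
- exact: image_solution_flux_i.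
- exact: (image_solution_decay al0 alci cice reE ki0 ke0 hH L0 lf).
Qed.

Lemma image_solution_grad_bound H (r L : R) : harmonic_on setT H -> 0 <= L -> al ^+ 2 <= r ->
  (forall x y, dotp x x <= 8 * re ^+ 2 + 2 * r -> dotp y y <= 8 * re ^+ 2 + 2 * r ->
     `|H x - H y| <= L * enorm (x - y)) ->
  (Linfty_norm_grad (image_solution al ci ce ki ke H \- H)%R <= (2 * grad_bound ki ke L)%:E)%E.
Proof.
move=> hH L0 hr lH; have lf := lip_focus hr lH.
apply: (@Linfty_norm_grad_le _ _ (interfaces ci ce ri re)).
- have -> : interfaces ci ce ri re = [set x | pencil al ci x = 0] `|` [set x | pencil al ce x = 0].
    by apply/seteqP; split => x [] h; [left; apply/(circleP x ri0 riE)|right; apply/(circleP x re0 reE)|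
      left; apply/(circleP x ri0 riE)|right; apply/(circleP x re0 reE)].
  by apply: negligibleU; exact: pencil_zero_negligible.
- by rewrite mulr_ge0//; exact: (grad_bound_ge0 ki0 ke0 L0).
- move=> x nx.
  have lx := image_solution_lipschitz al0 alci cice ri0 re0 riE reE ki0 ke0 hH L0 lf nx.
  have [_ hs _ _ _] := image_solutionP hH.
  have C1s := harmonic_C1 hs; have C1H := harmonic_C1 hH.
  have [d1 d2 _ _] := C1s x nx; have [k1 k2 _ _] := C1H x I.
  apply: enorm_grad_le lx.
  + exact: derivable_sub d1 k1.
  + exact: derivable_sub d2 k2.
Qed.

End Assembly.

Theorem theorem3p7 (R : realType) (r_i r_e : R) (k_i k_e : R)
    (H : R * R -> R)
    (r_i_gt0 : 0 < r_i) (r_i_lt_r_e : r_i < r_e)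
    (k_i_gt0 : 0 < k_i) (k_e_gt0 : 0 < k_e) (k_e_neq1 : k_e != 1)
    (H_harmonic : harmonic_on setT H) :
  let H1 := linear_part H in
  let H2 := H \- H1 in
  exists C eps0 : R, 0 < eps0 /\
    forall eps : R, 0 < eps -> eps < r_e - r_i ->
      exists u u1 u2 : R * R -> R,
        [/\ unique (transmission_solution r_i r_e eps k_i k_e H) u,
            unique (transmission_solution r_i r_e eps k_i k_e H1) u1,
            unique (transmission_solution r_i r_e eps k_i k_e H2) u2,
            (forall x, u x = u1 x + u2 x)
          & eps < eps0 -> (Linfty_norm_grad (u2 \- H2)%R < C%:E)%E].
Proof.
move=> H1 H2.
have r_e_gt0 : 0 < r_e by exact: lt_trans r_i_lt_r_e.
have hH1 : harmonic_on setT H1 by exact: linear_part_harmonic.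
have hH2 : harmonic_on setT H2.
  have := harmonic_comb 1 (-1) 0 openT H_harmonic hH1.
  by apply: harmonic_ext openT _ => x _; rewrite mul1r mulN1r addr0.
clearbody H1.
(* [L] is fixed before eps is introduced, which makes the final constant independent of eps; 4 r_e^2
   will bound al^2. *)
have [L L0 lH2] := C1_lipschitz (8 * r_e ^+ 2 + 2 * (4 * r_e ^+ 2)) (harmonic_C1 hH2).
(* The 1 makes the inequality strict. For eps below half of r_e - r_i, the distance [del] of the
   centres is at least that half, and this keeps [ci] bounded. *)
exists (2 * grad_bound k_i k_e L + 1), ((r_e - r_i) / 2).
split=> [|eps eps0 epsd]; first by rewrite divr_gt0// subr_gt0.
pose del := r_e - r_i - eps.
have del0 : 0 < del by rewrite /del subr_gt0.
pose ci := (r_e ^+ 2 - r_i ^+ 2 - del ^+ 2) / (2 * del).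
pose ce := ci + r_e - r_i - eps.
have d2 : 0 < 2 * del by rewrite mulr_gt0.
have ciE : 2 * del * ci = r_e ^+ 2 - r_i ^+ 2 - del ^+ 2.
  by rewrite /ci mulrC divfK// gt_eqF.
(* The origin lies outside the inner circle; the difference is a positive multiple of eps, so it is
   lost when the circles touch. *)
have r_ici : r_i < ci.
  rewrite -(ltr_pM2l d2) ciE -subr_gt0.
  have -> : r_e ^+ 2 - r_i ^+ 2 - del ^+ 2 - 2 * del * r_i = eps * (r_e + r_i + del).
    by rewrite /del; ring.
  by apply: mulr_gt0 => //; apply: addr_gt0 => //; exact: addr_gt0.
have ci0 : 0 < ci by exact: lt_trans r_ici.
have ceE : ce = ci + del by rewrite /ce /del; ring.
have rad0 : 0 < ci ^+ 2 - r_i ^+ 2 by rewrite subr_gt0 ltr_pXn2r// nnegrE ltW.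
(* The square is the power of the origin with respect to the inner circle. The formula for [ci] says
   exactly that its power with respect to the outer circle is the same, so both circles belong to
   one pencil. *)
pose al := Num.sqrt (ci ^+ 2 - r_i ^+ 2).
have al0 : 0 < al by rewrite sqrtr_gt0.
have al2 : al ^+ 2 = ci ^+ 2 - r_i ^+ 2 by rewrite sqr_sqrtr// ltW.
have riE : r_i ^+ 2 = rad2 al ci by rewrite /rad2 al2; ring.
have reE : r_e ^+ 2 = rad2 al ce by rewrite /rad2 al2 ceE; lra.
have alci : al < ci.
  rewrite -(@ltr_pXn2r _ 2)// ?nnegrE ?(ltW al0) ?(ltW ci0)// al2.
  by rewrite gtrBl exprn_gt0.
have cice : ci < ce by rewrite ceE ltrDl.
pose S H := interface_solution ci ce r_i r_e k_i k_e H.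
have ts G : harmonic_on setT G -> S G (image_solution al ci ce k_i k_e G).
  by move=> hG; exact: (image_solutionP al0 alci cice r_i_gt0 r_e_gt0 riE reE k_i_gt0 k_e_gt0 hG).
have un G u v : S G u -> S G v -> u = v.
  exact: (interface_solution_unique al0 alci cice r_i_gt0 r_e_gt0 riE reE k_i_gt0 k_e_gt0).
set u1 := image_solution al ci ce k_i k_e H1; set u2 := image_solution al ci ce k_i k_e H2.
have s1 : S H1 u1 by exact: ts.
have s2 : S H2 u2 by exact: ts.
have s : S H (fun x => 1 * u1 x + 1 * u2 x + 0).
  have := interface_solution_comb al0 alci cice r_i_gt0 r_e_gt0 riE reE 1 1 s1 s2.
  congr interface_solution; apply/funext => x; rewrite /H2 /=; ring.
exists (fun x => 1 * u1 x + 1 * u2 x + 0), u1, u2; split.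
- by split; [exact: s|move=> v sv; exact: un s sv].
- by split; [exact: s1|move=> v sv; exact: un s1 sv].
- by split; [exact: s2|move=> v sv; exact: un s2 sv].
- by move=> x; rewrite !mul1r addr0.
move=> epse.
apply: (@le_lt_trans _ _ (2 * grad_bound k_i k_e L)%:E); last by rewrite lte_fin ltrDl.
apply: (image_solution_grad_bound al0 alci cice r_i_gt0 r_e_gt0 riE reE k_i_gt0 k_e_gt0 hH2 L0 _ lH2).
rewrite al2; apply: (@le_trans _ _ ((2 * r_e) ^+ 2)); last by rewrite exprMn; lra.
apply: (@le_trans _ _ (ci ^+ 2)); first by rewrite gerBl sqr_ge0.
rewrite ler_pXn2r// ?nnegrE ?(ltW ci0)//; last by rewrite mulr_ge0// ltW.
(* It remains to see ci <= 2 r_e, which follows from r_e^2 - r_i^2 <= 2 del (r_e + r_i) <= 4 del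
   r_e. *)
have hd : (r_e - r_i) / 2 <= del by rewrite /del; lra.
rewrite -(ler_pM2l d2) ciE.
have h1 : 0 <= (2 * del - (r_e - r_i)) * (r_e + r_i).
  by apply: mulr_ge0; [lra|rewrite addr_ge0// ltW].
have h2 : 0 <= del ^+ 2 by exact: sqr_ge0.
have h3 : 0 <= del * (r_e - r_i) by apply: mulr_ge0; [exact: ltW|lra].
lra.
Qed.
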